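(* Let $n$ be a positive integer and let $A\subseteq\mathbb{R}^2$ be a (Lebesgue) measurable set of positive upper Banach density, i.e. $\overline{\delta}(A)>0$. Then there exists a number $\lambda_0(A,n)>0$ such that for every real number $\lambda\geq\lambda_0(A,n)$ the set $A$ contains an isometric copy of the distance graph $\lambda\cdot\Gamma_n$.
   Context: The upper Banach density of a measurable set $A\subseteq\mathbb{R}^2$ is $\overline{\delta}(A) := \limsup_{R\to\infty}\sup_{x\in\mathbb{R}^2}\frac{|A\cap(x+[0,R]^2)|}{R^2}$, where $|B|$ denotes the two-dimensional Lebesgue measure of $B$. $\Gamma_n$ denotes the distance graph given by the $1$-skeleton of an $n$-dimensional unit hypercube. For a real number $\lambda>0$, a set $A\subseteq\mathbb{R}^2$ is said to contain an isometric copy of $\lambda\cdot\Gamma_n$ if there exist a point $x\in\mathbb{R}^2$ and vectors $y_1,\ldots,y_n\in\mathbb{R}^2$, each of Euclidean length exactly $\lambda$, such that $x+r_1y_1+\cdots+r_ny_n\in A$ for all $2^n$ tuples $(r_1,\ldots,r_n)\in\{0,1\}^n$ and these $2^n$ points are mutually distinct. *)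

(* Defs.v *)
From HB Require Import structures.
From mathcomp Require Import all_boot all_order all_algebra.
From mathcomp Require Import all_classical all_reals all_analysis.
Set Implicit Arguments.
Unset Strict Implicit.
Unset Printing Implicit Defensive.
Import Order.TTheory GRing.Theory Num.Theory.
Import numFieldNormedType.Exports.
Local Open Scope classical_set_scope.
Local Open Scope ring_scope.

Section plane.
Variable R : realType.

(* The product measure is only meaningful on Borel sets; the Lebesgue
   measurable sets and their measure are obtained from the outer measure
   that it induces, by Caratheodory's construction (i.e., by completion). *)
Definition borel_measure2 : {measure set (measurableTypeR R * measurableTypeR R) -> \bar R} :=
  (@lebesgue_measure R \x @lebesgue_measure R)%E.

Definition lebesgue_measurable2 : set (set (R * R)) :=
  (borel_measure2^*)%mu.-cara.-measurable.

Definition lebesgue_measure2 : set (R * R) -> \bar R :=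
  @completed_measure_extension _ _ _ borel_measure2.

Definition square (x : R * R) (r : R) : set (R * R) :=
  `[x.1, x.1 + r] `*` `[x.2, x.2 + r].

Definition upper_banach_density (A : set (R * R)) : \bar R :=
  limf_esup
    (fun r : R =>
       ereal_sup [set (lebesgue_measure2 (A `&` square x r) / (r ^+ 2)%:E)%E
                 | x in [set: R * R]])
    +oo_R.

(* The library norm `|v| on R * R is the sup norm. *)
Definition euclidean_norm (v : R * R) : R := Num.sqrt (v.1 ^+ 2 + v.2 ^+ 2).

Definition cube_vertex (n : nat) (x : R * R) (y : 'I_n -> R * R)
    (r : {ffun 'I_n -> bool}) : R * R :=
  x + \sum_(i < n) (r i)%:R *: y i.

Definition contains_cube_graph (n : nat) (lambda : R) (A : set (R * R)) : Prop :=
  exists (x : R * R) (y : 'I_n -> R * R),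
    [/\ forall i, euclidean_norm (y i) = lambda,
        forall r, A (cube_vertex x y r) &
        injective (cube_vertex x y)].

End plane.

(* Main.v *)
(* Suppose that arbitrarily large scales fail; pick failing scales that grow as
   fast as needed. In a large square W where A has positive density, replace A
   by a union of cells of a fine grid of mesh W / N, so that the problem lives
   on a finite torus whose indicator functions hardly change under a unit
   horizontal step. There, G being the indicator of the good cells, average
   the product of G over the 2^n vertices x + sum_i r_i y_i, where y_i runs over
   a short arc of the circle of radius l, at heights between 4^-(i+2) l and
   twice that.

   Translating G by a vector of size at most eps l hardly changes its average
   along an arc: by Cauchy-Schwarz this is a statement about chords of the arc,
   and a horizontal displacement of a chord is traded, by the curvature of the
   circle, for a change of its position on the arc. Hence the arc averages can
   be replaced by averages over boxes unless the box averages carry much more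
   energy at scale eps l than at scale C l. The energies decrease with the scale
   and are bounded, so this fails for one of the chosen scales, and for the box
   averages the cube count is at least density^(2^n), as for Gowers norms.

   A cube of good cells yields a cube of points of A, as almost every point of
   each of these cells is in A. Its vertices are distinct because their second
   coordinates are distinct subset sums of a superincreasing sequence. *)

Require Import Defs.
From HB Require Import structures.
From mathcomp Require Import all_boot all_order all_algebra.
From mathcomp Require Import all_classical all_reals all_analysis.
From mathcomp Require Import measurable_realfun.
From mathcomp Require Import archimedean zify ring lra.
Set Implicit Arguments.
Unset Strict Implicit.
Unset Printing Implicit Defensive.
Import Order.TTheory GRing.Theory Num.Theory.
Import numFieldNormedType.Exports.
Local Open Scope classical_set_scope.
Local Open Scope ring_scope.

(** * Arcs of circles and their lattice approximations *)

(** All directions but one are frozen: the product of [G] over the remaining cube is one function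
    [H], and the last direction enters only through the autocorrelation [corr H]. Adding a direction
    at most doubles the change under a horizontal step, so one estimate for a single arc serves
    every [H]. The obstacle is that this estimate loses the energy drop of each [H], and there are
    far too many [H] for a pigeonhole over scales; only the cube count of box measures can be
    pigeonholed. But an arc convolved with a box measure of scale eps l is dominated by a constant
    times the box measure of scale C l, and energy drops are nonnegative. So the mean drop over
    mixed cubes is at most a constant times the drop of that one count. Almost invariance pays for
    rounding: abscissae on the arc are rounded down to integers, which moves a difference of two
    points by boundedly many horizontal steps. In the plane a vertex adds up to n rounded vectors
    and so lies in one of n + 1 consecutive cells; hence the runs of n + 1 good cells. *)

Section circle.
Variable R : archiRcfType.
Implicit Types l x i h : R.

Definition arc l x : R := Num.sqrt (l ^+ 2 - x ^+ 2).

Lemma arc_ge0 l x : 0 <= arc l x. Proof. exact: sqrtr_ge0. Qed.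

Lemma arc_sqr l x : 0 <= x <= l -> arc l x ^+ 2 = l ^+ 2 - x ^+ 2.
Proof. by move=> ?; rewrite sqr_sqrtr//; nra. Qed.

Lemma arc_le l x : 0 <= l -> arc l x <= l.
Proof.
move=> l0; rewrite -[leRHS](ger0_norm l0) -sqrtr_sqr ler_wsqrtr//.
by rewrite gerBl sqr_ge0.
Qed.

(** At height [3 * l / 5] the triangle with sides 3, 4, 5 appears; below it the slope [x / arc l x]
    is at most 3/4, the constant of [arc_slope]. *)
Lemma arc_lb l x : 0 <= x -> 5 * x <= 3 * l -> 4 * l <= 5 * arc l x.
Proof.
move=> x0 xl; have := @arc_sqr l x; have := arc_ge0 l x => a0 /(_ ltac:(nra)) e.
rewrite leNgt; apply/negP => h; nra.
Qed.

Lemma arc_slope l x h : 0 < l -> 0 <= x -> 0 <= h -> 5 * (x + h) <= 3 * l ->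
  0 <= arc l x - arc l (x + h) <= 3 / 4 * h.
Proof.
move=> l0 x0 h0 xl.
have e1 := @arc_sqr l x ltac:(nra); have e2 := @arc_sqr l (x + h) ltac:(nra).
have b1 := @arc_lb l x x0 ltac:(nra); have b2 := @arc_lb l (x + h) ltac:(nra) xl.
move: (arc l x) (arc l (x + h)) e1 e2 b1 b2 => a b e1 e2 b1 b2.
have e : (a - b) * (a + b) = (2 * x + h) * h by nra.
have p : 8 * l <= 5 * (a + b) by lra.
have ab : 0 <= a - b.
  rewrite -(@pmulr_lge0 _ (a + b)); last by lra.
  by rewrite e; nra.
rewrite ab /=; have : (a - b) * (8 * l) <= 6 * l * h by nra.
by rewrite mulrCA -mulrA; nra.
Qed.

(** Discrete curvature. Multiplied by [a + b], the mixed second difference becomes that of the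
    squares, [2 * h * i], plus a product of slopes that [arc_slope] bounds by [9 / 8 * (h * i)]; and
    [a + b] lies between [8 * l / 5] and [2 * l]. *)
Lemma arc_curv l x i h : 0 < l -> 0 <= x -> 0 <= i -> 0 <= h ->
  5 * (x + i + h) <= 3 * l ->
  i * h / l <= arc l (x + i) + arc l (x + h) - arc l x - arc l (x + i + h)
    <= 2 * (i * h / l).
Proof.
move=> l0 x0 i0 h0 xl.
have e1 := @arc_sqr l x ltac:(nra); have e2 := @arc_sqr l (x + i) ltac:(nra).
have e3 := @arc_sqr l (x + h) ltac:(nra).
have e4 := @arc_sqr l (x + i + h) ltac:(nra).
have b1 := @arc_lb l x x0 ltac:(nra).
have b2 := @arc_lb l (x + i) ltac:(nra) ltac:(nra).
have l1 := @arc_le l x ltac:(nra).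
have l2 := @arc_le l (x + i) ltac:(nra).
have /andP[s1 s1'] := @arc_slope l x h l0 x0 h0 ltac:(nra).
have /andP[s2 s2'] := @arc_slope l (x + i) h l0 ltac:(nra) h0 xl.
have /andP[s3 s3'] := @arc_slope l (x + h) i l0 ltac:(nra) i0 ltac:(nra).
rewrite [x + h + i]addrAC in s3 s3'.
move: (arc l x) (arc l (x + i)) (arc l (x + h)) (arc l (x + i + h))
  e1 e2 e3 e4 b1 b2 l1 l2 s1 s1' s2 s2' s3 s3'
  => a b c d e1 e2 e3 e4 b1 b2 l1 l2 s1 s1' s2 s2' s3 s3'.
have E : (c - d - (a - b)) * (a + b) =
    2 * h * i + (c - d) * ((a - c) + (b - d)) by nra.
have hi : 0 <= h * i by nra.
have lo : 0 <= (c - d) * ((a - c) + (b - d)) by nra.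
have up : (c - d) * ((a - c) + (b - d)) <= 9 / 8 * (h * i) by nra.
rewrite -mulrA in E.
have D0 : 0 <= c - d - (a - b).
  rewrite -(@pmulr_lge0 _ (a + b)); last by lra.
  by rewrite E; lra.
have -> : b + c - a - d = c - d - (a - b) by ring.
move: (c - d - (a - b)) D0 E => D D0 E.
rewrite mulrA ler_pdivrMr// ler_pdivlMr//.
by apply/andP; split; nra.
Qed.

End circle.

Section shifted_blocks.
Variable R : realFieldType.

Lemma sum_nat_diff_le (Psi : nat -> R) (x y : nat) :
  (forall u, `|Psi u| <= 1) ->
  `|\sum_(u < x) Psi u - \sum_(u < y) Psi u| <= `|x%:R - y%:R|.
Proof.
move=> P1; wlog xy : x y / (x <= y)%N => [hw|].
  by case: (leqP x y) => [/hw//|/ltnW/hw]; rewrite distrC [X in _ <= X]distrC.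
rewrite distrC [X in _ <= X]distrC -!(big_mkord xpredT Psi).
rewrite (big_cat_nat (n := x))//= [X in X - _]addrC addrK.
rewrite -natrB// [leRHS]ger0_norm ?ler0n//.
apply: le_trans (ler_norm_sum _ _ _) _.
apply: le_trans (ler_sum _ (fun u _ => P1 u)) _.
by rewrite big_const_nat iter_addr addr0.
Qed.

Lemma sum_blocks (F : nat -> R) (a w nb : nat) :
  \sum_(i < nb) \sum_(j < w) F (a + i * w + j)%N =
  \sum_(a <= u < a + nb * w) F u.
Proof.
elim: nb => [|nb IH]; first by rewrite big_ord0 mul0n addn0 big_geq.
rewrite big_ord_recr/= IH [RHS](@big_cat_nat _ _ _ (a + nb * w)%N) ?leq_addr ?mulSn//=; last first.
  by rewrite leq_add2l leq_addl.
congr (_ + _); rewrite -{2}[(a + nb * w)%N]add0n big_addn.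
have -> : (a + (w + nb * w) - (a + nb * w) = w)%N by lia.
by rewrite big_mkord; apply: eq_bigr => j _; congr F; rewrite addnC.
Qed.

(* The inner sums telescope in the antiderivative of [Psi], so that only the
   variation of the shift [q] contributes. *)
Lemma shifted_blocks (Psi : nat -> R) (a w nb Q : nat) (q : nat -> nat) (B : R) :
  0 <= B -> (forall u, `|Psi u| <= 1) -> (Q <= a)%N ->
  (forall i, (i < nb)%N -> (q i <= Q)%N) ->
  (forall i, (i.+1 < nb)%N -> `|(q i.+1)%:R - (q i)%:R| <= B) ->
  `|\sum_(i < nb) \sum_(j < w)
      (Psi (a + i * w + j - q i)%N - Psi (a + i * w + j)%N)| <=
    2 * Q%:R + nb%:R * B.
Proof.
move=> B0 P1 Qa qQ qB.
pose S x := \sum_(u < x) Psi u.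
pose D i x := S (x - q i)%N - S x.
have Sle x y : `|S x - S y| <= `|x%:R - y%:R| by exact: sum_nat_diff_le.
have Dle i x : (i < nb)%N -> (Q <= x)%N -> `|D i x| <= Q%:R.
  move=> ib Qx; apply: le_trans (Sle _ _) _.
  have qx : (q i <= x)%N by apply: leq_trans (qQ _ ib) Qx.
  by rewrite natrB// addrAC subrr add0r normrN ger0_norm// ler_nat qQ.
have T i : (i < nb)%N ->
    \sum_(j < w) (Psi (a + i * w + j - q i)%N - Psi (a + i * w + j)%N) =
    D i (a + i.+1 * w)%N - D i (a + i * w)%N.
  move=> ib; rewrite sumrB.
  have qa : (q i <= a)%N by apply: leq_trans (qQ _ ib) Qa.
  have aux b : \sum_(j < w) Psi (b + j)%N = S (b + w)%N - S b.
    rewrite /S -!(big_mkord xpredT Psi) (big_cat_nat (n := b)) ?leq_addr//=.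
    rewrite addrAC subrr add0r -{2}[b]add0n big_addn addKn big_mkord.
    by apply: eq_bigr => j _; rewrite addnC.
  rewrite aux; under eq_bigr => j _.
    have -> : (a + i * w + j - q i = (a + i * w - q i) + j)%N by lia.
    over.
  rewrite aux /D mulSn.
  have -> : (a + i * w - q i + w = a + (w + i * w) - q i)%N by lia.
  have -> : (a + i * w + w = a + (w + i * w))%N by lia.
  ring.
case: nb => [|nb] in qQ qB Dle T *.
  by rewrite big_ord0 normr0 mul0r addr0 mulr_ge0.
(* Consecutive blocks share an end point, where [D k] and [D k.+1] differ by at most the change of
   [q]. The two outer boundary terms cost [Q] each. *)
have K k : (k <= nb)%N ->
  `|\sum_(i < k.+1) (D i (a + i.+1 * w)%N - D i (a + i * w)%N)
     - D k (a + k.+1 * w)%N + D 0%N a| <= k%:R * B.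
  elim: k => [_|k IH kn].
    rewrite big_ord1/= mul0n addn0 mul0r (_ : _ + _ = 0) ?normr0//; ring.
  rewrite big_ord_recr/=.
  set s := \sum_(i < k.+1) _ in IH *.
  rewrite (_ : _ + _ = (s - D k (a + k.+1 * w)%N + D 0%N a) +
    (D k (a + k.+1 * w)%N - D k.+1 (a + k.+1 * w)%N)); last by ring.
  apply: le_trans (ler_normD _ _) _.
  rewrite -natr1 mulrDl mul1r; apply: lerD; first by apply: IH; exact: ltnW.
  rewrite /D opprB addrA subrK.
  apply: le_trans (Sle _ _) _.
  have q1 : (q k.+1 <= a + k.+1 * w)%N.
    by apply: leq_trans (qQ _ _) (leq_trans Qa (leq_addr _ _)).
  have q2 : (q k <= a + k.+1 * w)%N.
    by apply: leq_trans (qQ _ (ltnW _)) (leq_trans Qa (leq_addr _ _)).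
  rewrite !natrB//; set u := (_ + _)%:R.
  have -> : u - (q k)%:R - (u - (q k.+1)%:R) = (q k.+1)%:R - (q k)%:R by ring.
  exact: qB.
under eq_bigr => i _ do rewrite T//.
have := K nb (leqnn _).
set s := \sum_(i < nb.+1) _; set x := D nb _; set y := D 0%N a => h.
have hx : `|x| <= Q%:R by apply: Dle => //; rewrite (leq_trans Qa)// leq_addr.
have hy : `|y| <= Q%:R by apply: Dle.
have -> : s = (s - x + y) + (x - y) by ring.
apply: le_trans (ler_normD _ _) _.
have : `|x - y| <= Q%:R + Q%:R by apply: le_trans (ler_normB _ _) (lerD hx hy).
have : nb%:R * B <= nb.+1%:R * B by rewrite ler_wpM2r// ler_nat.
lra.
Qed.

End shifted_blocks.

Section chords.
Variable R : archiRcfType.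
Variable l : R.
Hypothesis l0 : 0 < l.

Definition farc (u : nat) : nat := Num.truncn (arc l u%:R).

Lemma farc_itv u : (farc u)%:R <= arc l u%:R < (farc u)%:R + 1.
Proof. by rewrite natr1; apply: truncn_itv; exact: arc_ge0. Qed.

(* The horizontal extent of the chord joining the points of the arc at heights
   [u] and [u + p]. *)
Let chord (p u : nat) : R := arc l u%:R - arc l (u + p)%:R.

Let chord_curv (p u i : nat) : 5 * (u + i + p)%:R <= 3 * l ->
  i%:R * p%:R / l <= chord p (u + i)%N - chord p u <= 2 * (i%:R * p%:R / l).
Proof.
rewrite /chord !natrD => ul.
have := @arc_curv _ l u%:R i%:R p%:R l0 (ler0n _ _) (ler0n _ _) (ler0n _ _) ul.
by move=> /andP[h1 h2]; apply/andP; split; lra.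
Qed.

Let chord_le (p u : nat) : 5 * (u + p)%:R <= 3 * l -> 0 <= chord p u <= p%:R.
Proof.
rewrite /chord !natrD => ul.
have := @arc_slope _ l u%:R p%:R l0 (ler0n _ _) (ler0n _ _) ul.
by have := ler0n R p; move=> p0 /andP[h1 h2]; apply/andP; split; lra.
Qed.

(** A discrete intermediate value argument. By curvature, lowering the chord by [q] shortens its
    extent by at least [q * p / l], so a decrease by at most [t1 + t2] is reached for some [q <= Q];
    a single step changes the extent by at most [2 * p / l <= 2]. *)
Lemma chord_shift (p t1 t2 Q u : nat) :
  (t1 + t2)%:R * l <= Q%:R * p%:R -> (Q <= u)%N -> 5 * (u + p + t2)%:R <= 3 * l ->
  exists2 q, (q <= Q)%N &
    `|chord p (u - q)%N - (chord p u - t1%:R - chord t2 u)| <= 2.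
Proof.
move=> tQ Qu ul.
have pl : p%:R <= l.
  have : p%:R <= (u + p + t2)%:R :> R by rewrite ler_nat; lia.
  by have := ler0n R p; lra.
have /andP[c0 ct] : 0 <= chord t2 u <= t2%:R.
  apply: chord_le; apply: le_trans ul; rewrite ler_wpM2l// ler_nat; lia.
pose tau := t1%:R + chord t2 u.
have tau0 : 0 <= tau by rewrite addr_ge0.
pose P q := (q <= Q)%N && (chord p (u - q)%N <= chord p u - tau).
have PQ : P Q.
  rewrite /P leqnn/=.
  have := @chord_curv p (u - Q)%N Q; rewrite subnK// => /(_ _)/andP[].
    by apply: le_trans ul; rewrite ler_wpM2l// ler_nat; lia.
  move=> h _; have : (t1 + t2)%:R <= Q%:R * p%:R / l by rewrite ler_pdivlMr.
  rewrite natrD /tau; lra.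
have exP : exists q, P q by exists Q.
case: (ex_minnP exP) => q /andP[qQ hq] qmin.
exists q => //.
have -> : chord p u - t1%:R - chord t2 u = chord p u - tau by rewrite /tau; ring.
case: q => [|q] in qQ hq qmin *.
  move: hq; rewrite subn0 => hq.
  have -> : tau = 0 by lra.
  by rewrite subr0 subrr normr0.
have hq' : chord p u - tau < chord p (u - q)%N.
  rewrite ltNge; apply/negP => hh.
  by have := qmin q; rewrite /P hh (ltnW qQ)/= ltnn => /(_ isT).
have := @chord_curv p (u - q.+1)%N 1%N.
rewrite (_ : (u - q.+1 + 1 = u - q)%N); last by lia.
move=> /(_ _)/andP[].
  by apply: le_trans ul; rewrite ler_wpM2l// ler_nat; lia.
move=> _; rewrite mul1r => h.
have : p%:R / l <= 1 by rewrite ler_pdivrMr// mul1r.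
rewrite ler_norml; move: hq hq' h; lra.
Qed.

Lemma lip_int (chi : int -> R) (zeta : R) :
  (forall t, `|chi (t + 1) - chi t| <= zeta) ->
  forall s t : int, `|chi s - chi t| <= `|s - t|%:~R * zeta.
Proof.
move=> lip.
have nn (t : int) (n : nat) : `|chi (t + n%:Z) - chi t| <= n%:R * zeta.
  elim: n => [|n IH]; first by rewrite addr0 subrr normr0 mul0r.
  rewrite -addn1 PoszD addrA; apply: le_trans (ler_distD (chi (t + n%:Z)) _ _) _.
  by rewrite natrD mulrDl mul1r [leRHS]addrC; apply: lerD.
move=> s t; wlog st : s t / t <= s => [hw|].
  have [/hw//|/ltW/hw h] := leP t s.
  by rewrite (distrC (chi s)) (distrC s).
have e : s = t + `|s - t|%N%:Z by lia.
by have := nn t `|s - t|%N; rewrite -e pmulrn abszE.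
Qed.

(** Both terms belong to the same vertical displacement [p]; only the horizontal one, seen by [chi],
    differs. [chord_shift] makes up for it by lowering the chord by [q], and with [q] frozen on
    blocks of length [w] the rest is [shifted_blocks]. The errors come from rounding, from the ends
    of the range and from the jumps of [q]. *)
Lemma chord_sum (chi : int -> R) (zeta : R) (p t1 t2 Q a w nb : nat) :
  0 <= zeta -> (forall t, `|chi t| <= 1) ->
  (forall t, `|chi (t + 1) - chi t| <= zeta) ->
  (0 < p)%N -> (t1 + t2)%:R * l <= Q%:R * p%:R -> (Q <= a)%N ->
  2 * w%:R * (Q + t2)%:R <= l -> 5 * (a + nb * w + p + t2)%:R <= 3 * l ->
  `|\sum_(a <= u < a + nb * w)
      (chi ((farc (u + p))%:Z - (farc (u + t2))%:Z + t1%:Z)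
       - chi ((farc (u + p))%:Z - (farc u)%:Z))| <=
  7 * zeta * (nb * w)%:R + 2 * Q%:R + nb%:R * (6 * l / p%:R).
Proof.
move=> z0 chi1 chiz p0 tQ Qa wQ al.
have pR : 0 < p%:R :> R by rewrite ltr0n.
pose c i r := `|chord p (a + i * w - r)%N -
  (chord p (a + i * w)%N - t1%:R - chord t2 (a + i * w)%N)| <= 2.
pose q i := find (c i) (iota 0 Q.+1).
have [qQ q2] : (forall i, (i < nb)%N -> (q i <= Q)%N) /\
    (forall i, (i < nb)%N -> `|chord p (a + i * w - q i)%N -
      (chord p (a + i * w)%N - t1%:R - chord t2 (a + i * w)%N)| <= 2).
  suff h i : (i < nb)%N -> (q i < Q.+1)%N /\ `|chord p (a + i * w - q i)%N -
      (chord p (a + i * w)%N - t1%:R - chord t2 (a + i * w)%N)| <= 2.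
    by split=> i /h[].
  move=> ib.
  have [r rQ hr] : exists2 r, (r <= Q)%N & `|chord p (a + i * w - r)%N -
      (chord p (a + i * w)%N - t1%:R - chord t2 (a + i * w)%N)| <= 2.
    apply: chord_shift => //; first by lia.
    apply: le_trans al; rewrite ler_wpM2l// ler_nat.
    by rewrite !leq_add2r leq_add2l leq_mul2r (ltnW ib) orbT.
  have hc : has (c i) (iota 0 Q.+1).
    by apply/hasP; exists r => //; rewrite mem_iota.
  have qlt : (q i < Q.+1)%N by rewrite -[X in (_ < X)%N](size_iota 0) -has_find.
  by split => //; have := nth_find 0%N hc; rewrite nth_iota.
clearbody q; clear c.
(* Over one block the chords drift by at most 1, so the error 2 at its start becomes 3 in
   [drift]. *)
have wl : 2 * (w%:R * Q%:R / l) + 2 * (w%:R * t2%:R / l) <= 1.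
  rewrite -mulrDr -mulrDl -mulrDr mulrA ler_pdivrMr// mul1r.
  by move: wQ; rewrite natrD !mulrA.
have drift i j : (i < nb)%N -> (j <= w)%N ->
  `|chord p (a + i * w + j - q i)%N -
    (chord p (a + i * w + j)%N - t1%:R - chord t2 (a + i * w + j)%N)| <= 3.
  move=> ib jw.
  have iw : (i * w + w <= nb * w)%N.
    by rewrite addnC -mulSn leq_mul2r ib orbT.
  have ra (n : nat) : (n <= a + nb * w + p + t2)%N -> 5 * n%:R <= 3 * l.
    by move=> h; apply: le_trans al; rewrite ler_wpM2l// ler_nat.
  have q2i := q2 i ib; have qa := qQ i ib.
  set b := (a + i * w)%N in q2i *.
  have [qb bw] : (q i <= b)%N /\ (b + w <= a + nb * w)%N.
    by rewrite /b; clear -qa Qa iw; lia.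
  clearbody b.
  have [r1 r2 r3] : [/\ (b - q i + j + q i <= a + nb * w + p + t2)%N,
      (b - q i + p + j + q i <= a + nb * w + p + t2)%N &
      (b + j + t2 <= a + nb * w + p + t2)%N].
    by clear -qb bw jw; split; lia.
  have [e1 e2 e3 [e4 e5]] : [/\ (b - q i + j + q i = b + j)%N,
      (b - q i + p + q i = b + p)%N,
      (b - q i + p + j + q i = b + j + p)%N &
      (b + j - q i = b - q i + j)%N /\ (b - q i + j + p = b - q i + p + j)%N].
    by clear -qb; split; lia.
  have := @arc_curv _ l (b - q i)%:R j%:R (q i)%:R l0 (ler0n _ _) (ler0n _ _) (ler0n _ _).
  rewrite -!natrD subnK// => /(_ (ra _ r1)); rewrite e1 => h1.
  have := @arc_curv _ l (b - q i + p)%:R j%:R (q i)%:R l0 (ler0n _ _) (ler0n _ _) (ler0n _ _).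
  rewrite -!natrD => /(_ (ra _ r2)); rewrite e2 e3 => h2.
  have h3 := @chord_curv t2 b j (ra _ r3).
  move: q2i h3; rewrite /chord e4 e5 => h0 h3.
  have k1 : j%:R * (q i)%:R / l <= w%:R * Q%:R / l.
    by rewrite ler_pM2r ?invr_gt0// -!natrM ler_nat leq_mul.
  have k2 : j%:R * t2%:R / l <= w%:R * t2%:R / l.
    by rewrite ler_pM2r ?invr_gt0// -!natrM ler_nat leq_mul.
  have k3 : 0 <= j%:R * (q i)%:R / l by rewrite divr_ge0 ?mulr_ge0 ?ler0n// ltW.
  have k4 : 0 <= j%:R * t2%:R / l by rewrite divr_ge0 ?mulr_ge0 ?ler0n// ltW.
  move: h0; rewrite !ler_norml; move: h1 h2 h3 wl k1 k2 k3 k4; clear; lra.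
pose Psi u := chi ((farc (u + p))%:Z - (farc u)%:Z).
pose Phi u := chi ((farc (u + p))%:Z - (farc (u + t2))%:Z + t1%:Z).
rewrite -/Phi -/Psi.
(* 7 is the error 3 of [drift] plus four roundings of less than 1 each. *)
have close i j : (i < nb)%N -> (j < w)%N ->
  `|Phi (a + i * w + j)%N - Psi (a + i * w + j - q i)%N| <= 7 * zeta.
  move=> ib jw; apply: le_trans (lip_int chiz _ _) _.
  rewrite ler_wpM2r// -[leRHS]/(7%:~R) ler_int.
  have := drift i j ib (ltnW jw); rewrite /chord.
  set u := (a + i * w + j)%N; set v := (u - q i)%N.
  have := farc_itv (u + p); have := farc_itv (u + t2).
  have := farc_itv (v + p); have := farc_itv v.
  set x1 := farc _; set x2 := farc _; set x3 := farc _; set x4 := farc _.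
  move=> h1 h2 h3 h4 h5.
  rewrite -(ler_int R) intr_norm !rmorphD/= !rmorphN/= rmorphB/=.
  move: h5; rewrite !ler_norml -!pmulrn; move: h1 h2 h3 h4; clear; lra.
(* At the common end [b] of two blocks both shifts bring the chord to within 3 of the same value,
   and the chord changes by at least [p / l] per unit of shift. *)
have jump i : (i.+1 < nb)%N -> `|(q i.+1)%:R - (q i)%:R| <= 6 * l / p%:R.
  move=> ib.
  have d1 := drift i w (ltnW ib) (leqnn _).
  have d2 := q2 _ ib.
  have e : (a + i.+1 * w = a + i * w + w)%N by rewrite mulSn addnCA addnC.
  rewrite e in d2; set b := (a + i * w + w)%N in d1 d2.
  have iw : (i.+1 * w <= nb * w)%N by rewrite leq_mul2r (ltnW ib) orbT.
  have bQ : (Q <= b)%N by rewrite /b; clear -Qa; lia.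
  have bw : (b <= a + nb * w)%N by rewrite /b -addnA [(_ * w + _)%N]addnC -mulSn leq_add2l.
  have qq (r s : nat) : (r <= s)%N -> (s <= Q)%N ->
      (s - r)%:R * p%:R / l <= chord p (b - r)%N - chord p (b - s)%N.
    move=> rs sQ; have := @chord_curv p (b - s)%N (s - r)%N.
    have [-> e1] : (b - s + (s - r) = b - r)%N /\ (b - r + p <= a + nb * w + p + t2)%N.
      by clear -rs sQ bQ bw; lia.
    move=> /(_ _)/andP[]//.
    by apply: le_trans al; rewrite ler_wpM2l// ler_nat.
  have d3 : `|chord p (b - q i)%N - chord p (b - q i.+1)%N| <= 6.
    move: d1 d2; rewrite !ler_norml; clear; lra.
  rewrite ler_pdivlMr//.
  have [qi|qi] := leP (q i) (q i.+1).
    have := qq _ _ qi (qQ _ ib).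
    rewrite natrB// ler_pdivrMr// ger0_norm ?subr_ge0 ?ler_nat//.
    move: d3; rewrite ler_norml; move: l0; clear; nra.
  have := qq _ _ (ltnW qi) (qQ _ (ltnW ib)).
  rewrite natrB 1?ltnW// ler_pdivrMr// distrC ger0_norm ?subr_ge0 ?ler_nat 1?ltnW//.
  move: d3; rewrite ler_norml; move: l0; clear; nra.
have B0 : 0 <= 6 * l / p%:R by rewrite divr_ge0// ?mulr_ge0// ltW.
have main := @shifted_blocks _ Psi a w nb Q q _ B0 (fun u => chi1 _) Qa qQ jump.
rewrite -sum_blocks.
have -> : \sum_(i < nb) \sum_(j < w) (Phi (a + i * w + j)%N - Psi (a + i * w + j)%N) =
   \sum_(i < nb) \sum_(j < w) (Phi (a + i * w + j)%N - Psi (a + i * w + j - q i)%N) +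
   \sum_(i < nb) \sum_(j < w) (Psi (a + i * w + j - q i)%N - Psi (a + i * w + j)%N).
  rewrite -big_split/=; apply: eq_bigr => i _.
  by rewrite -big_split/=; apply: eq_bigr => j _; rewrite addrA subrK.
apply: le_trans (ler_normD _ _) _; rewrite -addrA; apply: lerD main.
apply: le_trans (ler_norm_sum _ _ _) _.
have -> : 7 * zeta * (nb * w)%:R = \sum_(i < nb) \sum_(j < w) 7 * zeta.
  by rewrite !sumr_const !card_ord -mulrnA mulnC mulr_natr.
apply: ler_sum => i _; apply: le_trans (ler_norm_sum _ _ _) _.
by apply: ler_sum => j _; apply: close.
Qed.

End chords.

(** * Averages over finite abelian groups *)

Section double_sums.
Variable R : realFieldType.

(** Pairs are regrouped by their difference [p], because the chord estimates keep [p] fixed. *)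
Lemma sum_triangle (C : nat -> nat -> R) (a M : nat) :
  \sum_(a <= k < a + M) \sum_(a <= l < k) C l k =
  \sum_(1 <= p < M) \sum_(a <= l < a + (M - p)) C l (l + p)%N.
Proof.
elim: M => [|M IH]; first by rewrite addn0 big_geq// big_geq.
rewrite addnS big_nat_recr ?leq_addr//= IH.
have -> : \sum_(1 <= p < M.+1) \sum_(a <= l < a + (M.+1 - p)) C l (l + p)%N =
  \sum_(1 <= p < M.+1) (\sum_(a <= l < a + (M - p)) C l (l + p)%N + C (a + (M - p))%N (a + M)%N).
  apply: eq_big_nat => p /andP[p1 pM].
  rewrite subSn// addnS big_nat_recr ?leq_addr//=.
  by congr (_ + C _ _); rewrite -addnA subnK.
rewrite big_split/=; congr (_ + _).
  case: M {IH} => [|M]; first by rewrite !big_geq.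
  by rewrite [RHS]big_nat_recr//= subnn addn0 [X in _ + X]big_geq// addr0.
rewrite big_add1/= -{1}[a]add0n big_addn addKn [RHS]big_nat_rev/=.
apply: eq_big_nat => p /andP[_ pM].
by rewrite add0n subnSK// subKn ?(ltnW pM)// addnC.
Qed.

Lemma sqr_sum_nat (h : nat -> R) (a M : nat) :
  (\sum_(a <= u < a + M) h u) ^+ 2 = \sum_(a <= u < a + M) h u ^+ 2 +
    2 * \sum_(a <= k < a + M) \sum_(a <= l < k) h k * h l.
Proof.
elim: M => [|M IH].
  by rewrite addn0 !big_geq// expr0n/= mulr0 addr0.
rewrite addnS !big_nat_recr ?leq_addr//= sqrrD IH.
rewrite mulrDr -mulr_sumr; set s := \sum_(_ <= _ < _) h _.
set s2 := \sum_(_ <= _ < _) _ ^+ 2; set s3 := \sum_(_ <= _ < _) \sum_(_ <= _ < _) _.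
rewrite -mulr_natl; ring.
Qed.

Lemma sum_nat_shift_le (F : nat -> R) (a k t : nat) :
  (forall u, `|F u| <= 1) ->
  `|\sum_(a <= u < k) F (u + t)%N - \sum_(a <= u < k) F u| <= 2 * t%:R.
Proof.
move=> F1; have [ak|ak] := leqP a k; last first.
  by rewrite !big_geq 1?ltnW// subrr normr0 mulr_ge0.
have aux (x y : nat) : (x <= y)%N ->
    \sum_(x <= u < y) F u = \sum_(u < y) F u - \sum_(u < x) F u.
  move=> xy; rewrite -!(big_mkord xpredT F) [X in _ = X - _](big_cat_nat (n := x))//=.
  by rewrite addrAC subrr add0r.
have -> : \sum_(a <= u < k) F (u + t)%N = \sum_(a + t <= u < k + t) F u.
  by rewrite big_addn addnK.
rewrite !aux ?leq_add2r//.
set x := \sum_(u < k + t) _; set y := \sum_(u < a + t) _.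
set x' := \sum_(u < k) _; set y' := \sum_(u < a) _.
have -> : x - y - (x' - y') = (x - x') - (y - y') by ring.
apply: le_trans (ler_normB _ _) _.
have hx : `|x - x'| <= t%:R.
  by apply: le_trans (sum_nat_diff_le _ _ F1) _; rewrite natrD addrAC subrr add0r normr_nat.
have hy : `|y - y'| <= t%:R.
  by apply: le_trans (sum_nat_diff_le _ _ F1) _; rewrite natrD addrAC subrr add0r normr_nat.
lra.
Qed.

Lemma sum_nat_le_size (F : nat -> R) (a k : nat) (c : R) :
  (forall u, `|F u| <= c) -> (a <= k)%N -> `|\sum_(a <= u < k) F u| <= c * (k - a)%:R.
Proof.
move=> F1 ak; apply: le_trans (ler_norm_sum _ _ _) _.
apply: le_trans (ler_sum _ (fun u _ => F1 u)) _.
by rewrite big_const_nat iter_addr addr0 mulr_natr.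
Qed.

End double_sums.

Section mean.
Variables (R : realFieldType) (X : finZmodType).

Definition mean (F : X -> R) : R := #|X|%:R^-1 * \sum_x F x.

Lemma cardX_gt0 : 0 < #|X|%:R :> R.
Proof. by rewrite ltr0n; apply/card_gt0P; exists 0. Qed.

Lemma mean_shift (F : X -> R) v : mean (fun x => F (x + v)) = mean F.
Proof.
rewrite /mean; congr (_ * _); rewrite [RHS](reindex_inj (addIr v))/=.
by apply: eq_bigr.
Qed.

Lemma eq_mean (F G : X -> R) : F =1 G -> mean F = mean G.
Proof. by move=> FG; rewrite /mean; congr (_ * _); apply: eq_bigr. Qed.

Lemma meanD (F G : X -> R) : mean (fun x => F x + G x) = mean F + mean G.
Proof. by rewrite /mean big_split/= mulrDr. Qed.

Lemma meanN (F : X -> R) : mean (fun x => - F x) = - mean F.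
Proof. by rewrite /mean sumrN mulrN. Qed.

Lemma meanB (F G : X -> R) : mean (fun x => F x - G x) = mean F - mean G.
Proof. by rewrite meanD meanN. Qed.

Lemma meanZ c (F : X -> R) : mean (fun x => c * F x) = c * mean F.
Proof. by rewrite /mean -mulr_sumr mulrCA. Qed.

Lemma meanZr c (F : X -> R) : mean (fun x => F x * c) = mean F * c.
Proof. by rewrite mulrC -meanZ; apply: eq_mean => x; rewrite mulrC. Qed.

Lemma mean_cst c : mean (fun=> c) = c.
Proof.
by rewrite /mean sumr_const -[c *+ _]mulr_natl mulKf// gt_eqF// cardX_gt0.
Qed.

Lemma mean_sum I (r : seq I) (F : I -> X -> R) :
  mean (fun x => \sum_(i <- r) F i x) = \sum_(i <- r) mean (F i).
Proof. by rewrite /mean exchange_big/= mulr_sumr. Qed.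

Lemma ler_mean (F G : X -> R) : (forall x, F x <= G x) -> mean F <= mean G.
Proof.
by move=> FG; rewrite /mean ler_wpM2l ?invr_ge0// ler_sum.
Qed.

Lemma mean_ge0 (F : X -> R) : (forall x, 0 <= F x) -> 0 <= mean F.
Proof. by move=> F0; rewrite -(mean_cst 0); exact: ler_mean. Qed.

Lemma ler_norm_mean (F : X -> R) : `|mean F| <= mean (fun x => `|F x|).
Proof.
by rewrite /mean normrM ger0_norm ?invr_ge0// ler_wpM2l ?invr_ge0// ler_norm_sum.
Qed.

Lemma ler_norm_mean_le (F : X -> R) c : (forall x, `|F x| <= c) -> `|mean F| <= c.
Proof.
move=> Fc; apply: le_trans (ler_norm_mean _) _.
by rewrite -[leRHS]mean_cst; exact: ler_mean.
Qed.

End mean.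

(** * Smoothing along a single arc *)

Section arc_smoothing.
Variables (R : archiRcfType) (X : finZmodType) (e1 e2 : X).

Definition arc_pt (l : R) (u : nat) : X := e1 *+ farc l u + e2 *+ u.

Let count_lt (M p0 : nat) : (\sum_(1 <= p < M) (p < p0) <= p0)%N.
Proof.
suff : (\sum_(1 <= p < M) (p < p0) <= minn M p0)%N by move/leq_trans; apply; exact: geq_minr.
elim: M => [|M IH]; first by rewrite big_geq.
case: M IH => [|M] IH; first by rewrite big_geq.
by rewrite big_nat_recr//=; case: ltnP IH; lia.
Qed.

Let arc_pt_diff l k u (t : nat) : (u <= k)%N ->
  arc_pt l k - arc_pt l u + e1 *+ t =
    e1 *~ ((farc l k)%:Z - (farc l u)%:Z + t%:Z) + e2 *+ (k - u).
Proof.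
move=> uk; rewrite /arc_pt mulrzDr mulrzBr -!pmulrn mulrnBr// opprD addrACA.
by rewrite [LHS]addrAC.
Qed.

Let arc_pt_diffD l k u (t1 t2 : nat) : (u <= k)%N ->
  arc_pt l k - arc_pt l (u + t2) + (e1 *+ t1 + e2 *+ t2) =
    e1 *~ ((farc l k)%:Z - (farc l (u + t2))%:Z + t1%:Z) + e2 *+ (k - u).
Proof.
move=> uk; rewrite /arc_pt mulrzDr mulrzBr -!pmulrn mulrnBr// mulrnDr opprD.
by rewrite [X in X + _]addrACA [LHS]addrACA; congr (_ + _); rewrite opprD addrA subrK.
Qed.

(** The expanded square has a diagonal of at most [M] and correlations of pairs of points of the
    arc. Pairs with height difference below [p0] are bounded trivially; for the others [chord_sum]
    shows that shifted and unshifted correlations nearly cancel. The term [2 * t2] pays for a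
    re-indexing and [2 * w] for an incomplete block. *)
Lemma arc_smoothing (l zeta : R) (G : X -> R) (a M t1 t2 p0 Q w : nat) :
  0 < l -> (forall x, 0 <= G x <= 1) ->
  mean (fun x => `|G (x + e1) - G x|) <= zeta ->
  (0 < p0)%N -> (0 < w)%N -> (t1 + t2)%:R * l <= Q%:R * p0%:R -> (Q <= a)%N ->
  2 * w%:R * (Q + t2)%:R <= l -> 5 * (a + M + t2)%:R <= 3 * l ->
  mean (fun x => (\sum_(a <= u < a + M)
    (G (x + arc_pt l u) - G (x + arc_pt l u + (e1 *+ t1 + e2 *+ t2)))) ^+ 2) <=
  M%:R + 2 * (M%:R * (2 * t2%:R + 2 * p0%:R +
    (7 * zeta * M%:R + 2 * Q%:R + M%:R / w%:R * (6 * l / p0%:R) + 2 * w%:R))).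
Proof.
move=> l0 G01 Gz p00 w0 tQ Qa wl al.
have z0 : 0 <= zeta by apply: le_trans Gz; apply: mean_ge0.
set v := e1 *+ t1 + e2 *+ t2.
pose H x := G x - G (x + v).
have H1 x : `|H x| <= 1.
  by rewrite ler_norml; have := G01 x; have := G01 (x + v); rewrite /H; lra.
pose phi y := mean (fun x => G (x + y) * H x).
have phi1 y : `|phi y| <= 1.
  apply: ler_norm_mean_le => x; rewrite normrM -[leRHS]mulr1 ler_pM//.
  by have := G01 (x + y); rewrite ler_norml; lra.
have phiz y : `|phi (y + e1) - phi y| <= zeta.
  rewrite -meanB; apply: le_trans (ler_norm_mean _) _.
  apply: le_trans Gz; rewrite -[leRHS](mean_shift _ y); apply: ler_mean => x.
  by rewrite -mulrBl normrM addrA -[leRHS]mulr1 ler_wpM2l.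
have corr u k : mean (fun x => H (x + arc_pt l k) * H (x + arc_pt l u)) =
    phi (arc_pt l k - arc_pt l u) - phi (arc_pt l k - arc_pt l u + v).
  rewrite -meanB -[RHS](mean_shift _ (arc_pt l u)); apply: eq_mean => x.
  rewrite -mulrBl; congr (_ * _); rewrite /H.
  have E : x + arc_pt l u + (arc_pt l k - arc_pt l u) = x + arc_pt l k.
    by rewrite -addrA [arc_pt l u + _]addrC subrK.
  by rewrite (addrA _ _ v) E.
under eq_mean do rewrite sqr_sum_nat.
rewrite meanD meanZ !mean_sum; apply: lerD.
  apply: le_trans (ler_norm _) _; apply: (le_trans (@sum_nat_le_size _ _ _ _ 1 _ (leq_addr _ _))).
    move=> u; apply: ler_norm_mean_le => x.
    by rewrite normrX expr_le1// H1.
  by rewrite mul1r addKn.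
rewrite ler_pM2l//.
under eq_bigr => k _ do rewrite mean_sum.
pose A u k := phi (arc_pt l k - arc_pt l u + v).
pose B u k := phi (arc_pt l k - arc_pt l u).
under eq_bigr => k _ do (under eq_bigr => u _ do rewrite corr -/(A u k) -/(B u k)).
(* Re-indexing the shifted term by [t2] absorbs the vertical part of the translation: both terms now
   have vertical displacement [k - u]. *)
have -> : \sum_(a <= k < a + M) \sum_(a <= u < k) (B u k - A u k) =
   \sum_(a <= k < a + M) (\sum_(a <= u < k) A (u + t2)%N k - \sum_(a <= u < k) A u k) -
   \sum_(a <= k < a + M) \sum_(a <= u < k) (A (u + t2)%N k - B u k).
  rewrite -sumrB; apply: eq_bigr => k _; rewrite !sumrB opprB.
  set s1 := \sum_(_ <= _ < _) _; set s2 := \sum_(_ <= _ < _) _; set s3 := \sum_(_ <= _ < _) _.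
  lra.
apply: le_trans (ler_norm _) _; apply: le_trans (ler_normB _ _) _.
rewrite -[2 * _ + _ + _]addrA mulrDr; apply: lerD.
  rewrite mulrC; have := @sum_nat_le_size R
    (fun k => \sum_(a <= u < k) A (u + t2)%N k - \sum_(a <= u < k) A u k)
    a (a + M)%N (2 * t2%:R).
  rewrite addKn; apply; last exact: leq_addr.
  move=> k; apply: (sum_nat_shift_le (F := fun u => A u k)) => u; exact: phi1.
rewrite sum_triangle.
set K := _ + 2 * w%:R.
have K0 : 0 <= K.
  by rewrite /K !addr_ge0// ?mulr_ge0 ?ler0n ?invr_ge0// ltW.
have termle p : (1 <= p < M)%N -> `|\sum_(a <= u < a + (M - p))
     (A (u + t2)%N (u + p)%N - B u (u + p)%N)| <= (p < p0)%:R * (2 * M%:R) + K.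
  move=> /andP[p1 pM]; have [pp|pp] := ltnP p p0.
    apply: (@le_trans _ _ (2 * M%:R)); last by rewrite mul1r lerDl.
    apply: (@le_trans _ _ (2 * (a + (M - p) - a)%:R)).
      have := @sum_nat_le_size R (fun u => A (u + t2)%N (u + p)%N - B u (u + p)%N) a (a + (M - p)) 2.
      apply; last exact: leq_addr.
      move=> u; apply: le_trans (ler_normB _ _) _; rewrite -[leRHS]/(1 + 1).
      by apply: lerD; exact: phi1.
    by rewrite addKn ler_pM2l// ler_nat leq_subr.
  rewrite mul0r add0r.
  pose chi (t : int) := phi (e1 *~ t + e2 *+ p).
  have -> : \sum_(a <= u < a + (M - p)) (A (u + t2)%N (u + p)%N - B u (u + p)%N) =
      \sum_(a <= u < a + (M - p))
       (chi ((farc l (u + p))%:Z - (farc l (u + t2))%:Z + t1%:Z) -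
        chi ((farc l (u + p))%:Z - (farc l u)%:Z)).
    apply: eq_bigr => u _; rewrite /A /B /chi arc_pt_diffD ?leq_addr// addKn.
    have := @arc_pt_diff l (u + p)%N u 0%N (leq_addr _ _).
    by rewrite mulr0n !addr0 addKn => ->.
  pose nb := ((M - p) %/ w)%N.
  rewrite (big_cat_nat (n := (a + nb * w)%N)) ?leq_addr//=; last first.
    by rewrite leq_add2l /nb leq_trunc_div.
  apply: le_trans (ler_normD _ _) _.
  apply: lerD.
    have := @chord_sum _ l l0 chi zeta p t1 t2 Q a w nb z0 (fun t => phi1 _) _ _ _ Qa wl _.
    move=> /(_ _ _ _ _)/le_trans; apply.
    - move=> t; rewrite /chi mulrzDr mulr1z addrAC; exact: phiz.
    - exact: p1.
    - by apply: le_trans tQ _; rewrite ler_wpM2l// ler_nat.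
    - apply: le_trans al; rewrite ler_wpM2l// ler_nat.
      have : (nb * w <= M - p)%N by exact: leq_trunc_div.
      by clear -pM; lia.
    have nbM : (nb * w <= M)%N by apply: leq_trans (leq_trunc_div _ _) (leq_subr _ _).
    apply: lerD; first apply: lerD => //.
      by rewrite ler_wpM2l ?mulr_ge0// ler_nat.
    apply: ler_pM => //; first by rewrite divr_ge0 ?mulr_ge0// ltW.
      by rewrite ler_pdivlMr ?ltr0n// -natrM ler_nat.
    rewrite ler_wpM2l ?mulr_ge0//; first exact: ltW.
    by rewrite lef_pV2 ?posrE ?ltr0n ?(leq_trans p00)// ler_nat.
  pose F u := chi ((farc l (u + p))%:Z - (farc l (u + t2))%:Z + t1%:Z) -
    chi ((farc l (u + p))%:Z - (farc l u)%:Z).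
  have := @sum_nat_le_size R F (a + nb * w) (a + (M - p)) 2.
  move=> /(_ _ _)/le_trans; apply.
  - move=> u; apply: le_trans (ler_normB _ _) _; rewrite -[leRHS]/(1 + 1).
    by apply: lerD; exact: phi1.
  - by rewrite leq_add2l /nb leq_trunc_div.
  rewrite ler_wpM2l// ler_nat subnDl {1}(divn_eq (M - p) w) addKn.
  by apply: ltnW; rewrite ltn_mod.
apply: le_trans (ler_norm_sum _ _ _) _.
rewrite big_nat; apply: le_trans (ler_sum _ termle) _; rewrite -big_nat.
rewrite big_split/= -mulr_suml -natr_sum mulrDr; apply: lerD.
  have -> : M%:R * (2 * p0%:R) = p0%:R * (2 * M%:R) :> R by ring.
  by rewrite ler_wpM2r ?mulr_ge0// ler_nat count_lt.
rewrite big_const_nat iter_addr addr0 -[leLHS]mulr_natl ler_wpM2r// ler_nat.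
exact: leq_subr.
Qed.
End arc_smoothing.

Lemma truncnS_itv (R : archiRcfType) (x : R) : 0 <= x ->
  x <= (Num.truncn x).+1%:R <= x + 1.
Proof.
by move=> /truncn_itv/andP[h1 /ltW h2]; rewrite h2/= -natr1 lerD2r.
Qed.

Lemma amgm_abs (R : realFieldType) (eta h : R) : 0 < eta ->
  `|h| <= (eta + h ^+ 2 / eta) / 2.
Proof.
move=> e0; rewrite -real_normK ?num_real//; have := normr_ge0 h.
move: `|h| => k k0; rewrite ler_pdivlMr// -subr_ge0.
have -> : eta + k ^+ 2 / eta - k * 2 = (eta - k) ^+ 2 / eta by field; rewrite gt_eqF.
by rewrite divr_ge0 ?sqr_ge0// ltW.
Qed.

Definition arc_avg (R : archiRcfType) (X : finZmodType) (e1 e2 : X) (l : R)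
    (a M : nat) (F : X -> R) : R :=
  M%:R^-1 * \sum_(a <= u < a + M) F (arc_pt e1 e2 l u).

(** Trivial pairs end at [p0], about [kap * l], and chords move by at most [Q], about [y * l], while
    the block length [w] is a constant large enough for the jumps to cost at most [b / 16].
    [eps = kap * y / 2] is what [(t1 + t2) * l <= Q * p0] asks for. The square [b] of [eta] appears
    because [amgm_abs] bounds the first moment by the second. *)
Lemma arc_equidist (R : archiRcfType) (eta c : R) :
  0 < eta <= 1 -> 0 < c <= 1 ->
  exists eps zeta l1 : R, [/\ 0 < eps, 0 < zeta, 1 <= l1 &
  forall (X : finZmodType) (e1 e2 : X) (G : X -> R) (l : R) (a M t1 t2 : nat),
  l1 <= l -> (forall x, 0 <= G x <= 1) ->
  mean (fun x => `|G (x + e1) - G x|) <= zeta ->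
  c * l <= a%:R -> c * l <= M%:R -> 2 * (a + M)%:R <= l ->
  t1%:R <= eps * l -> t2%:R <= eps * l ->
  mean (fun x => `|arc_avg e1 e2 l a M
     (fun y => G (x + y) - G (x + y + (e1 *+ t1 + e2 *+ t2)))|) <= eta].
Proof.
move=> /andP[e0 e1'] /andP[c0 c1].
pose b := eta ^+ 2.
have b0 : 0 < b by rewrite exprn_gt0.
have b1 : b <= 1 by rewrite exprn_ile1// ltW.
have cb0 : 0 < c * b by rewrite mulr_gt0.
have cb1 : c * b <= 1 by nra.
pose kap := c * b / 64.
have kap0 : 0 < kap by rewrite /kap; lra.
have kap1 : kap <= 1 by rewrite /kap; lra.
pose w := (Num.truncn (96 / (kap * b))).+1.
pose W : R := w%:R.
have W1 : 1 <= W by rewrite ler1n.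
have Wk : 96 <= W * (kap * b).
  have kb0 : 0 < kap * b by rewrite mulr_gt0.
  have := @truncnS_itv R (96 / (kap * b)) ltac:(by rewrite divr_ge0// ltW).
  by move=> /andP[h _]; rewrite ler_pdivrMr// in h.
pose y := c * b / (64 * W).
have W0 : 0 < W by lra.
have yW : y * W = c * b / 64 by rewrite /y; field; rewrite gt_eqF.
have y0 : 0 < y by rewrite /y divr_gt0// mulr_gt0.
have y1 : y <= c * b / 64 by nra.
pose eps := kap * y / 2.
have eps0 : 0 < eps by rewrite /eps divr_gt0// mulr_gt0.
have epsy : eps <= y by rewrite /eps; nra.
pose l1 := 2 * (9 + 4 * W) / (c * b).
have l1e : l1 * (c * b) = 2 * (9 + 4 * W) by rewrite /l1; field; rewrite gt_eqF// gt_eqF.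
have l1ge : 2 * (9 + 4 * W) <= l1 by rewrite -l1e ler_piMr// /l1 divr_ge0// ltW//; lra.
(* With this [zeta], the term [2 * (7 * zeta)] of [arc_smoothing] is [b / 16]. *)
exists eps, (b / 224), l1; split; [exact: eps0|by rewrite divr_gt0|clear -l1ge W1; lra|].
move=> X f1 f2 G l a M t1 t2 ll G01 Gz ca cM aM t1e t2e.
have l0 : 0 < l by lra.
have p0P := @truncnS_itv R (kap * l) ltac:(by rewrite mulr_ge0// ltW).
set p0 := (Num.truncn (kap * l)).+1 in p0P.
have QP := @truncnS_itv R (y * l) ltac:(by rewrite mulr_ge0// ltW).
set Q := (Num.truncn (y * l)).+1 in QP.
move: p0P QP => /andP[p0l p0u] /andP[Ql Qu].
have lcb : 2 * (9 + 4 * W) <= l * (c * b).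
  by rewrite -l1e ler_wpM2r// ltW.
have m0 : 0 < M%:R :> R by apply: lt_le_trans cM; rewrite mulr_gt0.
have bM : l * (c * b) <= b * M%:R by nra.
have yl : y * l <= l * (c * b) / 64 by nra.
have epsl : eps * l <= y * l by rewrite ler_wpM2r// ltW.
have lc : l * (c * b) <= c * l by rewrite mulrA [l * c]mulrC ler_piMr// mulr_ge0// ltW.
have lcl : l * (c * b) <= l by rewrite ler_piMr// ltW.
have := @arc_smoothing R X f1 f2 l (b / 224) G a M t1 t2 p0 Q w l0 G01 Gz isT isT.
move=> /(_ _ _ _ _).
set T := mean _ => hT.
have {}hT : T <= b * M%:R ^+ 2.
  apply: le_trans (hT _ _ _ _) _.
  - rewrite natrD; apply: (@le_trans _ _ (2 * (eps * l) * l)).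
      by rewrite ler_wpM2r ?(ltW l0)//; clear -t1e t2e; lra.
    have -> : 2 * (eps * l) * l = y * l * (kap * l) by rewrite /eps; field.
    by apply: ler_pM => //; rewrite mulr_ge0// ltW.
  - by rewrite -(ler_nat R); clear -Qu yl lcb ca lc W1; lra.
  - rewrite -/W natrD.
    have : W * (Q%:R + t2%:R) <= W * (2 * (y * l) + 1) by rewrite ler_wpM2l ?(ltW W0)//; clear -t2e Qu epsl; lra.
    have : W * (y * l) = l * (c * b) / 64 by rewrite mulrA [W * y]mulrC yW; field.
    clear -lcb lcl l0; lra.
  - rewrite natrD; rewrite natrD in aM.
    clear -aM t2e epsl yl lcb lcl W1 l0; lra.
  rewrite -/W.
  have h6 : M%:R / W * (6 * l / p0%:R) <= b * M%:R / 16.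
    have p00 : 0 < p0%:R :> R by rewrite ltr0n.
    have -> : M%:R / W * (6 * l / p0%:R) = (6 * l) * M%:R / (W * p0%:R).
      by field; rewrite !gt_eqF.
    rewrite ler_pdivrMr ?mulr_gt0//.
    have : W * (kap * l) <= W * p0%:R by rewrite ler_wpM2l// ltW.
    have : 96 * l <= W * (kap * b) * l by rewrite ler_wpM2r// ltW.
    move=> g1 g2; have g3 : 96 * l <= b * (W * p0%:R).
      apply: le_trans g1 _; have -> : W * (kap * b) * l = b * (W * (kap * l)) by ring.
      by rewrite ler_wpM2l// ltW.
    have : (96 * l) * M%:R <= b * (W * p0%:R) * M%:R by rewrite ler_wpM2r// ltW.
    nra.
  move: h6; set z := M%:R / W * _ => h6.
  have -> : b * M%:R ^+ 2 = M%:R * (b * M%:R) by ring.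
  rewrite -[X in X + _]mulr1 [2 * (M%:R * _)]mulrCA -mulrDr ler_wpM2l ?ltW//.
  have : kap * l <= b * M%:R / 64 by rewrite /kap; lra.
  lra.
apply: (@le_trans _ _ ((eta + (M%:R^-1 ^+ 2 * T) / eta) / 2)).
  rewrite -[M%:R^-1 ^+ 2 * T]meanZ -meanZr -{1}(mean_cst X eta) -meanD -meanZr.
  by apply: ler_mean => x; rewrite -exprMn; exact: amgm_abs.
have : M%:R^-1 ^+ 2 * T <= b.
  by rewrite exprVn mulrC ler_pdivrMr// exprn_gt0.
move=> h; have : M%:R^-1 ^+ 2 * T / eta <= eta.
  by rewrite ler_pdivrMr.
lra.
Qed.

(** * Averages over sequences as convolutions *)

Section seq_average.
Variables (R : realFieldType) (X : finZmodType).
Implicit Types (s t K : seq X) (F G : X -> R) (x v : X).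

Definition avs s F : R := (size s)%:R^-1 * \sum_(v <- s) F v.

(** Repetitions are kept: a sequence stands for the uniform measure on its entries with
    multiplicity, so these two operations are convolutions of measures. *)
Definition addseq s t := [seq a + b | a <- s, b <- t].
Definition subseqs s t := [seq a - b | a <- s, b <- t].

Lemma eq_avs s F G : F =1 G -> avs s F = avs s G.
Proof. by move=> FG; rewrite /avs; congr (_ * _); apply: eq_bigr. Qed.

Lemma avs_allpairs (f : X -> X -> X) s t F :
  avs [seq f a b | a <- s, b <- t] F = avs s (fun a => avs t (fun b => F (f a b))).
Proof.
rewrite /avs size_allpairs natrM invfM -mulrA; congr (_ * _).
by rewrite big_allpairs_dep mulr_sumr.
Qed.

Lemma avs_addseq s t F :
  avs (addseq s t) F = avs s (fun a => avs t (fun b => F (a + b))).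
Proof. exact: avs_allpairs. Qed.

Lemma avs_subseqs s t F :
  avs (subseqs s t) F = avs s (fun a => avs t (fun b => F (a - b))).
Proof. exact: avs_allpairs. Qed.

Lemma avsD s F G : avs s (fun v => F v + G v) = avs s F + avs s G.
Proof. by rewrite /avs big_split mulrDr. Qed.

Lemma avsN s F : avs s (fun v => - F v) = - avs s F.
Proof. by rewrite /avs sumrN mulrN. Qed.

Lemma avsB s F G : avs s (fun v => F v - G v) = avs s F - avs s G.
Proof. by rewrite avsD avsN. Qed.

Lemma avsZ s c F : avs s (fun v => c * F v) = c * avs s F.
Proof. by rewrite /avs -mulr_sumr mulrCA. Qed.

Lemma avsZr s c F : avs s (fun v => F v * c) = avs s F * c.
Proof. by rewrite mulrC -avsZ; apply: eq_avs => v; rewrite mulrC. Qed.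

Lemma avs_cst s c : (0 < size s)%N -> avs s (fun=> c) = c.
Proof.
move=> s0; rewrite /avs big_const_seq count_predT iter_addr addr0.
by rewrite -[c *+ _]mulr_natl mulKf// pnatr_eq0 -lt0n.
Qed.

Lemma ler_avs_in s F G : {in s, forall v, F v <= G v} -> avs s F <= avs s G.
Proof.
move=> FG; rewrite /avs ler_wpM2l ?invr_ge0// big_seq [leRHS]big_seq.
exact: ler_sum.
Qed.

Lemma ler_avs s F G : (forall v, F v <= G v) -> avs s F <= avs s G.
Proof. by move=> FG; apply: ler_avs_in => v _. Qed.

Lemma avs_ge0 s F : (forall v, 0 <= F v) -> 0 <= avs s F.
Proof. by move=> F0; rewrite mulr_ge0 ?invr_ge0// sumr_ge0. Qed.

Lemma ler_avs_cst s F c : (0 < size s)%N -> {in s, forall v, F v <= c} -> avs s F <= c.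
Proof. by move=> s0 Fc; rewrite -[leRHS](@avs_cst s)//; exact: ler_avs_in. Qed.

Lemma ger_avs_cst s F c : (0 < size s)%N -> {in s, forall v, c <= F v} -> c <= avs s F.
Proof. by move=> s0 Fc; rewrite -[leLHS](@avs_cst s)//; exact: ler_avs_in. Qed.

Lemma ler_norm_avs s F : `|avs s F| <= avs s (fun v => `|F v|).
Proof.
by rewrite /avs normrM ger0_norm ?invr_ge0// ler_wpM2l ?invr_ge0// ler_norm_sum.
Qed.

Lemma exchange_avs s t (F : X -> X -> R) :
  avs s (fun a => avs t (F a)) = avs t (fun b => avs s (F^~ b)).
Proof. by rewrite /avs -!mulr_sumr exchange_big/= mulrCA. Qed.

Lemma mean_avs s (F : X -> X -> R) :
  mean (fun x => avs s (F x)) = avs s (fun v => mean (F^~ v)).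
Proof. by rewrite /avs meanZ mean_sum. Qed.

Lemma avs_sqr s F : (0 < size s)%N -> avs s F ^+ 2 <= avs s (fun v => F v ^+ 2).
Proof.
move=> s0; set m := avs s F.
have : 0 <= avs s (fun v => (F v - m) ^+ 2) by apply: avs_ge0 => v; exact: sqr_ge0.
have -> : avs s (fun v => (F v - m) ^+ 2) =
    avs s (fun v => F v ^+ 2) + (avs s (fun v => F v * (- 2 * m)) + avs s (fun=> m ^+ 2)).
  by rewrite -!avsD; apply: eq_avs => v; ring.
by rewrite avsZr -/m avs_cst//; lra.
Qed.

Lemma avs_exp2 s F n : (0 < size s)%N ->
  avs s F ^+ (2 ^ n) <= avs s (fun v => F v ^+ (2 ^ n)).
Proof.
move=> s0; elim: n F => [|n IH] F; first by rewrite expn0 expr1.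
case: n IH => [_|n IH]; first exact: avs_sqr.
rewrite expnS exprM; apply: (@le_trans _ _ (avs s (fun v => F v ^+ 2) ^+ (2 ^ n.+1))).
  by rewrite lerXn2r ?nnegrE ?sqr_ge0// ?avs_sqr//; apply: avs_ge0 => v; exact: sqr_ge0.
apply: le_trans (IH _) _; apply: ler_avs => v; by rewrite -exprM.
Qed.

Definition smooth s G x : R := avs s (fun v => G (x + v)).
Definition corr G v : R := mean (fun x => G x * G (x + v)).
Definition energy s G : R := mean (fun x => smooth s G x ^+ 2).

Lemma energy_ge0 s G : 0 <= energy s G.
Proof. by apply: mean_ge0 => x; exact: sqr_ge0. Qed.

Lemma corr_smooth s G y :
  avs (subseqs s s) (fun v => corr G (y + v)) =
  mean (fun x => smooth s G x * smooth s G (x + y)).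
Proof.
transitivity (mean (fun x => avs s (fun b => avs s (fun a => G (x + b) * G (x + y + a))))).
  rewrite mean_avs avs_subseqs exchange_avs; apply: eq_avs => b.
  rewrite mean_avs; apply: eq_avs => a.
  rewrite /corr -(mean_shift _ b); apply: eq_mean => x; congr (_ * G _).
  by rewrite -!addrA; congr (_ + _); rewrite addrCA [b + _]addrC subrK.
by apply: eq_mean => x; rewrite -avsZr; apply: eq_avs => b; rewrite -avsZ.
Qed.

Lemma energyE s G : energy s G = avs (subseqs s s) (corr G).
Proof.
under [RHS]eq_avs do rewrite -[X in corr G X]add0r.
by rewrite corr_smooth; apply: eq_mean => x; rewrite addr0 expr2.
Qed.

Lemma smooth_addseq s t G x :
  smooth (addseq s t) G x = avs t (fun b => smooth s G (x + b)).
Proof.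
rewrite /smooth avs_addseq exchange_avs; apply: eq_avs => b; apply: eq_avs => a.
by rewrite [a + b]addrC addrA.
Qed.

Lemma energy_addseq s t G : (0 < size t)%N -> energy (addseq s t) G <= energy s G.
Proof.
move=> t0; apply: (@le_trans _ _ (mean (fun x => avs t (fun b => smooth s G (x + b) ^+ 2)))).
  by apply: ler_mean => x; rewrite smooth_addseq avs_sqr.
rewrite mean_avs; under eq_avs do rewrite (mean_shift (fun x => smooth s G x ^+ 2)).
by rewrite avs_cst.
Qed.

Lemma mean_smooth s G : (0 < size s)%N -> mean (smooth s G) = mean G.
Proof.
by move=> s0; rewrite mean_avs; under eq_avs do rewrite mean_shift; rewrite avs_cst.
Qed.

Lemma mean_sqr F : mean F ^+ 2 <= mean (fun x => F x ^+ 2).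
Proof.
set m := mean F.
have : 0 <= mean (fun x => (F x - m) ^+ 2) by apply: mean_ge0 => v; exact: sqr_ge0.
have -> : mean (fun x => (F x - m) ^+ 2) =
    mean (fun x => F x ^+ 2) + (mean (fun x => F x * (- 2 * m)) + mean (fun _ : X => m ^+ 2)).
  by rewrite -!meanD; apply: eq_mean => x; ring.
by rewrite meanZr -/m mean_cst; lra.
Qed.

Lemma energy_ge s G : (0 < size s)%N -> mean G ^+ 2 <= energy s G.
Proof. by move=> s0; rewrite -(mean_smooth G s0); exact: mean_sqr. Qed.

Lemma smooth_itv s G x : (0 < size s)%N -> (forall x, 0 <= G x <= 1) ->
  0 <= smooth s G x <= 1.
Proof.
move=> s0 G01; rewrite ger_avs_cst//= ?ler_avs_cst// => v _; by have /andP[] := G01 (x + v).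
Qed.

(* [<g, psi g> = |smooth t g|^2] and [|psi g| <= |smooth t g|] for the
   convolution [psi] by [subseqs t t]. *)
Lemma smooth_diff_energy t g : (0 < size t)%N ->
  mean (fun x => (g x - smooth (subseqs t t) g x) ^+ 2) <=
  mean (fun x => g x ^+ 2) - energy t g.
Proof.
move=> t0.
have -> : mean (fun x => (g x - smooth (subseqs t t) g x) ^+ 2) =
    mean (fun x => g x ^+ 2) +
    (mean (fun x => - 2 * (g x * smooth (subseqs t t) g x)) +
     mean (fun x => smooth (subseqs t t) g x ^+ 2)).
  by rewrite -!meanD; apply: eq_mean => x; ring.
have e1 : mean (fun x => g x * smooth (subseqs t t) g x) = energy t g.
  rewrite energyE /smooth.
  transitivity (mean (fun x => avs (subseqs t t) (fun v => g x * g (x + v)))).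
    by apply: eq_mean => x; rewrite avsZ.
  by rewrite mean_avs.
have e2 : mean (fun x => smooth (subseqs t t) g x ^+ 2) <= energy t g.
  apply: (@le_trans _ _ (mean (fun x => avs t (fun b => smooth t g (x - b) ^+ 2)))).
    apply: ler_mean => x; apply: le_trans (avs_sqr _ t0).
    rewrite /smooth avs_subseqs exchange_avs le_eqVlt; apply/orP; left; apply/eqP.
    congr (_ ^+ 2); apply: eq_avs => b; apply: eq_avs => a.
    by rewrite addrA addrAC.
  rewrite mean_avs; under eq_avs do rewrite (mean_shift (fun x => smooth t g x ^+ 2)).
  by rewrite avs_cst.
rewrite meanZ e1; lra.
Qed.

End seq_average.

Section box.
Variables (R : realFieldType) (X : finZmodType) (e1 e2 : X).
Implicit Types (s t : seq X) (F G : X -> R) (x y v : X) (S L : nat).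

Definition run (e : X) S : seq X := [seq e *+ i | i <- iota 0 S].
Definition box S : seq X := addseq (run e1 S) (run e2 S).

Lemma size_run e S : size (run e S) = S.
Proof. by rewrite size_map size_iota. Qed.

Lemma size_box S : size (box S) = (S * S)%N.
Proof. by rewrite size_allpairs !size_run. Qed.

Lemma mem_box S v : v \in box S ->
  exists i j, [/\ (i < S)%N, (j < S)%N & v = e1 *+ i + e2 *+ j].
Proof.
move=> /allpairsP[[a b]/= [/mapP[i + ->] /mapP[j + ->] ->]].
by rewrite !mem_iota => iS jS; exists i, j.
Qed.

Lemma avs_run e S F : avs (run e S) F = S%:R^-1 * \sum_(i < S) F (e *+ i).
Proof. by rewrite /avs size_run big_map -(big_mkord xpredT (fun i => F (e *+ i))) /index_iota subn0. Qed.

Lemma avs_box S F : avs (box S) F =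
  S%:R^-1 ^+ 2 * \sum_(i < S) \sum_(j < S) F (e1 *+ i + e2 *+ j).
Proof.
rewrite avs_addseq avs_run expr2 -mulrA; congr (_ * _); rewrite mulr_sumr.
by apply: eq_bigr => i _; rewrite avs_run.
Qed.

Lemma smooth_run e S G x : (0 < S)%N -> (forall x, 0 <= G x <= 1) ->
  `|smooth (run e S) G (x + e) - smooth (run e S) G x| <= S%:R^-1.
Proof.
move=> S0 G01; rewrite /smooth !avs_run -mulrBr normrM ger0_norm ?invr_ge0//.
rewrite -[leRHS]mulr1 ler_wpM2l ?invr_ge0//.
have -> : \sum_(i < S) G (x + e + e *+ i) - \sum_(i < S) G (x + e *+ i) =
    G (x + e *+ S) - G x.
  rewrite -(big_mkord xpredT (fun i => G (x + e + e *+ i))).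
  rewrite -(big_mkord xpredT (fun i => G (x + e *+ i))) -sumrB.
  under eq_bigr => i _ do rewrite -addrA -mulrS.
  by rewrite telescope_sumr// mulr0n addr0.
by have := G01 x; have := G01 (x + e *+ S); rewrite ler_norml; lra.
Qed.

Lemma smooth_box1 S G x : (0 < S)%N -> (forall x, 0 <= G x <= 1) ->
  `|smooth (box S) G (x + e1) - smooth (box S) G x| <= S%:R^-1.
Proof.
move=> S0 G01; rewrite !smooth_addseq -avsB; apply: le_trans (ler_norm_avs _ _) _.
rewrite ler_avs_cst ?size_run// => b _.
by rewrite [x + e1 + b]addrAC; exact: smooth_run.
Qed.

Lemma smooth_box2 S G x : (0 < S)%N -> (forall x, 0 <= G x <= 1) ->
  `|smooth (box S) G (x + e2) - smooth (box S) G x| <= S%:R^-1.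
Proof.
move=> S0 G01; rewrite /smooth !avs_addseq -avsB; apply: le_trans (ler_norm_avs _ _) _.
rewrite ler_avs_cst ?size_run// => a _.
have := @smooth_run e2 S G (x + a) S0 G01; rewrite [x + a + e2]addrAC /smooth.
by congr (`|_ - _| <= _); apply: eq_avs => b; rewrite addrA.
Qed.

Lemma smooth_box_lip S G x m k : (0 < S)%N -> (forall x, 0 <= G x <= 1) ->
  `|smooth (box S) G (x + (e1 *+ m + e2 *+ k)) - smooth (box S) G x| <=
    (m + k)%:R / S%:R.
Proof.
move=> S0 G01; elim: m => [|m IH].
  rewrite mulr0n add0r add0n; elim: k => [|k IH].
    by rewrite mulr0n addr0 subrr normr0 mul0r.
  rewrite mulrSr addrA -[k.+1]addn1 natrD mulrDl mul1r.
  apply: le_trans (ler_distD (smooth (box S) G (x + e2 *+ k)) _ _) _.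
  by rewrite [leRHS]addrC; apply: lerD => //; exact: smooth_box2.
rewrite mulrSr addrAC addrA addSn -addn1 natrD mulrDl mul1r.
apply: le_trans (ler_distD (smooth (box S) G (x + (e1 *+ m + e2 *+ k))) _ _) _.
by rewrite [leRHS]addrC; apply: lerD => //; exact: smooth_box1.
Qed.

(** If one more convolution with the box hardly lowers the energy of [g = smooth s G], then [g] is
    close in mean square to its convolution with [subseqs t t], which is Lipschitz at scale [S]. So
    [g] hardly changes under translation by [y], and its correlation with the translate is nearly
    its energy. *)
Lemma corr_energy_lb s S G m k eta : (0 < size s)%N -> (0 < S)%N ->
  (forall x, 0 <= G x <= 1) -> 0 < eta ->
  energy (addseq s (box S)) G - eta
    - (energy s G - energy (addseq s (box S)) G) / eta - (m + k)%:R / S%:R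
  <= avs (subseqs s s) (fun v => corr G (e1 *+ m + e2 *+ k + v)).
Proof.
move=> s0 S0 G01 eta0.
have t0 : (0 < size (box S))%N by rewrite size_box muln_gt0 S0.
rewrite corr_smooth; set y := e1 *+ m + e2 *+ k; set t := box S.
have g01 x : 0 <= smooth s G x <= 1 by exact: smooth_itv.
have eE : energy (addseq s t) G = energy t (smooth s G).
  by apply: eq_mean => x; rewrite smooth_addseq.
have := smooth_diff_energy (smooth s G) t0; rewrite -eE -/t -/(energy s G).
set g := smooth s G in g01 *; set h := smooth (subseqs t t) g; move=> hd.
have hlip x : `|h (x + y) - h x| <= (m + k)%:R / S%:R.
  have hE z : h z = avs t (fun b => smooth t g (z - b)).
    rewrite /h {1}/smooth avs_subseqs exchange_avs; apply: eq_avs => b; apply: eq_avs => a.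
    by rewrite addrA addrAC.
  rewrite !hE -avsB; apply: le_trans (ler_norm_avs _ _) _.
  by rewrite ler_avs_cst// => b _; rewrite [x + y - b]addrAC smooth_box_lip.
have diff : mean (fun x => `|g x - g (x + y)|) <=
    eta + (energy s G - energy (addseq s t) G) / eta + (m + k)%:R / S%:R.
  have h1 : mean (fun x => `|g x - h x|) <=
      (eta + (energy s G - energy (addseq s t) G) / eta) / 2.
    apply: (@le_trans _ _ (mean (fun x => (eta + (g x - h x) ^+ 2 / eta) / 2))).
      by apply: ler_mean => x; exact: amgm_abs.
    rewrite meanZr meanD mean_cst meanZr ler_pM2r ?invr_gt0// lerD2l.
    by rewrite ler_pM2r ?invr_gt0.
  apply: (@le_trans _ _ (mean (fun x => `|g x - h x| + `|g (x + y) - h (x + y)| +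
     (m + k)%:R / S%:R))).
    apply: ler_mean => x; have -> : g x - g (x + y) = (g x - h x) -
       (g (x + y) - h (x + y)) - (h (x + y) - h x) by ring.
    apply: le_trans (ler_normB _ _) _; apply: lerD => //.
    exact: ler_normB.
  rewrite !meanD mean_cst (mean_shift (fun x => `|g x - h x|)); lra.
have lb : energy s G - mean (fun x => `|g x - g (x + y)|) <= mean (fun x => g x * g (x + y)).
  rewrite -meanB; apply: ler_mean => x; rewrite -/g.
  have := g01 x; have := g01 (x + y); move: (g x) (g (x + y)) => u v v01 u01.
  rewrite lerBlDr -lerBlDl -[leLHS]/(u ^+ 2 - u * v) expr2 -mulrBr.
  by apply: le_trans (ler_norm _) _; rewrite normrM ger0_norm ?ler_piMl//; case/andP: u01.
have := energy_addseq s G t0; rewrite -/t; lra.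
Qed.

End box.

Section domination.
Variables (R : realFieldType) (X : finZmodType) (e1 e2 : X).
Implicit Types (s t : seq X) (F G : X -> R) (x y v : X) (S L : nat).

Lemma sum_window (f : nat -> R) (m n N : nat) : (forall i, 0 <= f i) ->
  (m + n <= N)%N -> \sum_(i < n) f (m + i)%N <= \sum_(i < N) f i.
Proof.
move=> f0 mnN; rewrite -!(big_mkord xpredT) -(big_mkord xpredT (fun i => f (m + i)%N)).
have -> : \sum_(0 <= i < n) f (m + i)%N = \sum_(m <= i < m + n) f i.
  by rewrite -{2}[m]add0n big_addn addKn; apply: eq_bigr => i _; rewrite addnC.
rewrite [leRHS](big_cat_nat (n := m)) ?(leq_trans _ mnN) ?leq_addr//=.
rewrite [X in _ <= _ + X](big_cat_nat (n := m + n)) ?leq_addr//=.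
by rewrite addrCA lerDl addr_ge0// sumr_ge0.
Qed.

Lemma sum_window2 (f : nat -> nat -> R) (m n k p N : nat) : (forall i j, 0 <= f i j) ->
  (m + n <= N)%N -> (k + p <= N)%N ->
  \sum_(i < n) \sum_(j < p) f (m + i)%N (k + j)%N <= \sum_(i < N) \sum_(j < N) f i j.
Proof.
move=> f0 mnN kpN.
apply: (@le_trans _ _ (\sum_(i < n) \sum_(j < N) f (m + i)%N j)).
  by apply: ler_sum => i _; apply: (sum_window (f := f (m + i)%N)).
apply: (sum_window (f := fun i => \sum_(j < N) f i j)) => // i.
exact: sumr_ge0.
Qed.

(** A comparison of weights. On the left a point of the [L] by [L] grid has weight at most
    [1 / S^2]; on the right every [b] gives it at least [(T / 2)^2 / T^4]. The quotient is the
    constant. *)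
Lemma box_domination (ys : seq X) F (S T L : nat) :
  (0 < S)%N -> (0 < size ys)%N -> (forall x, 0 <= F x) ->
  {in ys, forall y, exists m k, [/\ (m + S <= L)%N, (k + S <= L)%N & y = e1 *+ m + e2 *+ k]} ->
  (2 * (S + L) <= T)%N ->
  avs ys (fun y => avs (box e1 e2 S) (fun b => F (y + b))) <=
  4 * (T%:R / S%:R) ^+ 2 *
    avs (box e1 e2 S) (fun b => avs (subseqs (box e1 e2 T) (box e1 e2 T)) (fun z => F (b + z))).
Proof.
move=> S0 ys0 F0 hys TSL.
have T0 : (0 < T)%N by lia.
have SR : 0 < S%:R :> R by rewrite ltr0n.
have TR : 0 < T%:R :> R by rewrite ltr0n.
pose f i j := F (e1 *+ i + e2 *+ j).
have f0 i j : 0 <= f i j by exact: F0.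
set gr := \sum_(i < L) \sum_(j < L) f i j.
have gr0 : 0 <= gr by apply: sumr_ge0 => i _; apply: sumr_ge0.
have up : avs ys (fun y => avs (box e1 e2 S) (fun b => F (y + b))) <= S%:R^-1 ^+ 2 * gr.
  apply: ler_avs_cst => // y /hys[m [k [mL kL ->]]].
  rewrite avs_box ler_wpM2l ?sqr_ge0//.
  apply: le_trans (sum_window2 f0 mL kL); rewrite le_eqVlt; apply/orP; left; apply/eqP.
  by apply: eq_bigr => i _; apply: eq_bigr => j _; rewrite /f addrACA -!mulrnDr.
have lo v : v \in box e1 e2 S -> (4 * T%:R ^+ 2)^-1 * gr <=
    avs (subseqs (box e1 e2 T) (box e1 e2 T)) (fun z => F (v + z)).
  move=> /mem_box[i0 [j0 [i0S j0S ->]]].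
  rewrite avs_subseqs exchange_avs avs_box.
  pose g i j := avs (box e1 e2 T) (fun a => F (e1 *+ i0 + e2 *+ j0 + (a - (e1 *+ i + e2 *+ j)))).
  have g0 i j : 0 <= g i j by apply: avs_ge0.
  rewrite -/g.
  have nE : (S + (T - (S + L)) <= T)%N by lia.
  (* Only subtracted points with both coordinates in [[S, T - L)] are kept: at least [T / 2] values
     per coordinate, and for each such point the translated big box covers the whole grid. *)
  apply: (@le_trans _ _ (T%:R^-1 ^+ 2 * \sum_(i < T - (S + L)) \sum_(j < T - (S + L)) g (S + i)%N (S + j)%N)); last first.
    by rewrite ler_wpM2l ?sqr_ge0//; exact: (sum_window2 g0 nE nE).
  have gl i j : (i < T - (S + L))%N -> (j < T - (S + L))%N ->
      T%:R^-1 ^+ 2 * gr <= g (S + i)%N (S + j)%N.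
    move=> iT jT; rewrite /g avs_box ler_wpM2l ?sqr_ge0//.
    pose h a b := F (e1 *+ i0 + e2 *+ j0 + (e1 *+ a + e2 *+ b - (e1 *+ (S + i) + e2 *+ (S + j)))).
    have h0 a b : 0 <= h a b by exact: F0.
    apply: le_trans (@sum_window2 h (S + i - i0) L (S + j - j0) L T h0 _ _); [|by lia|by lia].
    rewrite le_eqVlt; apply/orP; left; apply/eqP.
    apply: eq_bigr => a _; apply: eq_bigr => b _; rewrite /f /h; congr F.
    rewrite addrA addrACA -!mulrnDr.
    have -> : (i0 + (S + i - i0 + a) = a + (S + i))%N by clear -i0S; lia.
    have -> : (j0 + (S + j - j0 + b) = b + (S + j))%N by clear -j0S; lia.
    by rewrite (mulrnDr _ a) (mulrnDr _ b) addrACA addrK.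
  have n2 : T%:R <= 2 * (T - (S + L))%:R :> R.
    by rewrite -natrM ler_nat; lia.
  set n := (T - (S + L))%N in n2 gl *.
  apply: (@le_trans _ _ (T%:R^-1 ^+ 2 * (n%:R ^+ 2 * (T%:R^-1 ^+ 2 * gr)))).
    have -> : (4 * T%:R ^+ 2)^-1 * gr = T%:R^-1 ^+ 2 * ((T%:R / 2) ^+ 2 * (T%:R^-1 ^+ 2 * gr)).
      by field; rewrite gt_eqF.
    have q : (T%:R / 2) ^+ 2 <= n%:R ^+ 2 :> R.
      by rewrite lerXn2r ?nnegrE ?divr_ge0//; move: n2; clear; lra.
    by rewrite ler_wpM2l ?sqr_ge0// ler_wpM2r// mulr_ge0 ?sqr_ge0.
  rewrite ler_wpM2l ?sqr_ge0//.
  have -> : n%:R ^+ 2 * (T%:R^-1 ^+ 2 * gr) = \sum_(i < n) \sum_(j < n) (T%:R^-1 ^+ 2 * gr).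
    by rewrite !sumr_const !card_ord -mulrnA -[RHS]mulr_natl natrM expr2.
  by apply: ler_sum => i _; apply: ler_sum => j _; apply: gl.
apply: le_trans up _.
apply: (@le_trans _ _ (4 * (T%:R / S%:R) ^+ 2 * ((4 * T%:R ^+ 2)^-1 * gr))).
  rewrite le_eqVlt; apply/orP; left; apply/eqP; field.
  by rewrite !gt_eqF.
rewrite ler_wpM2l //.
by apply: ger_avs_cst => //; rewrite size_box muln_gt0 S0.
Qed.

End domination.

(** * Averages over cubes *)

Section cube_average.
Variables (R : realFieldType) (X : finZmodType).
Implicit Types (s t K : seq X) (F G : X -> R) (x v : X) (Ks : seq (seq X)).
Implicit Types (Th : (X -> R) -> R).

(** Iterated multiplicative derivatives: for [Th] the mean this averages the product of [G] over the
    vertices of a cube with edges from [Ks], as in a Gowers norm. The final functional is a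
    parameter so that the last direction can be absorbed into it. *)
Fixpoint cube_avg Ks Th G : R :=
  if Ks is K :: Ks' then avs K (fun v => cube_avg Ks' Th (fun x => G x * G (x + v)))
  else Th G.

Lemma cube_avg_rcons Ks K Th G : cube_avg (rcons Ks K) Th G =
  cube_avg Ks (fun H => avs K (fun v => Th (fun x => H x * H (x + v)))) G.
Proof. by elim: Ks G => //= L Ks IH G; apply: eq_avs => v; rewrite IH. Qed.

Lemma cube_avg_swap K L Ks Th G :
  cube_avg (K :: L :: Ks) Th G = cube_avg (L :: K :: Ks) Th G.
Proof.
rewrite /= exchange_avs; apply: eq_avs => v; apply: eq_avs => w.
congr cube_avg; apply: funext => x.
by rewrite -!mulrA; congr (_ * _); rewrite mulrCA [x + v + w]addrAC.
Qed.

(** Derivatives commute, so any direction can be made the last one, where the others are already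
    chosen and only [corr H] of the derivative [H] is left. *)
Lemma cube_avg_rot Ks K Th G : cube_avg (rcons Ks K) Th G = cube_avg (K :: Ks) Th G.
Proof.
elim: Ks G => // L Ks IH G; rewrite cube_avg_swap /=.
by apply: eq_avs => v; rewrite IH.
Qed.

Lemma cube_avgD Ks Th1 Th2 G :
  cube_avg Ks (fun H => Th1 H + Th2 H) G = cube_avg Ks Th1 G + cube_avg Ks Th2 G.
Proof. by elim: Ks G => //= K Ks IH G; rewrite -avsD; apply: eq_avs => v; rewrite IH. Qed.

Lemma cube_avgZ Ks Th c G : cube_avg Ks (fun H => c * Th H) G = c * cube_avg Ks Th G.
Proof. by elim: Ks G => //= K Ks IH G; rewrite -avsZ; apply: eq_avs => v; rewrite IH. Qed.

Lemma cube_avg_cst Ks c G : all (fun K => 0 < size K)%N Ks -> cube_avg Ks (fun=> c) G = c.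
Proof.
elim: Ks G => //= K Ks IH G /andP[K0 Ks0].
by under eq_avs do rewrite IH//; rewrite avs_cst.
Qed.

Lemma cube_avg_ge0 Ks Th G : (forall H, 0 <= Th H) -> 0 <= cube_avg Ks Th G.
Proof. by move=> T0; elim: Ks G => //= K Ks IH G; apply: avs_ge0. Qed.

Section shift_class.
Variable e : X.

Definition almost_invariant (z : R) G :=
  (forall x, 0 <= G x <= 1) /\ mean (fun x => `|G (x + e) - G x|) <= z.

Lemma almost_invariant_mul z G v :
  almost_invariant z G -> almost_invariant (2 * z) (fun x => G x * G (x + v)).
Proof.
move=> [G01 Gz]; split=> [x|].
  have /andP[a b] := G01 x; have /andP[c d] := G01 (x + v).
  by rewrite mulr_ge0// mulr_ile1.
apply: (@le_trans _ _ (mean (fun x => `|G (x + e) - G x| + `|G (x + v + e) - G (x + v)|))).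
  apply: ler_mean => x; rewrite [x + e + v]addrAC.
  have := G01 x; have := G01 (x + v + e).
  move: (G (x + e)) (G x) (G (x + v + e)) (G (x + v)) => a b c d c01 b01.
  have -> : a * c - b * d = (a - b) * c + b * (c - d) by ring.
  apply: le_trans (ler_normD _ _) _; rewrite !normrM.
  case/andP: c01 => c0 c1; case/andP: b01 => b0 b1.
  rewrite (ger0_norm c0) (ger0_norm b0).
  by apply: lerD; [rewrite ler_piMr|rewrite ler_piMl].
by rewrite meanD (mean_shift (fun x => `|G (x + e) - G x|)); lra.
Qed.

Lemma ler_cube_avg Ks Th1 Th2 z G :
  (forall H, almost_invariant (2 ^+ size Ks * z) H -> Th1 H <= Th2 H) ->
  almost_invariant z G -> cube_avg Ks Th1 G <= cube_avg Ks Th2 G.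
Proof.
elim: Ks z G => [|K Ks IH] z G /= hT hG.
  by apply: hT; rewrite expr0 mul1r.
apply: ler_avs => v; apply: (IH (2 * z)); last exact: almost_invariant_mul.
by move=> H hH; apply: hT; rewrite exprSr -mulrA.
Qed.

Lemma almost_invariant_le z z' G : z <= z' -> almost_invariant z G -> almost_invariant z' G.
Proof. by move=> zz [G01 Gz]; split => //; apply: le_trans zz. Qed.

(** Each direction in turn is rotated to the end, where the hypothesis applies to every derivative
    [H], and stays there as [A i]. Each derivative doubles the constant of almost invariance, hence
    the power of 2 in front of [z]. *)
Lemma cube_avg_replace (I : Type) (A B : I -> seq X) (ii jj : seq I) (c z Z : R) G :
  0 <= z -> all (fun i => 0 < size (A i))%N ii -> all (fun i => 0 < size (B i))%N (ii ++ jj) ->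
  (forall i H, almost_invariant Z H -> avs (B i) (corr H) - c <= avs (A i) (corr H)) ->
  2 ^+ (size ii + size jj) * z <= Z -> almost_invariant z G ->
  cube_avg (map B (ii ++ jj)) (@mean R X) G - (size ii)%:R * c <=
  cube_avg (map B jj ++ map A ii) (@mean R X) G.
Proof.
move=> z0 + + hAB + hG; elim/last_ind: ii jj => [|ii i IH] jj A0 B0 hz.
  by rewrite cats0 /= mul0r subr0.
move: A0; rewrite all_rcons => /andP[Ai A0].
rewrite size_rcons cat_rcons in hz B0 *; rewrite map_rcons -rcons_cat.
have := IH (i :: jj) A0 B0; rewrite /= addnS -addSn => /(_ hz).
rewrite -natr1 mulrDl mul1r => h.
set Ks := map B jj ++ map A ii in h *.
suff : avs (B i) (fun v => cube_avg Ks (@mean R X) (fun x => G x * G (x + v))) - c <=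
   cube_avg (rcons Ks (A i)) (@mean R X) G by move: h; lra.
rewrite -[avs _ _]/(cube_avg (B i :: Ks) _ G) -cube_avg_rot !cube_avg_rcons.
have KsN : all (fun K => 0 < size K)%N Ks.
  rewrite /Ks all_cat !all_map/=; apply/andP; split => //.
  by move: B0; rewrite all_cat => /andP[_ /andP[]].
rewrite -[c](cube_avg_cst c G KsN) -mulN1r -cube_avgZ -cube_avgD.
apply: (ler_cube_avg (z := z)) => // H hH.
rewrite mulN1r; apply: hAB; apply: almost_invariant_le hH.
apply: le_trans hz; rewrite ler_wpM2r// ler_weXn2l ?ler1n//.
by rewrite /Ks size_cat !size_map addnC addSn.
Qed.

End shift_class.

(** Since [Th] is nonnegative, domination of measures can be used in one direction after the other.
    It turns a mixed cube into one with all its directions in [L]. *)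
Lemma cube_avg_dominated (Ks : seq (seq X)) L (j : nat) (D : R) Th G :
  0 <= D -> (forall H, 0 <= Th H) ->
  {in Ks, forall K F, (forall x, 0 <= F x) -> avs K F <= D * avs L F} ->
  cube_avg (nseq j L ++ Ks) Th G <= D ^+ size Ks * cube_avg (nseq (j + size Ks) L) Th G.
Proof.
move=> D0 T0 hD; elim: j G => [|j IH] G /=; last first.
  by rewrite -avsZ; apply: ler_avs => v; exact: IH.
rewrite add0n; elim: Ks hD G => [|K Ks IH] hD G /=; first by rewrite expr0 mul1r.
have Ks_le v : cube_avg Ks Th (fun x => G x * G (x + v)) <=
    D ^+ size Ks * cube_avg (nseq (size Ks) L) Th (fun x => G x * G (x + v)).
  by apply: IH => K' hK'; apply: hD; rewrite inE hK' orbT.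
apply: le_trans (ler_avs _ Ks_le) _.
rewrite avsZ exprSr -mulrA ler_wpM2l ?exprn_ge0//.
apply: hD; first by rewrite mem_head.
by move=> x; exact: cube_avg_ge0.
Qed.

Definition psi s := subseqs s s.

Lemma size_psi s : (0 < size s)%N -> (0 < size (psi s))%N.
Proof. by move=> s0; rewrite size_allpairs muln_gt0 s0. Qed.

(** As for Gowers norms: the average of [corr G] over [psi s] is an energy, hence at least
    [mean G ^+ 2], and the power mean inequality carries this through the induction. *)
Lemma cube_avg_psi_ge s n G : (0 < size s)%N -> (forall x, 0 <= G x) ->
  mean G ^+ (2 ^ n) <= cube_avg (nseq n (psi s)) (@mean R X) G.
Proof.
move=> s0; elim: n G => [|n IH] G G0 /=; first by rewrite expn0 expr1.
apply: (@le_trans _ _ (avs (psi s) (fun v => corr G v ^+ (2 ^ n)))); last first.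
  by apply: ler_avs => v; apply: IH => x; rewrite mulr_ge0.
apply: le_trans (avs_exp2 _ _ (size_psi s0)).
rewrite -energyE expnS exprM.
by rewrite lerXn2r ?nnegrE ?sqr_ge0 ?energy_ge0// energy_ge.
Qed.

Lemma cube_avg_psi_mono s t n G : (0 < size s)%N -> (0 < size t)%N ->
  (forall x, 0 <= G x <= 1) ->
  cube_avg (nseq n (psi (addseq s t))) (@mean R X) G <= cube_avg (nseq n (psi s)) (@mean R X) G.
Proof.
move=> s0 t0 G01.
have st0 : (0 < size (addseq s t))%N by rewrite size_allpairs muln_gt0 s0.
(* Almost invariance along 0 with constant 1 asks only for [0 <= G <= 1]. The loss [c] is 0 because
   convolution decreases energies. *)
have G1 : almost_invariant 0 1 G.
  split=> //; apply: (@le_trans _ _ (mean (fun _ : X => 1))); last by rewrite mean_cst.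
  by apply: ler_mean => x; have := G01 x; have := G01 (x + 0); rewrite ler_norml; lra.
have := @cube_avg_replace 0 unit (fun=> psi s) (fun=> psi (addseq s t)) (nseq n tt) [::] 0 1
  (2 ^+ n) G ler01.
rewrite cats0 mulr0 subr0 /= !map_nseq; apply => //.
- by rewrite all_nseq size_psi ?orbT.
- by rewrite all_nseq size_psi ?orbT.
- by move=> _ H _; rewrite subr0 -!energyE; exact: energy_addseq.
- by rewrite size_nseq addn0 mulr1.
Qed.

(** The link between energies and counts: an energy averaged over derivatives is a cube average with
    one more direction. So the mean energy drop is bounded by the drop of a single number, fit for a
    pigeonhole. *)
Lemma cube_avg_psi_gap s t n G : (0 < size s)%N -> (0 < size t)%N ->
  (forall x, 0 <= G x <= 1) ->
  cube_avg (nseq n (psi (addseq s t))) (fun H => energy s H - energy (addseq s t) H) G <=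
  cube_avg (nseq n.+1 (psi s)) (@mean R X) G -
  cube_avg (nseq n.+1 (psi (addseq s t))) (@mean R X) G.
Proof.
move=> s0 t0 G01; set P := psi (addseq s t).
have rc (u : seq X) : cube_avg (psi u :: nseq n P) (@mean R X) G =
    cube_avg (nseq n P) (energy u) G.
  rewrite -cube_avg_rot cube_avg_rcons; congr cube_avg; apply: funext => H.
  by rewrite energyE.
have -> : cube_avg (nseq n P) (fun H => energy s H - energy (addseq s t) H) G =
   cube_avg (nseq n P) (energy s) G - cube_avg (nseq n P) (energy (addseq s t)) G.
  rewrite -[in RHS]mulN1r -cube_avgZ -cube_avgD; congr cube_avg; apply: funext => H.
  by rewrite mulN1r.
rewrite -!rc lerD2r /=; apply: ler_avs => v.
apply: cube_avg_psi_mono => // x.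
have /andP[a b] := G01 x; have /andP[c d] := G01 (x + v).
by rewrite mulr_ge0// mulr_ile1.
Qed.

End cube_average.

(** * One scale: from box directions to arc directions *)

Section single_scale.
Variables (R : archiRcfType) (X : finZmodType) (e1 e2 : X).
Implicit Types (s t K : seq X) (F G : X -> R) (x v : X) (l : R).

Definition arc_seq l (a M : nat) : seq X :=
  [seq arc_pt e1 e2 l u | u <- index_iota a (a + M)].

Lemma size_arc_seq l a M : size (arc_seq l a M) = M.
Proof. by rewrite size_map size_iota addKn. Qed.

Lemma arc_avgE l a M F : arc_avg e1 e2 l a M F = avs (arc_seq l a M) F.
Proof. by rewrite /arc_avg /avs size_arc_seq big_map. Qed.

Lemma mem_arc_seq l a M v : v \in arc_seq l a M ->
  exists2 u, (a <= u < a + M)%N & v = e1 *+ farc l u + e2 *+ u.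
Proof. by move=> /mapP[u]; rewrite mem_index_iota => h ->; exists u. Qed.

(** A shift by [b - b'] is compared with no shift by moving [b'] to the other factor: what remains
    is the difference of two arc averages of the kind in the hypothesis, against a factor between 0
    and 1. *)
Lemma arc_seq_corr l a M s G eta : (0 < size s)%N -> (forall x, 0 <= G x <= 1) ->
  {in s, forall b, mean (fun x => `|arc_avg e1 e2 l a M (fun y => G (x + y) - G (x + y + b))|) <= eta} ->
  avs (addseq (arc_seq l a M) (psi s)) (corr G) - 2 * eta <= avs (arc_seq l a M) (corr G).
Proof.
move=> s0 G01 hs; rewrite lerBlDr -lerBlDl avs_addseq exchange_avs avs_subseqs.
rewrite -[X in _ - X](avs_cst _ s0) -avsB; apply: ler_avs_cst => // b hb.
rewrite -[X in _ - X](avs_cst _ s0) -avsB; apply: ler_avs_cst => // b' hb'.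
set sg := arc_seq _ _ _.
pose d u x := arc_avg e1 e2 l a M (fun y => G (x + y) - G (x + y + u)).
have -> : avs sg (fun y => corr G (y + (b - b'))) - avs sg (corr G) =
    mean (fun x => G (x + b') * (d b' x - d b x)).
  rewrite -avsB.
  transitivity (avs sg (fun y => mean (fun x => G (x + b') * (G (x + y + b) - G (x + y + b'))))).
    apply: eq_avs => y; rewrite /corr -meanB -(mean_shift _ b'); apply: eq_mean => x.
    rewrite -mulrBr [x + b' + y]addrAC; congr (_ * (G _ - _)).
    by rewrite -[LHS]addrA -[RHS]addrA; congr (_ + _); rewrite addrCA [b' + _]addrC subrK.
  rewrite -mean_avs; apply: eq_mean => x.
  rewrite avsZ; congr (_ * _); rewrite /d !arc_avgE -avsB; apply: eq_avs => y.
  ring.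
apply: (@le_trans _ _ (mean (fun x => `|d b' x| + `|d b x|))).
  apply: ler_mean => x; apply: le_trans (ler_normB _ _).
  apply: le_trans (ler_norm _) _; rewrite normrM ger0_norm; last by case/andP: (G01 (x + b')).
  by rewrite ler_piMl//; case/andP: (G01 (x + b')).
by rewrite meanD mulr2n mulrDl mul1r; apply: lerD; exact: hs.
Qed.

(** With [c] and [c'], which occur on both sides, fixed, only [box_domination] is left; the grid of
    side [S + truncn l + 1] contains every translate of the box by a point of the arc. *)
Lemma arc_psi_dominated l a M s0 (S T : nat) (D : R) F :
  0 < l -> (0 < S)%N -> (0 < size s0)%N -> (0 < M)%N -> (a + M)%:R <= l ->
  (2 * (2 * S + (Num.truncn l).+1) <= T)%N -> 4 * (T%:R / S%:R) ^+ 2 <= D ->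
  (forall x, 0 <= F x) ->
  avs (addseq (arc_seq l a M) (psi (addseq s0 (box e1 e2 S)))) F <=
  D * avs (psi (addseq (addseq s0 (box e1 e2 S)) (box e1 e2 T))) F.
Proof.
move=> l0 S0 s00 M0 aMl TS TD F0.
set s := addseq s0 _.
have s_gt0 : (0 < size s)%N by rewrite size_allpairs size_box !muln_gt0 s00 S0.
have T0 : (0 < T)%N by apply: leq_trans TS; rewrite muln_gt0 addnS.
pose P c c' := avs (box e1 e2 S) (fun b => avs (subseqs (box e1 e2 T) (box e1 e2 T))
  (fun z => F (b + z + (c - c')))).
have -> : avs (psi (addseq s (box e1 e2 T))) F = avs s0 (fun c => avs s (fun c' => P c c')).
  rewrite /psi avs_subseqs avs_addseq /s avs_addseq; apply: eq_avs => c.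
  rewrite -/s.
  under eq_avs => b do under eq_avs => z do rewrite avs_addseq.
  under eq_avs => b do rewrite exchange_avs.
  rewrite exchange_avs; apply: eq_avs => c'; apply: eq_avs => b.
  rewrite avs_subseqs; apply: eq_avs => z; apply: eq_avs => z'; congr F.
  by rewrite opprD addrACA [c + b]addrC -[b + c - c']addrA [RHS]addrAC.
have -> : avs (addseq (arc_seq l a M) (psi s)) F =
    avs s0 (fun c => avs s (fun c' => avs (arc_seq l a M) (fun y =>
      avs (box e1 e2 S) (fun b => F (y + b + (c - c')))))).
  rewrite avs_addseq exchange_avs avs_subseqs /s avs_addseq -/s; apply: eq_avs => c.
  rewrite exchange_avs; apply: eq_avs => c'; rewrite exchange_avs; apply: eq_avs => y.
  apply: eq_avs => b; congr F.
  by rewrite [c + b]addrC !addrA.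
rewrite -avsZ; apply: ler_avs => c; rewrite -avsZ; apply: ler_avs => c'.
have hP : 0 <= P c c' by apply: avs_ge0 => b; apply: avs_ge0.
apply: (@le_trans _ _ (4 * (T%:R / S%:R) ^+ 2 * P c c')); last by rewrite ler_wpM2r.
apply: (@box_domination _ _ e1 e2 (arc_seq l a M) (fun x => F (x + (c - c'))) S T (S + (Num.truncn l).+1)) => //.
- by rewrite size_arc_seq.
- have lt : l < (Num.truncn l).+1%:R by case/andP: (truncn_itv (ltW l0)).
  move=> y /mem_arc_seq[u /andP[_ uaM] ->]; exists (farc l u), u; split => //.
    rewrite addnC leq_add2l; apply: ltnW; rewrite -(ltr_nat R).
    have /andP[h _] := farc_itv l u.
    by apply: le_lt_trans h (le_lt_trans (arc_le _ _) lt); exact: ltW.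
  rewrite addnC leq_add2l; apply: ltnW; rewrite -(ltr_nat R).
  apply: le_lt_trans lt; apply: le_trans aMl; rewrite ler_nat; exact: ltnW.
- by rewrite addnA addnn -mul2n.
Qed.

End single_scale.

Section scale_bound.
Variables (R : archiRcfType) (X : finZmodType) (e1 e2 : X).

(** The intermediate measure is [K i], the arc convolved with [psi s]. Passing between [K i] and the
    bare arc uses the hypothesis on arc averages; passing between [psi s'] and [K i] loses the
    energy drop of each derivative, averaged to at most [D ^+ n * gap]. Both lose a further
    [2 * eta] per direction. *)
Lemma scale_bound (n : nat) (l eta D z : R) (aa MM : 'I_n -> nat) (s0 : seq X)
    (S T : nat) (G : X -> R) :
  let s := addseq s0 (box e1 e2 S) in
  let s' := addseq s (box e1 e2 T) in
  let gap := cube_avg (nseq n (psi s)) (@mean R X) G -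
             cube_avg (nseq n (psi s')) (@mean R X) G in
  0 < eta -> 0 <= z -> 0 < l -> (0 < S)%N -> (0 < size s0)%N ->
  (forall i, 0 < MM i)%N -> (forall i, (aa i + MM i)%:R <= l) ->
  (2 * (2 * S + (Num.truncn l).+1) <= T)%N -> 4 * (T%:R / S%:R) ^+ 2 <= D ->
  1 <= D -> 2 * l <= eta * T%:R ->
  (forall i H, almost_invariant e1 (2 ^+ n * z) H ->
     {in s, forall b, mean (fun x => `|arc_avg e1 e2 l (aa i) (MM i)
        (fun y => H (x + y) - H (x + y + b))|) <= eta}) ->
  almost_invariant e1 z G ->
  cube_avg (nseq n (psi s')) (@mean R X) G - n%:R * (4 * eta + D ^+ n * gap / eta) <=
  cube_avg [seq arc_seq e1 e2 l (aa i) (MM i) | i <- enum 'I_n] (@mean R X) G.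
Proof.
move=> s s' gap eta0 z0 l0 S0 s00 MM0 aMl TS TD D1 lT hA hG.
have G01 := hG.1.
have D0 : 0 <= D by apply: le_trans D1.
have S_gt0 : (0 < size (box e1 e2 S))%N by rewrite size_box muln_gt0 S0.
have T0 : (0 < T)%N by apply: leq_trans TS; rewrite muln_gt0 addnS.
have T_gt0 : (0 < size (box e1 e2 T))%N by rewrite size_box muln_gt0 T0.
have s_gt0 : (0 < size s)%N by rewrite size_allpairs muln_gt0 s00.
have s'_gt0 : (0 < size s')%N by rewrite size_allpairs muln_gt0 s_gt0.
pose A i := arc_seq e1 e2 l (aa i) (MM i).
pose K i := addseq (A i) (psi s).
have A_gt0 i : (0 < size (A i))%N by rewrite size_arc_seq.
have K_gt0 i : (0 < size (K i))%N by rewrite size_allpairs muln_gt0 A_gt0 size_psi.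
have step1 : cube_avg (map K (enum 'I_n)) (@mean R X) G - n%:R * (2 * eta) <=
    cube_avg (map A (enum 'I_n)) (@mean R X) G.
  have := @cube_avg_replace R X e1 'I_n A K (enum 'I_n) [::] (2 * eta) z (2 ^+ n * z) G z0.
  rewrite cats0 cat0s size_enum_ord addn0; apply => //.
  - exact/allP.
  - exact/allP.
  - move=> i H hH; apply: arc_seq_corr => //; first exact: hH.1.
    exact: hA.
pose th (H : X -> R) := energy s H - energy s' H.
have th0 H : 0 <= th H by rewrite subr_ge0; exact: energy_addseq.
have KE i (H : X -> R) : (forall x, 0 <= H x <= 1) ->
    avs (psi s') (corr H) - (2 * eta + th H / eta) <= avs (K i) (corr H).
  move=> H01; rewrite -energyE avs_addseq.
  apply: ger_avs_cst => // _ /mem_arc_seq[u /andP[_ uaM] ->].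
  have := @corr_energy_lb R X e1 e2 s T H (farc l u) u eta s_gt0 T0 H01 eta0.
  apply: le_trans; rewrite -/s' -/(th H).
  have : (farc l u + u)%:R / T%:R <= eta.
    rewrite ler_pdivrMr ?ltr0n// natrD; apply: le_trans lT.
    have /andP[h _] := farc_itv l u.
    have h1 : (farc l u)%:R <= l by apply: le_trans h (arc_le _ _); exact: ltW.
    have h2 : u%:R <= l by apply: le_trans (aMl i); rewrite ler_nat ltnW.
    lra.
  lra.
have Kdom i (F : X -> R) : (forall x, 0 <= F x) -> avs (K i) F <= D * avs (psi s') F.
  by move=> F0; apply: arc_psi_dominated.
have gap0 : 0 <= gap by rewrite subr_ge0; apply: cube_avg_psi_mono.
pose c := 2 * eta + D ^+ n * gap / eta.
have step2 (ii : seq 'I_n) (j : nat) : (j + size ii = n)%N ->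
    cube_avg (nseq n (psi s')) (@mean R X) G - (size ii)%:R * c <=
    cube_avg (nseq j (psi s') ++ map K ii) (@mean R X) G.
  elim/last_ind: ii j => [|ii i IH] j.
    by rewrite addn0 => ->; rewrite mul0r subr0 cats0.
  rewrite size_rcons addnS => hj.
  have := IH j.+1; rewrite addSn => /(_ hj) h.
  rewrite -natr1 mulrDl mul1r map_rcons -rcons_cat.
  rewrite -[nseq j.+1 _ ++ _]/(psi s' :: (nseq j (psi s') ++ map K ii)) in h.
  set Ks := nseq j (psi s') ++ map K ii in h *.
  have KsN : all (fun K => 0 < size K)%N Ks.
    by rewrite /Ks all_cat all_nseq size_psi// orbT all_map; apply/allP => k _; exact: K_gt0.
  suff : cube_avg (psi s' :: Ks) (@mean R X) G - c <= cube_avg (rcons Ks (K i)) (@mean R X) G.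
    by move: h; lra.
  rewrite -cube_avg_rot !cube_avg_rcons.
  (* The cube is mixed here: some directions are [psi s'], the others [K]. Domination makes all of
     them [psi s'], where [cube_avg_psi_gap] applies. *)
  have thle : cube_avg Ks th G <= D ^+ n * gap.
    apply: (@le_trans _ _ (D ^+ size ii * gap)); last first.
      by rewrite ler_wpM2r// ler_weXn2l//; move: hj; clear; lia.
    apply: le_trans (cube_avg_dominated (L := psi s') (D := D) _ _ _ _ _) _ => //.
      by move=> _ /mapP[k _ ->] F F0; exact: Kdom.
    rewrite size_map ler_wpM2l ?exprn_ge0//.
    have := @cube_avg_psi_gap R X s (box e1 e2 T) (j + size ii) G s_gt0 T_gt0 G01.
    by rewrite hj.
  apply: (@le_trans _ _ (cube_avg Ks (fun H => avs (psi s') (corr H) +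
     (- (2 * eta) + (- eta^-1) * th H)) G)).
    rewrite !cube_avgD (cube_avgZ Ks th) cube_avg_cst// lerD2l /c.
    have : cube_avg Ks th G / eta <= D ^+ n * gap / eta by rewrite ler_pM2r ?invr_gt0.
    by lra.
  apply: (@ler_cube_avg _ _ e1 _ _ _ z) => // H [H01 _].
  by apply: le_trans (KE i H H01); rewrite opprD mulNr [_^-1 * _]mulrC.
have := step2 (enum 'I_n) 0%N; rewrite size_enum_ord add0n => /(_ erefl).
by move: step1; rewrite /= /c -/A; lra.
Qed.

End scale_bound.

(** * Pigeonholing the scale *)

Section ladder.
Variables (X : finZmodType) (e1 e2 : X) (S T : nat -> nat).

(** Each rung only convolves the previous one further, so cube counts decrease along the ladder and
    their drops add up to at most 1. [S j] will be a small and [T j] a large multiple of the radius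
    at scale [j]. *)
Fixpoint ladder (j : nat) : seq X :=
  if j is i.+1 then addseq (addseq (ladder i) (box e1 e2 (S i))) (box e1 e2 (T i))
  else [:: 0].

Lemma mem_addseq_box (s : seq X) (P W : nat) :
  {in s, forall b, exists t1 t2, [/\ (t1 <= P)%N, (t2 <= P)%N & b = e1 *+ t1 + e2 *+ t2]} ->
  {in addseq s (box e1 e2 W), forall b, exists t1 t2,
     [/\ (t1 <= P + W)%N, (t2 <= P + W)%N & b = e1 *+ t1 + e2 *+ t2]}.
Proof.
move=> hs _ /allpairsP[[a b]/= [/hs[t1 [t2 [h1 h2 ->]]] /mem_box[i [k [iW kW ->]]] ->]].
exists (t1 + i)%N, (t2 + k)%N; split; [lia|lia|].
by rewrite !mulrnDr addrACA.
Qed.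

Lemma mem_ladder j : {in ladder j, forall b, exists t1 t2,
  [/\ (t1 <= \sum_(i < j) (S i + T i))%N, (t2 <= \sum_(i < j) (S i + T i))%N &
      b = e1 *+ t1 + e2 *+ t2]}.
Proof.
elim: j => [|j IH].
  by move=> b; rewrite inE => /eqP ->; exists 0%N, 0%N; rewrite !mulr0n addr0.
rewrite big_ord_recr/= addnA; do 2 apply: mem_addseq_box; exact: IH.
Qed.

Lemma size_ladder j : (forall i, 0 < S i)%N -> (forall i, 0 < T i)%N -> (0 < size (ladder j))%N.
Proof.
move=> S0 T0; elim: j => //= j IH.
by rewrite !size_allpairs !size_run !muln_gt0 IH !S0 !T0.
Qed.

End ladder.

(* The factor 4 between consecutive arcs makes the heights superincreasing. *)
Definition arc_lo (R : archiRcfType) (l : R) (i : nat) : nat := (Num.truncn (l / 4 ^+ i.+2)).+1.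
Definition arc_num (R : archiRcfType) (l : R) (i : nat) : nat := Num.truncn (l / 4 ^+ i.+2).

(** The shortest arc, for [i = n - 1], has length about [l / 4 ^+ n.+1 = 2 * c * l]; rounding costs
    at most [1 <= c * l]. *)
Lemma arc_lo_num (R : archiRcfType) (l c : R) (n i : nat) : (i < n)%N ->
  c = (2 * 4 ^+ n.+1)^-1 -> 4 <= l -> 1 <= c * l ->
  [/\ c * l <= (arc_lo l i)%:R, c * l <= (arc_num l i)%:R & 2 * (arc_lo l i + arc_num l i)%:R <= l].
Proof.
move=> iin -> l4 cl.
have p0 (m : nat) : 0 < 4 ^+ m :> R by rewrite exprn_gt0.
have xlo : 2 * ((2 * 4 ^+ n.+1)^-1 * l) <= l / 4 ^+ i.+2.
  have -> : 2 * ((2 * 4 ^+ n.+1)^-1 * l) = l / 4 ^+ n.+1 by field; rewrite gt_eqF.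
  rewrite ler_wpM2l//; first by lra.
  by rewrite lef_pV2 ?posrE// ler_weXn2l// ler1n.
have xhi : l / 4 ^+ i.+2 <= l / 16.
  rewrite ler_wpM2l//; first by lra.
  rewrite lef_pV2 ?posrE//.
  have -> : 16 = 4 ^+ 2 :> R by ring.
  by rewrite ler_weXn2l// ler1n.
rewrite /arc_lo /arc_num; move: xlo xhi; set x := l / _; set y := _ * l in cl *.
move=> xlo xhi; have /andP[h1 h2] := @truncn_itv R x ltac:(lra).
by move: h1 h2; rewrite natrD -natr1; split; lra.
Qed.

Lemma finite_core (R : archiRcfType) (n : nat) (delta : R) :
  (0 < n)%N -> 0 < delta <= 1 ->
  exists (zeta C l0 : R) (J : nat), [/\ 0 < zeta, 1 <= C, 1 <= l0 &
  forall (X : finZmodType) (e1 e2 : X) (G : X -> R) (ls : nat -> R),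
  l0 <= ls 0%N -> (forall j, C * ls j <= ls j.+1) ->
  almost_invariant e1 zeta G -> delta <= mean G ->
  exists2 j, (j < J)%N & 0 < cube_avg
    [seq arc_seq e1 e2 (ls j) (arc_lo (ls j) i) (arc_num (ls j) i) | i : 'I_n <- enum 'I_n]
    (@mean R X) G].
Proof.
move=> n0 /andP[d0 d1].
have nR : 1 <= n%:R :> R by rewrite ler1n.
pose P := delta ^+ (2 ^ n).
have P0 : 0 < P by rewrite exprn_gt0.
have P1 : P <= 1 by rewrite exprn_ile1// ltW.
(* The losses are [4 * n * eta = P / 4] and, by the choice of [J], at most [P / 4] for the energy
   drop; half of [P] is left. *)
pose eta := P / (16 * n%:R).
have n16 : 0 < 16 * n%:R :> R by lra.
have eta0 : 0 < eta by rewrite divr_gt0.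
have etaE : 16 * n%:R * eta = P by rewrite /eta; field; rewrite gt_eqF//; lra.
have eta1 : eta <= 1 by nra.
clearbody eta.
pose c : R := (2 * 4 ^+ n.+1)^-1.
have c0 : 0 < c by rewrite invr_gt0 mulr_gt0// exprn_gt0.
have c1 : c <= 1.
  rewrite invf_le1 ?mulr_gt0 ?exprn_gt0//.
  have : 1 <= 4 ^+ n.+1 :> R by rewrite exprn_ege1// ler1n.
  lra.
have [||ep' [zeta' [l1 [ep'0 z'0 l11 H]]]] := @arc_equidist R eta c; [by rewrite eta0|by rewrite c0|].
pose ep := Num.min ep' 1.
have ep0 : 0 < ep by rewrite lt_min ep'0 ltr01.
have ep1 : ep <= 1 by rewrite ge_min lexx orbT.
have epep : ep <= ep' by rewrite ge_min lexx.
(* [T j] is about [C'] times the radius, so displacements along the arc cost at most [eta]. [S j] is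
   about [ep / 4] times the radius, and [D] bounds [4 * (T j / S j) ^+ 2]. *)
pose C' := 16 / eta.
have C'e : C' * eta = 16 by rewrite /C'; field; rewrite gt_eqF.
have C'16 : 16 <= C' by nra.
pose D := 4 * (8 * C' / ep) ^+ 2.
have D1 : 1 <= D.
  have : 1 <= 8 * C' / ep by rewrite ler_pdivlMr// mul1r; lra.
  by rewrite /D; nra.
have D0 : 0 <= D by lra.
pose J := (Num.truncn (4 * n%:R * D ^+ n / (eta * P))).+1.
(* This growth keeps the total side of all earlier boxes within [ep / 2] times the next radius, see
   [Pb]. *)
pose C := 2 * (C' + 3) / ep.
have Ce : C * ep = 2 * (C' + 3) by rewrite /C; field; rewrite gt_eqF.
have C1 : 1 <= C by nra.
pose l0 := l1 + 4 / ep + c^-1 + 8.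
have i1 : 0 <= 4 / ep by rewrite divr_ge0// ltW.
have i2 : 0 <= c^-1 by rewrite invr_ge0 ltW.
exists (zeta' / 2 ^+ n), C, l0, J; split => //; [by rewrite divr_gt0// exprn_gt0|by rewrite /l0; lra|].
move=> X e1 e2 G ls ls0 lsC hG dG.
have G01 := hG.1.
have lsl0 j : l0 <= ls j.
  elim: j => // j IH; apply: le_trans (lsC j); have : 0 <= ls j by rewrite /l0 in IH; lra.
  by move=> h; apply: le_trans IH _; rewrite ler_peMl.
have ls_pos j : 0 < ls j by have := lsl0 j; rewrite /l0; lra.
have ls_ep j : 4 <= ls j * ep.
  by rewrite -ler_pdivrMr//; have := lsl0 j; rewrite /l0; lra.
have ls_c j : 1 <= c * ls j.
  by rewrite mulrC -ler_pdivrMr// div1r; have := lsl0 j; rewrite /l0; lra.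
pose S j := (Num.truncn (ep / 4 * ls j)).+1.
pose T j := (Num.truncn (C' * ls j)).+1.
have Sb j : ep / 4 * ls j <= (S j)%:R <= ep / 4 * ls j + 1.
  by apply: truncnS_itv; rewrite mulr_ge0 ?divr_ge0// ltW.
have Tb j : C' * ls j <= (T j)%:R <= C' * ls j + 1.
  by apply: truncnS_itv; rewrite mulr_ge0// ?ltW//; lra.
pose Pj j := (\sum_(i < j) (S i + T i))%N.
have Pb j : (Pj j)%:R <= ep / 2 * ls j.
  elim: j => [|j IH]; first by rewrite /Pj big_ord0 mulr_ge0 ?divr_ge0// ltW.
  rewrite /Pj big_ord_recr/= -/(Pj j) !natrD.
  have /andP[_ hS] := Sb j; have /andP[_ hT] := Tb j.
  apply: (@le_trans _ _ (ep / 2 * (C * ls j))).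
    have -> : ep / 2 * (C * ls j) = (C' + 3) * ls j by rewrite -[RHS]mul1r; nra.
    have : ep * ls j <= ls j by rewrite ler_piMl// ltW.
    by have := lsl0 j; rewrite /l0; lra.
  by rewrite ler_pM2l// divr_gt0.
pose s j := addseq (ladder e1 e2 S T j) (box e1 e2 (S j)).
pose E j := cube_avg (nseq n (psi (s j))) (@mean R X) G.
pose E' j := cube_avg (nseq n (psi (ladder e1 e2 S T j))) (@mean R X) G.
have lad0 j : (0 < size (ladder e1 e2 S T j))%N by apply: size_ladder.
have box0 W : (0 < W)%N -> (0 < size (box e1 e2 W))%N by rewrite size_box muln_gt0 => ->.
have s0 j : (0 < size (s j))%N by rewrite size_allpairs muln_gt0 lad0 box0.
have EE' j : E j <= E' j by apply: cube_avg_psi_mono; rewrite ?box0.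
(* From [E j] to [E' j.+1] one adds the large box, from [E' j] to [E j] the small one. Only the
   first kind of drop matters; the second has the right sign. *)
have tel m : \sum_(j < m) (E j - E' j.+1) + E' m <= 1.
  elim: m => [|m IH].
    rewrite big_ord0 add0r -(@cube_avg_cst R X (nseq n (psi (ladder e1 e2 S T 0))) 1 G).
      apply: (@ler_cube_avg _ _ e1 _ _ _ _ _ _ hG) => H' [H01 _].
      by rewrite -[leRHS](mean_cst X); apply: ler_mean => x; case/andP: (H01 x).
    by rewrite all_nseq size_psi ?orbT.
  by rewrite big_ord_recr/=; have := EE' m; lra.
have J0 : 0 < J%:R :> R by rewrite ltr0n.
have [j jJ gapj] : exists2 j, (j < J)%N & E j - E' j.+1 <= J%:R^-1.
  apply: contrapT => hn.
  have big j : (j < J)%N -> J%:R^-1 < E j - E' j.+1.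
    by move=> jJ; rewrite ltNge; apply/negP => h; apply: hn; exists j.
  have E'0 : 0 <= E' J.
    apply: (@le_trans _ _ (mean G ^+ (2 ^ n))).
      by rewrite exprn_ge0//; apply: le_trans dG; exact: ltW.
    by apply: cube_avg_psi_ge => // x; case/andP: (G01 x).
  have : \sum_(j < J) J%:R^-1 < \sum_(j < J) (E j - E' j.+1).
    apply: ltr_sum; last by move=> i _; exact: big.
    by apply/hasP; exists ord0; rewrite ?mem_index_enum.
  rewrite sumr_const card_ord -[_ *+ _]mulr_natl divff ?gt_eqF//.
  by have := tel J; lra.
exists j => //.
have /andP[Sj1 Sj2] := Sb j; have /andP[Tj1 Tj2] := Tb j.
have lj0 := ls_pos j; have lje := ls_ep j; have ljl := lsl0 j.
have zE : 2 ^+ n * (zeta' / 2 ^+ n) = zeta' by field; rewrite expf_eq0 pnatr_eq0 andbF.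
have hall (i : 'I_n) := @arc_lo_num R (ls j) c n i (ltn_ord i) erefl ltac:(by rewrite /l0 in ljl; lra) (ls_c j).
have lb := @scale_bound R X e1 e2 n (ls j) eta D (zeta' / 2 ^+ n)
  (fun i => arc_lo (ls j) i) (fun i => arc_num (ls j) i)
  (ladder e1 e2 S T j) (S j) (T j) G eta0.
apply: lt_le_trans (lb _ _ _ _ _ _ _ _ _ _ _ hG) => {lb} //.
- rewrite -/(s j) -/(E j).
  have hE : P <= E' j.+1.
    apply: (@le_trans _ _ (mean G ^+ (2 ^ n))).
      by rewrite lerXn2r ?nnegrE// ?ltW//; apply: lt_le_trans dG.
    by apply: cube_avg_psi_ge => // x; case/andP: (G01 x).
  rewrite -[cube_avg (nseq n (psi (addseq (s j) _))) _ _]/(E' j.+1).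
  have Jb : 4 * n%:R * D ^+ n / (eta * P) < J%:R.
    rewrite /J; set x := _ / _.
    have x0 : 0 <= x by apply: divr_ge0; [rewrite !mulr_ge0 ?exprn_ge0|rewrite mulr_ge0// ltW].
    by have /andP[_ ] := truncn_itv x0.
  have h : 4 * (n%:R * (D ^+ n * (E j - E' j.+1) / eta)) <= P.
    have h1 : n%:R * (D ^+ n * (E j - E' j.+1) / eta) <= n%:R * (D ^+ n * J%:R^-1 / eta).
      by rewrite ler_wpM2l// ler_pM2r ?invr_gt0// ler_wpM2l ?exprn_ge0.
    have h2 : 4 * (n%:R * (D ^+ n * J%:R^-1 / eta)) <= P.
      move: Jb; rewrite ltr_pdivrMr ?mulr_gt0// => /ltW Jb.
      have -> : 4 * (n%:R * (D ^+ n * J%:R^-1 / eta)) = 4 * n%:R * D ^+ n / (J%:R * eta).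
        by field; rewrite !gt_eqF.
      rewrite ler_pdivrMr ?mulr_gt0//.
      by have -> : P * (J%:R * eta) = J%:R * (eta * P) by ring.
    lra.
  have : 4 * (n%:R * (4 * eta)) = P by rewrite -etaE; ring.
  by move: h hE P0; rewrite [n%:R * (4 * eta + _)]mulrDr; set y := n%:R * (_ / eta); clear; lra.
- by rewrite divr_ge0 ?exprn_ge0// ltW.
- move=> i; have [_ h _] := hall i; rewrite -(ltr_nat R); apply: lt_le_trans h.
  by rewrite mulr_gt0.
- move=> i; have [_ _ h] := hall i; lra.
- rewrite -(ler_nat R) natrM natrD natrM -natr1.
  have /andP[h _] := @truncn_itv R (ls j) (ltW lj0).
  have : ep * ls j <= ls j by rewrite ler_piMl// ltW.
  have : 16 * ls j <= C' * ls j by rewrite ler_pM2r.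
  rewrite /l0 in ljl; lra.
- have q : 0 <= 8 * C' / ep by rewrite divr_ge0 ?(ltW ep0)// mulr_ge0//; lra.
  have r : (T j)%:R / (S j)%:R <= 8 * C' / ep.
    rewrite ler_pdivrMr ?ltr0n//.
    apply: (@le_trans _ _ (8 * C' / ep * (ep / 4 * ls j))); last by rewrite ler_wpM2l.
    have -> : 8 * C' / ep * (ep / 4 * ls j) = 2 * (C' * ls j) by field; rewrite gt_eqF.
    have : 16 * ls j <= C' * ls j by rewrite ler_pM2r.
    rewrite /l0 in ljl; lra.
  by rewrite /D ler_pM2l// lerXn2r// nnegrE.
- have : eta * (C' * ls j) <= eta * (T j)%:R by rewrite ler_pM2l.
  by rewrite mulrA [eta * C']mulrC C'e; lra.
- move=> i H' hH' b; rewrite zE in hH'.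
  move=> /(mem_addseq_box (@mem_ladder X e1 e2 S T j))[t1 [t2 [h1 h2 ->]]].
  have [a1 a2 a3] := hall i.
  have bd t : (t <= Pj j + S j)%N -> t%:R <= ep' * ls j.
    move=> ht; apply: (@le_trans _ _ (ep * ls j)); last by rewrite ler_pM2r.
    apply: (@le_trans _ _ ((Pj j + S j)%:R)); first by rewrite ler_nat.
    by rewrite natrD; have := Pb j; lra.
  apply: (H X e1 e2 H' (ls j) _ _ t1 t2 _ hH'.1 hH'.2 a1 a2 a3 (bd _ h1) (bd _ h2)).
  by rewrite /l0 in ljl; lra.
Qed.

(** * From the torus to the lattice *)

HB.instance Definition _ (U V : finZmodType) := GRing.Zmodule.on (U * V)%type.

Lemma avs_gt0 (R : realFieldType) (X : finZmodType) (s : seq X) (F : X -> R) :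
  0 < avs s F -> exists2 v, v \in s & 0 < F v.
Proof.
move=> h; apply: contrapT => hn; move: h; apply/negP; rewrite -leNgt.
rewrite /avs mulr_ge0_le0 ?invr_ge0// big_seq sumr_le0// => v vs.
by rewrite leNgt; apply/negP => Fv; apply: hn; exists v.
Qed.

Lemma cube_avg_gt0 (R : realFieldType) (X : finZmodType) (I : eqType) (A : I -> seq X)
    (ii : seq I) (G : X -> R) : uniq ii ->
  0 < cube_avg [seq A i | i <- ii] (@mean R X) G ->
  exists (v : I -> X) (x : X), {in ii, forall i, v i \in A i} /\
    forall r : pred I, G (x + \sum_(i <- ii | r i) v i) != 0.
Proof.
elim: ii G => [|i ii IH] G /=.
  move=> _ h; have [x Gx] : exists x, G x != 0.
    apply: contrapT => hn; move: h; rewrite (@eq_mean _ _ _ (fun=> 0)) ?mean_cst ?ltxx// => x.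
    by apply: contrapT => /eqP Gx; apply: hn; exists x.
  by exists (fun=> 0), x; split => // r; rewrite big_nil addr0.
move=> /andP[iNii uii] /avs_gt0[w wA /(IH _ uii)[v [x [vA hx]]]].
exists (fun k => if k == i then w else v k), x; split=> [k|r].
  by rewrite inE; case: eqP => [->//|_ /= /vA].
rewrite big_cons eqxx.
have -> : \sum_(j <- ii | r j) (if j == i then w else v j) = \sum_(j <- ii | r j) v j.
  rewrite big_seq_cond [RHS]big_seq_cond; apply: eq_bigr => j /andP[jii _].
  by case: eqP jii iNii => // -> ->.
have := hx r; rewrite mulf_eq0 negb_or => /andP[h1 h2].
by case: (r i) => //; rewrite [w + _]addrC addrA.
Qed.

Lemma arc_num_le (R : archiRcfType) (l : R) (i u : nat) :
  0 <= l -> (u < arc_lo l i + arc_num l i)%N -> u%:R <= l.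
Proof.
rewrite /arc_lo /arc_num => l0; set x := l / _.
have x0 : 0 <= x by rewrite divr_ge0 ?exprn_ge0.
have xl : 2 * x <= l.
  rewrite /x mulrA ler_pdivrMr ?exprn_gt0// mulrC ler_wpM2l//.
  have : 1 <= 4 ^+ i.+1 :> R by rewrite exprn_ege1// ler1n.
  by move=> h; rewrite [4 ^+ i.+2]exprS; lra.
rewrite addSn ltnS addnn -mul2n -(ler_nat R) natrM => ul.
have /andP[h _] := truncn_itv x0.
lra.
Qed.

(** [f] lives in one quarter of a torus of side [2 * N]. The empty subset shows that the base vertex
    is in [[0, N]^2], and all offsets are below [N]; so no vertex wraps around and the cube is one
    of the integer lattice. *)
Lemma torus_core (R : archiRcfType) (n : nat) (delta : R) :
  (0 < n)%N -> 0 < delta <= 1 ->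
  exists (zeta C l0 : R) (J : nat), [/\ 0 < zeta, 1 <= C, 1 <= l0 &
  forall (N : nat) (f : nat -> nat -> bool) (ls : nat -> R),
  (0 < N)%N -> l0 <= ls 0%N -> (forall j, C * ls j <= ls j.+1) ->
  (forall j, (j < J)%N -> n%:R * ls j < N%:R) ->
  (forall i j, f i j -> (i <= N)%N /\ (j <= N)%N) ->
  delta * (2 * N)%:R ^+ 2 <= \sum_(i < 2 * N) \sum_(j < 2 * N) (f i j)%:R ->
  \sum_(i < 2 * N) \sum_(j < 2 * N) (f (i.+1 %% (2 * N))%N j != f i j)%:R <=
    zeta * (2 * N)%:R ^+ 2 ->
  exists j, [/\ (j < J)%N & exists (u : 'I_n -> nat) (a b : nat),
    (forall i : 'I_n, arc_lo (ls j) i <= u i < arc_lo (ls j) i + arc_num (ls j) i)%N /\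
    (forall r : {ffun 'I_n -> bool}, f (a + \sum_(i < n | r i) farc (ls j) (u i))%N
                                      (b + \sum_(i < n | r i) u i)%N)]].
Proof.
move=> n0 d01; have [zeta [C [l0 [J [z0 C1 l01 H]]]]] := finite_core n0 d01.
exists zeta, C, l0, J; split => // N f ls N0 ls0 lsC lsN fN fd fz.
pose P := (2 * N)%N.
have P1 : (1 < P)%N by rewrite /P; lia.
pose X : finZmodType := ('Z_P * 'Z_P)%type.
have ZP : (Zp_trunc P).+2 = P by rewrite Zp_cast.
pose G (x : X) : R := (f (x.1 : nat) (x.2 : nat))%:R.
pose e1 : X := (1, 0); pose e2 : X := (0, 1).
have sumX (F : nat -> nat -> R) :
    \sum_(x : X) F (x.1 : nat) (x.2 : nat) = \sum_(i < P) \sum_(j < P) F i j.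
  rewrite -(pair_bigA _ (fun i j : 'Z_P => F i j))/=.
  by rewrite ZP.
have cardX : #|X|%:R = (2 * N)%:R ^+ 2 :> R.
  by rewrite card_prod card_ord ZP natrM expr2.
have cX0 : 0 < (2 * N)%:R ^+ 2 :> R by rewrite exprn_gt0// ltr0n; lia.
have hG : almost_invariant e1 zeta G.
  split=> [x|]; first by rewrite /G ler0n/= lern1 leq_b1.
  rewrite /mean cardX mulrC ler_pdivrMr//; apply: le_trans fz.
  rewrite -/P -(sumX (fun i j => (f (i.+1 %% P)%N j != f i j)%:R)).
  apply: ler_sum => -[i j] _.
  have -> : (i, j) + e1 = (i + 1, j) :> X.
    by apply: (congr1 (pair (i + 1))); exact: addr0.
  have Gp (a b : 'Z_P) : G (a, b) = (f a b)%:R by [].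
  rewrite !Gp.
  have -> : (i + 1 : 'Z_P) = (i.+1 %% P)%N :> nat.
    by rewrite /= modnDmr addn1; congr (_ %% _)%N.
  by case: (f _ _); case: (f _ _); rewrite /= ?subrr ?subr0 ?sub0r ?normrN ?normr0 ?normr1.
have dG : delta <= mean G.
  by rewrite /mean cardX mulrC ler_pdivlMr//; apply: le_trans fd _; rewrite (sumX (fun i j => (f i j)%:R)).
have [j jJ hj] := H X e1 e2 G ls ls0 lsC hG dG.
exists j; split => //.
have [v [x [vA hx]]] := cube_avg_gt0 (enum_uniq _) hj.
have ex (i : 'I_n) : exists u, (arc_lo (ls j) i <= u < arc_lo (ls j) i + arc_num (ls j) i)%N /\
    v i = e1 *+ farc (ls j) u + e2 *+ u.
  by have [u h1 h2] := mem_arc_seq (vA i (mem_enum _ _)); exists u.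
have [u hu] := choice ex.
exists u, (x.1 : nat), (x.2 : nat); split=> [i|r]; first by have [] := hu i.
set sm := (\sum_(i < n | r i) farc (ls j) (u i))%N.
set su := (\sum_(i < n | r i) u i)%N.
have vE : \sum_(i <- enum 'I_n | r i) v i = (sm%:R, su%:R) :> X.
  have e1n m : e1 *+ m = (m%:R, 0) :> X.
    elim: m => [//|m IH]; rewrite mulrS IH.
    have -> : m.+1%:R = 1 + m%:R :> 'Z_P by rewrite mulrS.
    by apply: (congr1 (pair (1 + m%:R))); exact: addr0.
  have e2n m : e2 *+ m = (0, m%:R) :> X.
    elim: m => [//|m IH]; rewrite mulrS IH.
    have -> : m.+1%:R = 1 + m%:R :> 'Z_P by rewrite mulrS.
    by apply: (congr1 (fun a => (a, 1 + m%:R))); exact: addr0.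
  rewrite big_enum_cond/= /sm /su; elim/big_rec3: _ => // i y1 y2 y3 ri ->.
  rewrite (hu i).2 !natrD e1n e2n.
  transitivity ((((farc (ls j) (u i))%:R + 0) + y2%:R, (0 + (u i)%:R) + y1%:R) : X); first by [].
  by rewrite addr0 add0r.
have val_nat (y : 'Z_P) (m : nat) : (y + m <= (2 * N).-1)%N -> (y + m%:R)%R = (y + m)%N :> nat.
  move=> h; rewrite -[y in LHS]natr_Zp -natrD val_Zp_nat// modn_small//.
  by apply: leq_ltn_trans h _; rewrite /P prednK// muln_gt0.
have fx r' : f ((x + \sum_(i <- enum 'I_n | (r' : pred 'I_n) i) v i).1 : nat)
    ((x + \sum_(i <- enum 'I_n | r' i) v i).2 : nat).
  by have := hx r'; rewrite /G pnatr_eq0 eqb0 negbK.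
have [x1N x2N] : (x.1 <= N)%N /\ (x.2 <= N)%N.
  by apply: fN; have := fx pred0; rewrite big_pred0_eq addr0.
have lsj0 : 0 <= ls j.
  have : forall k, 0 <= ls k.
    elim=> [|k IH]; first by lra.
    by apply: le_trans (lsC k); rewrite mulr_ge0//; lra.
  exact.
have small (F : 'I_n -> nat) : (forall i, (F i)%:R <= ls j) -> (\sum_(i < n | r i) F i < N)%N.
  move=> hF; rewrite -(ltr_nat R); apply: le_lt_trans (lsN j jJ).
  rewrite natr_sum; apply: (@le_trans _ _ (\sum_(i < n) ls j)).
    by rewrite big_mkcond/=; apply: ler_sum => i _; case: ifP.
  by rewrite sumr_const card_ord mulr_natl.
have smN : (sm < N)%N.
  apply: small => i; have /andP[h _] := farc_itv (ls j) (u i).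
  by apply: le_trans h (arc_le _ _).
have suN : (su < N)%N.
  apply: small => i; have /andP[_ hi] := (hu i).1.
  exact: arc_num_le hi.
have := fx (fun i => r i); rewrite vE.
rewrite -[(x + _).1]/(x.1 + sm%:R) -[(x + _).2]/(x.2 + su%:R).
by rewrite !val_nat// -ltnS prednK ?muln_gt0// mul2n -addnn -addnS leq_add.
Qed.

(** * Borel sets of the plane and grids *)

Section measure_tools.
Variable R : realType.
Notation T := (measurableTypeR R * measurableTypeR R)%type.
Local Notation mu := (borel_measure2 R).

Lemma borel_measure2X (A B : set (measurableTypeR R)) : measurable A -> measurable B ->
  mu (A `*` B) = (lebesgue_measure A * lebesgue_measure B)%E.
Proof. exact: product_measure1E. Qed.

Definition shiftR (c : R) (x : measurableTypeR R) : measurableTypeR R := x + c.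

Lemma measurable_shiftR c : measurable_fun setT (shiftR c).
Proof. by apply: measurable_funD => //; exact: measurable_cst. Qed.

Lemma lebesgue_measure_shift (c : R) (A : set (measurableTypeR R)) : measurable A ->
  lebesgue_measure (shiftR c @^-1` A) = lebesgue_measure A.
Proof.
move=> mA; rewrite -[LHS]/(pushforward lebesgue_measure (shiftR c) A).
apply/esym/lebesgue_measure_unique => //; first exact: measurable_shiftR.
move=> mf _ [[a b] _ <-].
suff : lebesgue_measure `]a, b]%classic = lebesgue_measure (shiftR c @^-1` `]a, b]%classic) by [].
have -> : shiftR c @^-1` `]a, b]%classic = `]a - c, b - c]%classic.
  by apply/seteqP; split => x /=; rewrite /shiftR !in_itv/= ltrBlDr lerBrDr.
rewrite !lebesgue_measure_itv/= !lte_fin ltrD2r; case: ifP => // _.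
by rewrite -!EFinB; congr (_%:E); ring.
Qed.

Definition shift2 (v p : T) : T := (shiftR v.1 p.1, shiftR v.2 p.2).

Lemma measurable_shift2 v : measurable_fun setT (shift2 v).
Proof.
apply/measurable_fun_pairP; split.
  exact: (measurableT_comp (measurable_shiftR v.1) measurable_fst).
exact: (measurableT_comp (measurable_shiftR v.2) measurable_snd).
Qed.

Lemma borel_measure2_shift (v : T) (A : set T) : measurable A ->
  mu (shift2 v @^-1` A) = mu A.
Proof.
move=> mA; rewrite -[LHS]/(pushforward mu (shift2 v) A).
apply/esym/product_measure_unique => //; first exact: measurable_shift2.
move=> mf B C mB mC; rewrite /= /pushforward.
have -> : shift2 v @^-1` (B `*` C) = (shiftR v.1 @^-1` B) `*` (shiftR v.2 @^-1` C) by [].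
rewrite borel_measure2X; first by rewrite !lebesgue_measure_shift.
- by rewrite -[X in measurable X]setTI; apply: measurable_shiftR.
- by rewrite -[X in measurable X]setTI; apply: measurable_shiftR.
Qed.

Lemma upper_density_square (A : set (R * R)) : (0 < upper_banach_density A)%E ->
  exists2 d : R, 0 < d <= 1 & forall W0 : R, exists W x, [/\ W0 <= W, 0 < W &
    ((d * W ^+ 2)%:E <= lebesgue_measure2 (A `&` square x W))%E].
Proof.
pose F (r : R) := ereal_sup [set (lebesgue_measure2 (A `&` square x r) / (r ^+ 2)%:E)%E
  | x in [set: R * R]].
rewrite /upper_banach_density -/F; set D := limf_esup _ _ => D0.
have [d /andP[d0 d1] dD] : exists2 d : R, 0 < d <= 1 & (d%:E < D)%E.
  case: D D0 => [r|_|//]; last by exists 1; rewrite ?ltr01 ?lexx// ltry.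
  rewrite lte_fin => r0; exists (Num.min 1 (r / 2)).
    by rewrite lt_min ltr01/= divr_gt0//= ge_min lexx.
  rewrite lte_fin; apply: (@le_lt_trans _ _ (r / 2)); last by lra.
  by rewrite ge_min lexx orbT.
exists d; first by rewrite d0.
move=> W0.
(* A limsup is an infimum of suprema over neighbourhoods of infinity; the one used is given by
   [W0 <= W] and [0 < W]. *)
have : (d%:E < ereal_sup (F @` [set W : R | (W0 <= W)%R /\ (0 < W)%R]))%E.
  apply: (lt_le_trans dD); apply: ereal_inf_lbound.
  exists [set W : R | (W0 <= W)%R /\ (0 < W)%R] => //.
  exists (Num.max W0 1); split; first exact: num_real.
  move=> W /=; rewrite gt_max => /andP[h1 h2]; split; first exact: ltW.
  by apply: lt_trans h2.
move=> /ereal_sup_gt[_ [W [W0W Wp] <-]]; rewrite /F.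
move=> /ereal_sup_gt[_ [x _ <-]] h; exists W, x; split => //.
move: h; rewrite inver gt_eqF ?exprn_gt0// lte_pdivlMr ?exprn_gt0// => /ltW.
by rewrite -EFinM.
Qed.

(** The Caratheodory condition splits [Q] along [A]. Removing from [Q] a countable Borel cover of
    the part outside [A], of nearly the same outer measure, leaves a Borel set inside [A] that has
    lost at most [e]. *)
Lemma borel_inner (A : set (R * R)) (Q : set T) (e : R) : 0 < e ->
  lebesgue_measurable2 A -> measurable Q -> (mu Q < +oo)%E ->
  exists B : set T, [/\ measurable B, B `<=` A `&` Q &
    (lebesgue_measure2 (A `&` Q) <= mu B + e%:E)%E].
Proof.
move=> e0 mA mQ Qoo.
pose nu : set T -> \bar R := mu_ext mu.
have nuQ : nu Q = mu Q by exact: measurable_mu_extE.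
have split_Q : mu Q = (nu (Q `&` A) + nu (Q `&` ~` A))%E by rewrite -nuQ; exact: mA.
have nuQA : (nu (Q `&` A) <= mu Q)%E by rewrite -nuQ; apply: le_mu_ext; exact: subIsetl.
have nuQC : (nu (Q `&` ~` A) <= mu Q)%E by rewrite -nuQ; apply: le_mu_ext; exact: subIsetl.
have fin1 : nu (Q `&` A) \is a fin_num.
  by rewrite ge0_fin_numE ?mu_ext_ge0//; exact: le_lt_trans Qoo.
have fin2 : nu (Q `&` ~` A) \is a fin_num.
  by rewrite ge0_fin_numE ?mu_ext_ge0//; exact: le_lt_trans Qoo.
have [_ [F [mF FQ] <-] hF] := lb_ereal_inf_adherent e0 fin2.
pose U := \bigcup_k F k.
have mU : measurable U by apply: bigcup_measurable.
have muU : (mu U <= nu (Q `&` ~` A) + e%:E)%E.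
  apply: le_trans (ltW hF). apply: measure_sigma_subadditive; [exact: mF|exact: mU|exact: subset_refl].
exists (Q `\` U); split.
- exact: measurableD.
- move=> p [Qp Up]; split => //; apply: contrapT => Ap; apply: Up; apply: FQ.
  by split.
have finU : (mu (Q `&` U) < +oo)%E.
  by apply: le_lt_trans Qoo; apply: le_measure; rewrite ?inE//; exact: measurableI.
have -> : mu (Q `\` U) = (mu Q - mu (Q `&` U))%E by exact: measureD.
have QU : (mu (Q `&` U) <= nu (Q `&` ~` A) + e%:E)%E.
  by apply: le_trans muU; apply: le_measure; rewrite ?inE//; exact: measurableI.
rewrite -[lebesgue_measure2 _]/(nu (A `&` Q)) setIC split_Q.
have finU' : mu (Q `&` U) \is a fin_num by rewrite ge0_fin_numE.
move: QU; rewrite -(fineK fin1) -(fineK fin2) -(fineK finU').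
by rewrite -EFinB -!EFinD !lee_fin; lra.
Qed.

End measure_tools.

Section grid.
Variable R : realType.
Notation T := (measurableTypeR R * measurableTypeR R)%type.
Local Notation mu := (borel_measure2 R).
Variables (x0 : T) (W : R).
Hypothesis W0 : 0 < W.

(** In the normalised coordinate [(t - x) / W], refining the mesh by [k] is division of indices by
    [k]. Bands are half-open, hence disjoint. *)
Definition band (x : R) (N i : nat) : set (measurableTypeR R) :=
  [set t : R | i%:R <= N%:R * ((t - x) / W) < i.+1%:R].

Definition cell (N i j : nat) : set T := band x0.1 N i `*` band x0.2 N j.

(** Its length is [2 * W], while the set of interest lies in a square of side [W]: this margin
    becomes the room against wrapping around the torus. *)
Definition seg (x : R) : set (measurableTypeR R) := [set t : R | 0 <= (t - x) / W < 2].

Definition window : set T := seg x0.1 `*` seg x0.2.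

Lemma bandE x N i : (0 < N)%N ->
  band x N i = `[x + i%:R * (W / N%:R), x + i.+1%:R * (W / N%:R)[%classic.
Proof.
move=> N0; have NR : 0 < N%:R :> R by rewrite ltr0n.
have h0 : 0 < W / N%:R by rewrite divr_gt0.
apply/seteqP; split => t; rewrite /band /= in_itv/=.
  have -> : N%:R * ((t - x) / W) = (t - x) / (W / N%:R) by field; rewrite !gt_eqF.
  by rewrite ler_pdivlMr// ltr_pdivrMr// lerBrDl ltrBlDl.
have -> : N%:R * ((t - x) / W) = (t - x) / (W / N%:R) by field; rewrite !gt_eqF.
by rewrite ler_pdivlMr// ltr_pdivrMr// lerBrDl ltrBlDl.
Qed.

Lemma segE x : seg x = `[x, x + 2 * W[%classic.
Proof.
apply/seteqP; split => t; rewrite /seg /= in_itv/= ler_pdivlMr// ltr_pdivrMr//;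
  by rewrite mul0r subr_ge0 ltrBlDl.
Qed.

Lemma measurable_band x N i : (0 < N)%N -> measurable (band x N i).
Proof. by move=> N0; rewrite bandE//; exact: measurable_itv. Qed.

Lemma measurable_cell N i j : (0 < N)%N -> measurable (cell N i j).
Proof. by move=> N0; apply: measurableX; exact: measurable_band. Qed.

Lemma measurable_seg x : measurable (seg x).
Proof. by rewrite segE; exact: measurable_itv. Qed.

Lemma measurable_window : measurable window.
Proof. by apply: measurableX; exact: measurable_seg. Qed.

Lemma cell_measure N i j : (0 < N)%N -> mu (cell N i j) = ((W / N%:R) ^+ 2)%:E.
Proof.
move=> N0; have h0 : 0 < W / N%:R by rewrite divr_gt0// ltr0n.
have band_m x k : lebesgue_measure (band x N k) = (W / N%:R)%:E.
  rewrite bandE// lebesgue_measure_itv/= lte_fin ltrD2l ltr_pM2r// ltr_nat ltnSn.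
  by rewrite -EFinB; congr (_%:E); rewrite -natr1; ring.
by rewrite borel_measure2X ?band_m ?expr2//; exact: measurable_band.
Qed.

Lemma window_measure : mu window = ((2 * W) ^+ 2)%:E.
Proof.
have seg_m x : lebesgue_measure (seg x) = (2 * W)%:E.
  by rewrite segE lebesgue_measure_itv/= lte_fin ltrDl mulr_gt0// -EFinB addrAC subrr add0r.
by rewrite borel_measure2X ?seg_m ?expr2//; exact: measurable_seg.
Qed.

Definition wm (B : set T) : R := fine (mu (window `&` B)).

Lemma window_fin B : measurable B -> mu (window `&` B) \is a fin_num.
Proof.
move=> mB; rewrite ge0_fin_numE//; apply: (@le_lt_trans _ _ (mu window)).
  apply: le_measure; rewrite ?inE//; [|exact: measurable_window].
  by apply: measurableI => //; exact: measurable_window.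
by rewrite window_measure ltry.
Qed.

Lemma wmE B : measurable B -> (wm B)%:E = mu (window `&` B).
Proof. by move=> mB; rewrite fineK// window_fin. Qed.

Lemma wm_ge0 B : 0 <= wm B.
Proof. exact: fine_ge0. Qed.

Lemma wm_le A B : measurable A -> measurable B -> window `&` A `<=` B -> wm A <= wm B.
Proof.
move=> mA mB AB; rewrite -lee_fin !wmE//.
have mW := measurable_window.
apply: le_measure; rewrite ?inE//; try exact: measurableI.
by move=> p [Wp Ap]; split => //; apply: AB.
Qed.

Lemma wmU A B : measurable A -> measurable B -> wm (A `|` B) <= wm A + wm B.
Proof.
move=> mA mB; have mW := measurable_window.
rewrite -lee_fin EFinD !wmE//; last exact: measurableU.
by rewrite setIUr; apply: measureU2; exact: measurableI.
Qed.

Lemma wmD A B : measurable A -> measurable B -> wm A = wm (A `&` B) + wm (A `\` B).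
Proof.
move=> mA mB; have mW := measurable_window.
have mAB : measurable (A `&` B) by exact: measurableI.
have mDB : measurable (A `\` B) by exact: measurableD.
apply: EFin_inj; rewrite EFinD !wmE//.
rewrite -measureU; [|exact: measurableI|exact: measurableI|].
  rewrite -setIUr; congr (mu (_ `&` _)); apply/seteqP; split=> p /=; last by case=> -[].
  by move=> Ap; have [Bp|Bp] := pselect (B p); [left|right].
by apply/seteqP; split => p //= [[_ [_ Bp]] [_ [_ nBp]]].
Qed.

Definition grid_set (N : nat) (D : nat -> nat -> bool) : set T :=
  \bigcup_i \bigcup_j (if D i j then cell N i j else set0).

Lemma measurable_grid_set N D : (0 < N)%N -> measurable (grid_set N D).
Proof.
move=> N0; apply: bigcup_measurable => i _; apply: bigcup_measurable => j _.
by case: ifP => // _; exact: measurable_cell.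
Qed.

Lemma grid_setP N D p : grid_set N D p <-> exists i j, D i j /\ cell N i j p.
Proof.
split=> [[i _ [j _]]|[i [j [Dij cp]]]]; last by exists i => //; exists j => //; rewrite Dij.
by case: ifP => // Dij cp; exists i, j.
Qed.

Lemma band_uniq x N i i' t : band x N i t -> band x N i' t -> i = i'.
Proof.
rewrite /band /= => /andP[h1 h2] /andP[h3 h4].
have := le_lt_trans h1 h4; have := le_lt_trans h3 h2; rewrite !ltr_nat; clear; lia.
Qed.

Lemma cell_uniq N i j i' j' p : cell N i j p -> cell N i' j' p -> i = i' /\ j = j'.
Proof. by move=> [h1 h2] [h3 h4]; split; [exact: band_uniq h1 h3|exact: band_uniq h2 h4]. Qed.

Lemma seg_band x N t : (0 < N)%N -> seg x t -> exists2 i, (i < 2 * N)%N & band x N i t.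
Proof.
move=> N0 /andP[h1 h2]; have NR : 0 < N%:R :> R by rewrite ltr0n.
have y0 : 0 <= N%:R * ((t - x) / W) by rewrite mulr_ge0.
have /andP[a b] := truncn_itv y0.
exists (Num.truncn (N%:R * ((t - x) / W))); last by rewrite /band /= a.
rewrite -(ltr_nat R); apply: le_lt_trans a _.
by rewrite natrM mulrC ltr_pM2r.
Qed.

Lemma window_cell N p : (0 < N)%N -> window p ->
  exists i j, [/\ (i < 2 * N)%N, (j < 2 * N)%N & cell N i j p].
Proof.
by move=> N0 [/(seg_band N0)[i iN ci] /(seg_band N0)[j jN cj]]; exists i, j.
Qed.

Lemma grid_setC N D p : (0 < N)%N -> window p ->
  grid_set N (fun i j => ~~ D i j) p <-> ~ grid_set N D p.
Proof.
move=> N0 Wp; have [i [j [_ _ cp]]] := window_cell N0 Wp.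
split=> [/grid_setP[i1 [j1 [nD c1]]] /grid_setP[i2 [j2 [D2 c2]]]|h].
  by have [e1 e2] := cell_uniq c1 c2; rewrite e1 e2 D2 in nD.
apply/grid_setP; exists i, j; split => //; apply/negP => Dij; apply: h.
by apply/grid_setP; exists i, j.
Qed.

Lemma band_refine x N k i t : (0 < k)%N -> band x (N * k) i t -> band x N (i %/ k) t.
Proof.
move=> k0; rewrite /band /= natrM => /andP[h1 h2].
have kR : 0 < k%:R :> R by rewrite ltr0n.
apply/andP; split.
  rewrite -(ler_pM2r kR) -natrM mulrAC; apply: le_trans h1.
  by rewrite ler_nat leq_trunc_div.
rewrite -(ltr_pM2r kR) -natrM mulrAC; apply: lt_le_trans h2 _.
by rewrite ler_nat ltn_ceil.
Qed.

Lemma cell_refine N k i j p : (0 < k)%N -> cell (N * k) i j p -> cell N (i %/ k) (j %/ k) p.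
Proof. by move=> k0 [h1 h2]; split; exact: band_refine. Qed.

Lemma grid_set_refine N k D p : (0 < N)%N -> (0 < k)%N -> window p ->
  grid_set N D p <-> grid_set (N * k) (fun i j => D (i %/ k)%N (j %/ k)%N) p.
Proof.
move=> N0 k0 Wp; split=> /grid_setP[i [j [Dij cp]]].
  have [|i' [j' [_ _ cp']]] := @window_cell (N * k) p _ Wp; first by rewrite muln_gt0 N0.
  apply/grid_setP; exists i', j'; split => //.
  by have [<- <-] := cell_uniq cp (cell_refine k0 cp').
by apply/grid_setP; exists (i %/ k)%N, (j %/ k)%N; split => //; exact: cell_refine.
Qed.

Definition symd (A B : set T) : set T := (A `\` B) `|` (B `\` A).

Lemma measurable_symd A B : measurable A -> measurable B -> measurable (symd A B).
Proof. by move=> mA mB; apply: measurableU; exact: measurableD. Qed.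

(** The sets with this property form a sigma-algebra containing the half-planes, hence all Borel
    sets; for unions two grids are refined to mesh [W / (N * M)]. *)
Definition grid_approx (B : set T) : Prop := measurable B /\
  forall e : R, 0 < e -> exists N D, (0 < N)%N /\ wm (symd B (grid_set N D)) <= e.

Lemma grid_approxC B : grid_approx B -> grid_approx (~` B).
Proof.
move=> [mB hB]; split; first exact: measurableC.
move=> e e0; have [N [D [N0 hD]]] := hB e e0.
exists N, (fun i j => ~~ D i j); split => //; apply: le_trans hD.
have mD E := @measurable_grid_set N E N0.
apply: wm_le; [by apply: measurable_symd => //; exact: measurableC|exact: measurable_symd|].
move=> p [Wp]; have := grid_setC D N0 Wp.
case=> [h1 h2] [[nBp nDp]|[/h1 Dp /contrapT Bp]].
  by right; split => //; apply: contrapT => /h2.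
by left.
Qed.

Lemma grid_approx0 : grid_approx set0.
Proof.
split=> // e e0; exists 1%N, (fun _ _ => false); split => //.
have -> : symd set0 (grid_set 1 (fun _ _ => false)) = set0.
  apply/seteqP; split => // p [[]//|[/grid_setP[i [j []//]]]].
by rewrite /wm setI0 measure0/= ltW.
Qed.

Lemma grid_approxU A B : grid_approx A -> grid_approx B -> grid_approx (A `|` B).
Proof.
move=> [mA hA] [mB hB]; split; first exact: measurableU.
move=> e e0; have e2 : 0 < e / 2 by rewrite divr_gt0.
have [N [D [N0 hD]]] := hA _ e2; have [M [E [M0 hE]]] := hB _ e2.
exists (N * M)%N, (fun i j => D (i %/ M)%N (j %/ M)%N || E (i %/ N)%N (j %/ N)%N).
have NM0 : (0 < N * M)%N by rewrite muln_gt0 N0.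
split => //; have mG K F (K0 : (0 < K)%N) := @measurable_grid_set K F K0.
apply: (@le_trans _ _ (wm (symd A (grid_set N D) `|` symd B (grid_set M E)))); last first.
  apply: le_trans (wmU _ _) _; try by apply: measurable_symd => //; exact: mG.
  by lra.
apply: wm_le.
- by apply: measurable_symd; [exact: measurableU|exact: mG].
- by apply: measurableU; apply: measurable_symd => //; exact: mG.
move=> p [Wp]; have h1 := grid_set_refine D N0 M0 Wp.
have h2 := grid_set_refine E M0 N0 Wp; rewrite [(M * N)%N]mulnC in h2.
case=> [[ABp nG]|[/grid_setP[i [j [/orP[Dij|Eij] cp]]] nAB]].
- case: ABp => [Ap|Bp]; [left|right]; left; split => //.
    move=> /h1/grid_setP[i [j [Dij cp]]]; apply: nG; apply/grid_setP.
    by exists i, j; rewrite Dij.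
  move=> /h2/grid_setP[i [j [Dij cp]]]; apply: nG; apply/grid_setP.
  by exists i, j; rewrite Dij orbT.
- left; right; split; last by move=> Ap; apply: nAB; left.
  by apply/h1/grid_setP; exists i, j.
- right; right; split; last by move=> Bp; apply: nAB; right.
  by apply/h2/grid_setP; exists i, j.
Qed.

(** Continuity from below of the finite measure on the window reduces to a finite union, at the cost
    [e / 2]. *)
Lemma grid_approx_bigcup (F : (set T)^nat) :
  (forall n, grid_approx (F n)) -> grid_approx (\bigcup_n F n).
Proof.
move=> hF; have mF n : measurable (F n) by exact: (hF n).1.
have mU : measurable (\bigcup_n F n) by apply: bigcup_measurable.
split => // e e0; have e2 : 0 < e / 2 by rewrite divr_gt0.
pose G n := \big[setU/set0]_(i < n.+1) F i.
have aG n : grid_approx (G n).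
  rewrite /G; elim/big_ind: _ => //; [exact: grid_approx0|exact: grid_approxU].
have mG n : measurable (G n) by exact: (aG n).1.
have mW := measurable_window.
have GU : \bigcup_n (window `&` G n) = window `&` \bigcup_n F n.
  by rewrite -setI_bigcupr; congr (_ `&` _); rewrite /G bigcup_bigsetU_bigcup.
have cv : (mu \o (fun n => window `&` G n)) n @[n --> \oo] --> mu (window `&` \bigcup_n F n).
  rewrite -GU; apply: nondecreasing_cvg_mu.
  - by move=> n; exact: measurableI.
  - by rewrite GU; exact: measurableI.
  - by move=> n m nm; apply/subsetPset; apply: setIS; exact: subset_bigsetU.
have [n hn] : exists n, wm (\bigcup_n F n) - e / 2 < wm (G n).
  apply: contrapT => hn.
  have : (mu (window `&` \bigcup_n F n) <= (wm (\bigcup_n F n) - e / 2)%:E)%E.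
    rewrite -(cvg_lim _ cv)//; apply: lime_le; first by apply/cvg_ex; eexists; exact: cv.
    apply: nearW => n /=; rewrite -wmE// lee_fin leNgt; apply/negP => h.
    by apply: hn; exists n.
  by rewrite -wmE// lee_fin; lra.
have GF : G n `<=` \bigcup_n F n.
  by rewrite /G -bigcup_mkord => p [i _ Fip]; exists i.
have [N [D [N0 hD]]] := (aG n).2 _ e2.
exists N, D; split => //.
have mD := @measurable_grid_set N D N0.
apply: (@le_trans _ _ (wm ((\bigcup_n F n) `\` G n `|` symd (G n) (grid_set N D)))).
  apply: wm_le; [exact: measurable_symd|apply: measurableU; [exact: measurableD|exact: measurable_symd]|].
  move=> p [_ [[Fp nDp]|[Dp nFp]]].
    by have [Gp|Gp] := pselect (G n p); [right; left|left].
  by right; right; split => // /GF.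
apply: le_trans (wmU _ _) _; [exact: measurableD|exact: measurable_symd|].
have := wmD mU (mG n); rewrite setIidr//; move: hn hD; clear; lra.
Qed.

Lemma sigma_algebra_grid_approx : sigma_algebra setT grid_approx.
Proof.
split; [exact: grid_approx0| |exact: grid_approx_bigcup].
by move=> A hA; rewrite setTD; exact: grid_approxC.
Qed.

(** The bound [c / N] is the area of the strip, one mesh wide, that the cells strictly inside a
    half-plane may miss. *)
Lemma grid_approx_halfplane (c : R) (D : nat -> nat -> nat -> bool) (H : set T) :
  measurable H -> (forall N p, (0 < N)%N -> grid_set N (D N) p -> H p) ->
  (forall N, (0 < N)%N -> wm (H `\` grid_set N (D N)) <= c / N%:R) -> grid_approx H.
Proof.
move=> mH sub bd; split => // e e0.
pose N := (Num.truncn (c / e)).+1; exists N, (D N); split => //.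
have mD := @measurable_grid_set N (D N) isT.
have cN : c <= e * N%:R.
  have [ce|ce] := leP 0 (c / e); last first.
    have c0 : c < 0 by move: ce; rewrite ltr_pdivrMr// mul0r.
    by apply: le_trans (ltW c0) _; rewrite mulr_ge0// ltW.
  have /andP[_ /ltW] := truncn_itv ce.
  by rewrite ler_pdivrMr// mulrC.
apply: (@le_trans _ _ (c / N%:R)); last by rewrite ler_pdivrMr ?ltr0n.
apply: le_trans (bd N isT).
apply: wm_le; [exact: measurable_symd|exact: measurableD|].
by move=> p [_ [//|[/sub Hp]]]; move/(_ isT) in Hp.
Qed.

Lemma strip_measure1 (a b : R) : a <= b -> wm (`[a, b]%classic `*` setT) <= 2 * W * (b - a).
Proof.
move=> ab.
have mA : measurable (`[a, b]%classic : set (measurableTypeR R)) by exact: measurable_itv.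
rewrite -lee_fin wmE; last by apply: measurableX.
have ms := measurable_seg.
apply: (@le_trans _ _ (mu (`[a, b]%classic `*` seg x0.2))).
  apply: le_measure; rewrite ?inE//.
  - by apply: measurableI; [exact: measurable_window|exact: measurableX].
  - exact: measurableX.
  - by move=> p [[_ h] [h' _]].
rewrite borel_measure2X// segE !lebesgue_measure_itv/= !lte_fin ltrDl mulr_gt0//.
case: ifP => _; last by rewrite mul0e lee_fin mulr_ge0 ?subr_ge0// mulr_ge0// ltW.
by rewrite -!EFinB -EFinM lee_fin addrAC subrr add0r mulrC.
Qed.

Lemma strip_measure2 (a b : R) : a <= b -> wm (setT `*` `[a, b]%classic) <= 2 * W * (b - a).
Proof.
move=> ab.
have mA : measurable (`[a, b]%classic : set (measurableTypeR R)) by exact: measurable_itv.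
rewrite -lee_fin wmE; last by apply: measurableX.
have ms := measurable_seg.
apply: (@le_trans _ _ (mu (seg x0.1 `*` `[a, b]%classic))).
  apply: le_measure; rewrite ?inE//.
  - by apply: measurableI; [exact: measurable_window|exact: measurableX].
  - exact: measurableX.
  - by move=> p [[h _] [_ h']].
rewrite borel_measure2X// segE !lebesgue_measure_itv/= !lte_fin ltrDl mulr_gt0//.
case: ifP => _; last by rewrite mule0 lee_fin mulr_ge0 ?subr_ge0// mulr_ge0// ltW.
by rewrite -!EFinB -EFinM lee_fin addrAC subrr add0r.
Qed.

Lemma band_halfline x N i a t : (0 < N)%N -> band x N i t ->
  (N%:R * ((a - x) / W) < i%:R -> a < t) /\
  (~ N%:R * ((a - x) / W) < i%:R -> t <= a + W / N%:R).
Proof.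
move=> N0; have NR : 0 < N%:R :> R by rewrite ltr0n.
have e y : N%:R * ((y - x) / W) = (y - x) / (W / N%:R) by field; rewrite !gt_eqF.
have h0 : 0 < W / N%:R by rewrite divr_gt0.
rewrite /band /= !e -natr1 => /andP[h1 h2]; split=> h.
  by have := lt_le_trans h h1; rewrite ltr_pM2r ?invr_gt0// ltrD2r.
move/negP: h; rewrite -leNgt => h.
have {h1} : (t - x) / (W / N%:R) <= (a - x) / (W / N%:R) + 1.
  by apply: le_trans (ltW h2) _; rewrite lerD2r.
rewrite ler_pdivrMr// mulrDl mul1r divfK ?gt_eqF//; lra.
Qed.

Lemma grid_approx_fst (U : set (measurableTypeR R)) : measurable U ->
  grid_approx (fst @^-1` U).
Proof.
move=> mU; have [s0 sC sU] := sigma_algebra_grid_approx.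
have mfst (V : set (measurableTypeR R)) : measurable V -> measurable (fst @^-1` V : set T).
  by move=> mV; rewrite -[X in measurable X]setTI; exact: measurable_fst.
suff : (measurable : set (set (measurableTypeR R))) `<=` [set V | grid_approx (fst @^-1` V)].
  by apply.
rewrite [X in X `<=` _]RGenOInfty.measurableE; apply: smallest_sub.
  split=> /= [|A hA|A hA].
  - by rewrite preimage_set0.
  - by have := sC _ hA; rewrite !setTD -preimage_setC.
  - by rewrite preimage_bigcup; exact: sU.
move=> _ [a ->] /=.
apply: (@grid_approx_halfplane (2 * W * W) (fun N i j => N%:R * ((a - x0.1) / W) < i%:R)).
- by apply: mfst; exact: measurable_itv.
- move=> N p N0 /grid_setP[i [j [h [c1 _]]]]; rewrite /= in_itv/= andbT.
  by have [h1 _] := band_halfline a N0 c1; exact: h1.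
move=> N N0; rewrite -mulrA.
have -> : W / N%:R = (a + W / N%:R) - a by rewrite addrAC subrr add0r.
have ab : a <= a + W / N%:R by rewrite lerDl divr_ge0// ltW.
apply: le_trans (strip_measure1 ab); apply: wm_le.
- by apply: measurableD; [apply: mfst; exact: measurable_itv|exact: measurable_grid_set].
- by apply: measurableX => //; exact: measurable_itv.
move=> p [Wp []]; rewrite /= in_itv/= andbT => ap np; split => //=.
rewrite in_itv/= (ltW ap)/=.
have [i [j [_ _ cp]]] := window_cell N0 Wp.
have [_ h2] := band_halfline a N0 cp.1; apply: h2 => h; apply: np.
by apply/grid_setP; exists i, j.
Qed.

Lemma grid_approx_snd (U : set (measurableTypeR R)) : measurable U ->
  grid_approx (snd @^-1` U).
Proof.
move=> mU; have [s0 sC sU] := sigma_algebra_grid_approx.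
have msnd (V : set (measurableTypeR R)) : measurable V -> measurable (snd @^-1` V : set T).
  by move=> mV; rewrite -[X in measurable X]setTI; exact: measurable_snd.
suff : (measurable : set (set (measurableTypeR R))) `<=` [set V | grid_approx (snd @^-1` V)].
  by apply.
rewrite [X in X `<=` _]RGenOInfty.measurableE; apply: smallest_sub.
  split=> /= [|A hA|A hA].
  - by rewrite preimage_set0.
  - by have := sC _ hA; rewrite !setTD -preimage_setC.
  - by rewrite preimage_bigcup; exact: sU.
move=> _ [a ->] /=.
apply: (@grid_approx_halfplane (2 * W * W) (fun N i j => N%:R * ((a - x0.2) / W) < j%:R)).
- by apply: msnd; exact: measurable_itv.
- move=> N p N0 /grid_setP[i [j [h [_ c1]]]]; rewrite /= in_itv/= andbT.
  by have [h1 _] := band_halfline a N0 c1; exact: h1.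
move=> N N0; rewrite -mulrA.
have -> : W / N%:R = (a + W / N%:R) - a by rewrite addrAC subrr add0r.
have ab : a <= a + W / N%:R by rewrite lerDl divr_ge0// ltW.
apply: le_trans (strip_measure2 ab); apply: wm_le.
- by apply: measurableD; [apply: msnd; exact: measurable_itv|exact: measurable_grid_set].
- by apply: measurableX => //; exact: measurable_itv.
move=> p [Wp []]; rewrite /= in_itv/= andbT => ap np; split => //=.
rewrite in_itv/= (ltW ap)/=.
have [i [j [_ _ cp]]] := window_cell N0 Wp.
have [_ h2] := band_halfline a N0 cp.2; apply: h2 => h; apply: np.
by apply/grid_setP; exists i, j.
Qed.

Lemma measurable_grid_approx (B : set T) : measurable B -> grid_approx B.
Proof.
apply: smallest_sub; first exact: sigma_algebra_grid_approx.
rewrite subUset; split=> _ [U mU <-]; rewrite setTI;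
  [exact: grid_approx_fst|exact: grid_approx_snd].
Qed.

End grid.

(** * Runs of good cells *)

Section runs.
Variable R : realFieldType.

Lemma sum_shift_le (g : nat -> R) (m r : nat) : (forall i, 0 <= g i) ->
  (forall i, (m <= i)%N -> g i = 0) -> \sum_(i < m) g (i + r)%N <= \sum_(i < m) g i.
Proof.
move=> g0 gm; rewrite -!(big_mkord xpredT) -(big_mkord xpredT (fun i => g (i + r)%N)).
have -> : \sum_(0 <= i < m) g (i + r)%N = \sum_(r <= i < m + r) g i.
  by rewrite -{2}[r]add0n big_addn addnK.
have [rm|mr] := leqP r m; last first.
  rewrite [leLHS]big_nat_cond [leLHS]big1; first by apply: sumr_ge0.
  move=> i /andP[/andP[ri _] _].
  by apply: gm; apply: leq_trans ri; exact: ltnW.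
rewrite (big_cat_nat (n := m)) ?leq_addr//= [X in _ + X]big_nat_cond [X in _ + X]big1 ?addr0; last first.
  by move=> i /andP[/andP[mi _] _]; exact: gm.
by rewrite [leRHS](big_cat_nat (n := r))//= lerDr sumr_ge0.
Qed.

Lemma run_change (F : nat -> bool) (i m : nat) :
  (F i != F (i + m)%N)%:R <= \sum_(r < m) (F (i + r.+1)%N != F (i + r)%N)%:R :> R.
Proof.
elim: m => [|m IH]; first by rewrite addn0 eqxx big_ord0.
rewrite big_ord_recr/=; apply: le_trans (lerD IH (lexx _)).
rewrite -natrD ler_nat; by case: (F i); case: (F _); case: (F _).
Qed.

(* Replacing [F] by the indicator of the starting points of runs of length
   [n.+1] costs at most [n] times the number of changes of [F]. *)
Lemma run_count (F : nat -> bool) (m n : nat) (c : R) :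
  (forall i, (m <= i)%N -> F i = false) ->
  \sum_(i < m) (F i.+1 != F i)%:R <= c ->
  let f i := [forall r : 'I_n.+1, F (i + r)%N] in
  \sum_(i < m) (F i)%:R - n%:R * c <= \sum_(i < m) (f i)%:R /\
  \sum_(i < m) (f i.+1 != f i)%:R <= n.+1%:R * c.
Proof.
move=> Fm Fc f.
have chg r : \sum_(i < m) (F (i + r.+1)%N != F (i + r)%N)%:R <= c :> R.
  apply: le_trans Fc.
  have := @sum_shift_le (fun i => (F i.+1 != F i)%:R) m r.
  under eq_bigr do rewrite -addnS.
  by apply => [i|i mi]; [exact: ler0n|rewrite !Fm// ?eqxx//; exact: leqW].
split.
  rewrite lerBlDr; apply: (@le_trans _ _ (\sum_(i < m) ((f i)%:R +
      \sum_(r < n) (F (i + r.+1)%N != F (i + r)%N)%:R))).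
    apply: ler_sum => i _; have [fi|] := boolP (f i).
      by rewrite -[leLHS]addr0 lerD ?lern1 ?leq_b1// sumr_ge0.
    rewrite negb_forall => /existsP[r Fr]; rewrite add0r.
    case Fi : (F i); last by rewrite sumr_ge0.
    apply: (@le_trans _ _ (F i != F (i + r)%N)%:R); first by rewrite Fi (negbTE Fr).
    apply: le_trans (run_change F i r) _.
    rewrite -(big_mkord xpredT (fun r => (F (i + r.+1)%N != F (i + r)%N)%:R)).
    rewrite -(big_mkord xpredT (fun r => (F (i + r.+1)%N != F (i + r)%N)%:R)).
    have rn : (r <= n)%N by rewrite -ltnS.
    by rewrite [leRHS](big_cat_nat (n := r))//= lerDl sumr_ge0.
  rewrite big_split/= lerD2l exchange_big/=.
  apply: le_trans (ler_sum _ (fun (r : 'I_n) _ => chg r)) _.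
  by rewrite sumr_const card_ord mulr_natl.
apply: (@le_trans _ _ (\sum_(i < m) \sum_(r < n.+1) (F (i + r.+1)%N != F (i + r)%N)%:R)).
  apply: ler_sum => i _; rewrite -/(f i) -/(f i.+1).
  case: (f i.+1 =P f i) => [_|/eqP fi]; first by rewrite sumr_ge0.
  (* The runs tested by [f i] and [f i.+1] differ only in their end cells, so they succeed or fail
     together when [F i = F (i + n.+1)]. *)
  apply: le_trans (run_change F i n.+1).
  rewrite ler_nat; move: fi; case: (F i =P F (i + n.+1)%N) => // e; rewrite /f.
  case/eqP; apply/forallP/forallP => h r.
    have [r0|r0] := posnP r; first by rewrite r0 addn0 e -addSnnS; exact: (h ord_max).
    have rn : (r.-1 < n.+1)%N by apply: leq_ltn_trans (ltn_ord r); exact: leq_pred.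
    by have := h (Ordinal rn); rewrite /= addSnnS prednK.
  have [rn|rn] := ltnP r n.
    by have := h (Ordinal (rn : (r.+1 < n.+1)%N)); rewrite /= addSnnS.
  have -> : nat_of_ord r = n by apply/eqP; rewrite eqn_leq rn -ltnS ltn_ord.
  by rewrite addSnnS -e; have := h ord0; rewrite addn0.
rewrite exchange_big/=; apply: le_trans (ler_sum _ (fun (r : 'I_n.+1) _ => chg r)) _.
by rewrite sumr_const card_ord mulr_natl.
Qed.

Lemma block_change (D : nat -> bool) (K k : nat) : (0 < k)%N ->
  (\sum_(i < K * k) (D (i.+1 %/ k) != D (i %/ k)) <= K)%N.
Proof.
move=> k0; apply: (@leq_trans (\sum_(i < K * k) (k %| i.+1))%N).
  apply: leq_sum => i _; rewrite divnS//; case: (k %| _)%N; first exact: leq_b1.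
  by rewrite add0n eqxx.
suff h m : (\sum_(i < m) (k %| i.+1) = m %/ k)%N by rewrite h mulnK.
elim: m => [|m IH]; first by rewrite big_ord0 div0n.
by rewrite big_ord_recr/= divnS// addnC IH.
Qed.

End runs.

Section good_cells.
Variable R : realType.
Notation T := (measurableTypeR R * measurableTypeR R)%type.
Local Notation mu := (borel_measure2 R).
Variables (x0 : T) (W : R).
Hypothesis W0 : 0 < W.
Local Notation cell := (cell x0 W).
Local Notation wm := (wm x0 W).
Local Notation window := (window x0 W).
Local Notation grid_set := (grid_set x0 W).

Lemma wm_split (m : nat) (P : nat -> set T) (V : set T) : measurable V ->
  (forall i, measurable (P i)) -> trivIset setT P ->
  (forall p, window p -> exists2 i, (i < m)%N & P i p) ->
  wm V = \sum_(i < m) wm (V `&` P i).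
Proof.
move=> mV mP tP cP; have mW := measurable_window x0 W0.
apply: EFin_inj; rewrite wmE// -sumEFin.
transitivity (mu (\big[setU/set0]_(i < m) (window `&` (V `&` P i)))).
  congr (mu _); rewrite -(bigcup_mkord m (fun i => window `&` (V `&` P i))); apply/seteqP; split => p.
    by move=> [Wp Vp]; have [i im Pip] := cP p Wp; exists i.
  by move=> [i _ [Wp [Vp _]]].
have mF i : measurable (window `&` (V `&` P i)) by apply: measurableI => //; exact: measurableI.
have tF : trivIset setT (fun i => window `&` (V `&` P i)).
  apply/trivIsetP => i j _ _ ij; move/trivIsetP : tP => /(_ i j I I ij).
  move=> h; apply/seteqP; split => // p [[_ [_ Pi]] [_ [_ Pj]]].
  by have : (P i `&` P j) p by []; rewrite h.
have -> := @measure_bigsetU _ _ _ mu (fun i => window `&` (V `&` P i)) mF tF m.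
by apply: eq_bigr => i _; rewrite wmE//; exact: measurableI.
Qed.

Lemma wm_cells (N : nat) (V : set T) : (0 < N)%N -> measurable V ->
  wm V = \sum_(i < 2 * N) \sum_(j < 2 * N) wm (V `&` cell N i j).
Proof.
move=> N0 mV.
have mc1 i : measurable (band W x0.1 N i `*` [set: measurableTypeR R]).
  by apply: measurableX => //; exact: measurable_band.
have mc2 j : measurable ([set: measurableTypeR R] `*` band W x0.2 N j).
  by apply: measurableX => //; exact: measurable_band.
rewrite (@wm_split (2 * N) (fun i => band W x0.1 N i `*` setT))//.
- apply: eq_bigr => i _.
  rewrite (@wm_split (2 * N) (fun j => setT `*` band W x0.2 N j))//.
  + apply: eq_bigr => j _; congr wm; apply/seteqP; split => p.
      by move=> [[Vp [c1 _]] [_ c2]].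
    by move=> [Vp [c1 c2]].
  + exact: measurableI.
  + apply/trivIsetP => a b _ _ ab; apply/seteqP; split => // p [[_ h1] [_ h2]].
    by move: ab; rewrite (band_uniq h1 h2) eqxx.
  + by move=> p [_ /(seg_band N0)[j jN c]]; exists j.
- apply/trivIsetP => a b _ _ ab; apply/seteqP; split => // p [[h1 _] [h2 _]].
  by move: ab; rewrite (band_uniq h1 h2) eqxx.
- by move=> p [/(seg_band N0)[j jN c] _]; exists j.
Qed.

Lemma cell_window N i j : (0 < N)%N -> (i < 2 * N)%N -> (j < 2 * N)%N ->
  cell N i j `<=` window.
Proof.
move=> N0 iN jN; have NR : 0 < N%:R :> R by rewrite ltr0n.
have aux x a t : (a < 2 * N)%N -> band W x N a t -> seg W x t.
  move=> aN /andP[h1 h2]; apply/andP; split.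
    by rewrite -(pmulr_rge0 _ NR); apply: le_trans h1.
  rewrite -(ltr_pM2l NR); apply: lt_le_trans h2 _.
  by rewrite -natrM ler_nat mulnC.
by move=> p [h1 h2]; split; [exact: aux h1|exact: aux h2].
Qed.

Lemma wm_cell N i j : (0 < N)%N -> (i < 2 * N)%N -> (j < 2 * N)%N ->
  wm (cell N i j) = (W / N%:R) ^+ 2.
Proof.
move=> N0 iN jN; apply: EFin_inj; have mc := measurable_cell x0 W0 i j N0.
rewrite wmE// setIidr; first exact: cell_measure.
exact: cell_window.
Qed.

Definition good (B : set T) (z0 : R) (N : nat) (D : nat -> nat -> bool) (i j : nat) : bool :=
  [&& (i < 2 * N)%N, (j < 2 * N)%N, D i j & wm (cell N i j `\` B) <= z0 * (W / N%:R) ^+ 2].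

(** Markov's inequality: a cell of [D] that is not good has more than the fraction [z0] of its area
    outside [B], and this area is part of the symmetric difference. *)
Lemma good_count (B : set T) (z0 eps : R) (N : nat) (D : nat -> nat -> bool) :
  (0 < N)%N -> measurable B -> 0 < z0 ->
  wm (symd B (grid_set N D)) <= z0 * eps * W ^+ 2 ->
  \sum_(i < 2 * N) \sum_(j < 2 * N) (D i j && ~~ good B z0 N D i j)%:R <= eps * N%:R ^+ 2 /\
  (wm B / W ^+ 2 - z0 * eps) * N%:R ^+ 2 <= \sum_(i < 2 * N) \sum_(j < 2 * N) (D i j)%:R.
Proof.
move=> N0 mB z00 hB; have NR : 0 < N%:R :> R by rewrite ltr0n.
set h2 := (W / N%:R) ^+ 2.
have h20 : 0 < h2 by rewrite exprn_gt0// divr_gt0.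
have hW : W ^+ 2 = h2 * N%:R ^+ 2 by rewrite /h2; field; rewrite gt_eqF.
have mG := @measurable_grid_set R x0 W W0 N D N0.
have mc i j := measurable_cell x0 W0 i j N0.
have GB : wm (grid_set N D `\` B) <= z0 * eps * W ^+ 2.
  apply: le_trans hB; apply: wm_le => //; [exact: measurableD|exact: measurable_symd|].
  by move=> p [_ h]; right.
split.
  rewrite -(ler_pM2r (mulr_gt0 z00 h20)).
  have -> : eps * N%:R ^+ 2 * (z0 * h2) = z0 * eps * W ^+ 2 by rewrite hW; ring.
  apply: le_trans GB; rewrite (wm_cells N0); last exact: measurableD.
  rewrite mulr_suml; apply: ler_sum => i _; rewrite mulr_suml; apply: ler_sum => j _.
  have [/andP[Dij]|_] := boolP (D i j && _); last by rewrite mul0r wm_ge0.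
  rewrite /good !ltn_ord Dij/= -ltNge mul1r => /ltW h.
  apply: le_trans h _; apply: wm_le => //; [exact: measurableD|apply: measurableI => //; exact: measurableD|].
  move=> p [_ [cp nB]]; split => //; split => //.
  by apply/grid_setP; exists i, j.
have GE : wm (grid_set N D) <= \sum_(i < 2 * N) \sum_(j < 2 * N) (D i j)%:R * h2.
  rewrite (wm_cells N0)//; apply: ler_sum => i _; apply: ler_sum => j _.
  have [Dij|nDij] := boolP (D i j).
    rewrite mul1r /h2 -(wm_cell N0 (ltn_ord i) (ltn_ord j)).
    by apply: wm_le => //; [exact: measurableI|move=> p [_ []]].
  rewrite mul0r (_ : _ `&` _ = set0); first by rewrite /wm setI0 measure0.
  apply/seteqP; split => // p [/grid_setP[a [b [Dab c1]]] c2].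
  by have [e1 e2] := cell_uniq c1 c2; rewrite e1 e2 (negbTE nDij) in Dab.
have BG : wm B <= wm (grid_set N D) + wm (symd B (grid_set N D)).
  apply: le_trans (wmU x0 W0 mG (measurable_symd mB mG)); apply: wm_le => //.
    by apply: measurableU => //; exact: measurable_symd.
  move=> p [_ Bp]; have [Gp|Gp] := pselect (grid_set N D p); first by left.
  by right; left.
have GE' : \sum_(i < 2 * N) \sum_(j < 2 * N) (D i j)%:R * h2 =
    (\sum_(i < 2 * N) \sum_(j < 2 * N) (D i j)%:R) * h2.
  by rewrite mulr_suml; apply: eq_bigr => i _; rewrite mulr_suml.
rewrite GE' in GE.
rewrite -(ler_pM2r h20); apply: le_trans GE.
have -> : (wm B / W ^+ 2 - z0 * eps) * N%:R ^+ 2 * h2 = wm B - z0 * eps * W ^+ 2.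
  by rewrite hW; field; rewrite !gt_eqF.
by rewrite lerBlDr; apply: le_trans BG _; rewrite lerD2l.
Qed.

Lemma good_range (B : set T) (z0 : R) (N : nat) (D : nat -> nat -> bool) i j :
  (0 < N)%N -> measurable B -> B `<=` `[x0.1, x0.1 + W] `*` `[x0.2, x0.2 + W] ->
  z0 < 1 -> good B z0 N D i j -> (i <= N)%N /\ (j <= N)%N.
Proof.
move=> N0 mB Bsq z01 /and4P[iN jN Dij h].
have NR : 0 < N%:R :> R by rewrite ltr0n.
have h20 : 0 < (W / N%:R) ^+ 2 by rewrite exprn_gt0// divr_gt0.
have mc := measurable_cell x0 W0 i j N0.
have [p [cp Bp]] : exists p, cell N i j p /\ B p.
  apply: contrapT => hn.
  have e : cell N i j `\` B = cell N i j.
    apply/seteqP; split => p; first by case.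
    by move=> cp; split => // Bp; apply: hn; exists p.
  by move: h; rewrite e wm_cell// leNgt gtr_pMl// z01.
have aux x t a : band W x N a t -> x <= t <= x + W -> (a <= N)%N.
  move=> /andP[h1 _] /andP[_ h3]; rewrite -(ler_nat R); apply: le_trans h1 _.
  by rewrite ger_pMr// ler_pdivrMr// mul1r lerBlDl.
have [/= b1 b2] := Bsq p Bp; rewrite !in_itv/= in b1 b2.
by split; [exact: aux cp.1 b1|exact: aux cp.2 b2].
Qed.

(** A grid approximation with mesh [W / K] is refined by a large factor [k], so its indicator
    changes at most [2 * K] times in a row of [2 * N] cells, [N = K * k]. As bad cells are few,
    goodness also changes rarely, and most good cells start a run. The density bound is half of
    [d * N^2]. *)
Lemma good_cells (B : set T) (d zeta z0 : R) (n N0 : nat) :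
  measurable B -> B `<=` `[x0.1, x0.1 + W] `*` `[x0.2, x0.2 + W] ->
  0 < d -> d * W ^+ 2 <= wm B -> 0 < zeta -> 0 < z0 < 1 ->
  exists (N : nat) (f : nat -> nat -> bool), [/\ (N0 <= N)%N, (0 < N)%N &
  [/\ forall i j, f i j -> [/\ (i <= N)%N, (j <= N)%N & forall r, (r <= n)%N ->
         [/\ (i + r <= N)%N & wm (cell N (i + r) j `\` B) <= z0 * (W / N%:R) ^+ 2]],
      d / 8 * (2 * N)%:R ^+ 2 <= \sum_(i < 2 * N) \sum_(j < 2 * N) (f i j)%:R &
      \sum_(i < 2 * N) \sum_(j < 2 * N) (f (i.+1 %% (2 * N))%N j != f i j)%:R <=
         zeta * (2 * N)%:R ^+ 2]].
Proof.
move=> mB Bsq d0 dB zeta0 /andP[z00 z01].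
pose th := Num.min d zeta / (16 * n.+1%:R).
have n1 : 1 <= n.+1%:R :> R by rewrite ler1n.
have n16 : 0 < 16 * n.+1%:R :> R by lra.
have th0 : 0 < th by rewrite divr_gt0// lt_min d0.
have thd : 16 * n.+1%:R * th <= d.
  by rewrite /th mulrC divfK ?gt_eqF// ge_min lexx.
have thz : 16 * n.+1%:R * th <= zeta.
  by rewrite /th mulrC divfK ?gt_eqF// ge_min lexx orbT.
have [_ /(_ (z0 * th * W ^+ 2))[|K [D [K0 hD]]]] := measurable_grid_approx x0 W0 mB.
  by rewrite mulr_gt0 ?exprn_gt0// mulr_gt0.
pose k := (N0 + (Num.truncn (4 / th)).+1)%N.
have k0 : (0 < k)%N by rewrite /k addnS.
have kth : 4 <= k%:R * th.
  have /andP[_ /ltW] := @truncn_itv R (4 / th) ltac:(by rewrite divr_ge0// ltW).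
  rewrite ler_pdivrMr// => h; apply: le_trans h _; rewrite ler_pM2r// ler_nat.
  exact: leq_addl.
pose N := (K * k)%N.
have N_gt0 : (0 < N)%N by rewrite muln_gt0 K0.
have NR : 0 < N%:R :> R by rewrite ltr0n.
pose D' i j := D (i %/ k)%N (j %/ k)%N.
have hD' : wm (symd B (grid_set N D')) <= z0 * th * W ^+ 2.
  apply: le_trans hD; have mG M E (M0 : (0 < M)%N) := @measurable_grid_set R x0 W W0 M E M0.
  apply: wm_le => //; [by apply: measurable_symd => //; exact: mG|by apply: measurable_symd => //; exact: mG|].
  move=> p [Wp]; have [h1 h2] := grid_set_refine D K0 k0 Wp.
  by case=> [[Bp nG]|[/h2 Gp nB]]; [left; split => // /h1|right].
have [bad_le D_ge] := good_count N_gt0 mB z00 hD'.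
pose F j i := good B z0 N D' i j.
pose f i j := [forall r : 'I_n.+1, F j (i + r)%N].
have FN j i : F j i -> (i <= N)%N /\ (j <= N)%N by exact: good_range.
pose bad i j := D' i j && ~~ good B z0 N D' i j.
have badS : \sum_(j < 2 * N) \sum_(i < 2 * N) (bad i j)%:R <= th * N%:R ^+ 2.
  by rewrite exchange_big.
have F2N j i : (2 * N <= i)%N -> F j i = false.
  by move=> Ni; apply/negP => /and4P[]; rewrite ltnNge Ni.
pose c j : R := \sum_(i < 2 * N) (F j i.+1 != F j i)%:R.
have last1 : \sum_(i < 2 * N) (i.+1 == 2 * N)%N%:R <= 1 :> R.
  suff h m : \sum_(i < m) (i.+1 == m)%N%:R <= 1 :> R by exact: h.
  case: m => [|m]; first by rewrite big_ord0.
  rewrite big_ord_recr/= eqxx big1 ?add0r// => i _.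
  by rewrite eqSS ltn_eqF.
have cj (j : 'I_(2 * N)) : c j <= (2 * K)%:R + 1 + 2 * \sum_(i < 2 * N) (bad i j)%:R.
  have bc := @block_change (fun a => D a (j %/ k)%N) (2 * K) k k0.
  rewrite -mulnA -/N in bc.
  have bcR : \sum_(i < 2 * N) (D' i.+1 j != D' i j)%:R <= (2 * K)%:R :> R.
    by rewrite -natr_sum ler_nat.
  have sh : \sum_(i < 2 * N) ((i.+1 < 2 * N)%N && bad i.+1 j)%:R <= \sum_(i < 2 * N) (bad i j)%:R :> R.
    pose g i : R := ((i < 2 * N)%N && bad i j)%:R.
    have -> : \sum_(i < 2 * N) (bad i j)%:R = \sum_(i < 2 * N) g i.
      by apply: eq_bigr => i _; rewrite /g ltn_ord.
    apply: le_trans (@sum_shift_le R g (2 * N) 1 _ _).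
    - by apply: ler_sum => i _; rewrite addn1.
    - by move=> i; exact: ler0n.
    - by move=> i Ni; rewrite /g ltnNge Ni.
  (* Goodness changes only where [D'] changes, next to a bad cell, or at the right end of the
     row. *)
  apply: (@le_trans _ _ (\sum_(i < 2 * N) ((D' i.+1 j != D' i j)%:R + (bad i j)%:R +
      ((i.+1 < 2 * N)%N && bad i.+1 j)%:R + (i.+1 == 2 * N)%N%:R))); last first.
    by rewrite !big_split/=; move: bcR sh last1; clear; lra.
  apply: ler_sum => i _; rewrite -!natrD ler_nat /bad -/(F j i) -/(F j i.+1).
  have := ltn_ord i; rewrite leq_eqVlt => /orP[/eqP->|i1].
    by rewrite eqxx addn1; apply: leq_trans (leq_b1 _) _.
  have Dle a : F j a -> D' a j by move=> /and4P[].
  rewrite i1 (ltn_eqF i1) addn0; move: (Dle i) (Dle i.+1).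
  by case: (F j i); case: (F j i.+1); case: (D' i j); case: (D' i.+1 j) => //= h1 h2;
    first [have := h1 isT | have := h2 isT].
have N1k : k%:R <= N%:R :> R by rewrite ler_nat /N leq_pmull.
have Nth : 4 <= N%:R * th by apply: le_trans kth _; rewrite ler_pM2r.
have NKk : N%:R = K%:R * k%:R :> R by rewrite /N natrM.
have Kth : 4 * K%:R <= N%:R * th by rewrite NKk -mulrA mulrC ler_wpM2l.
have cS : \sum_(j < 2 * N) c j <= 4 * th * N%:R ^+ 2.
  apply: le_trans (ler_sum _ (fun j _ => cj j)) _.
  rewrite big_split/= sumr_const card_ord -mulr_sumr -[_ *+ _]mulr_natr.
  have : 4 * K%:R * N%:R <= N%:R * th * N%:R by rewrite ler_pM2r.
  have : 4 * N%:R <= N%:R * th * N%:R by rewrite ler_pM2r.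
  rewrite (natrM _ 2 K) (natrM _ 2 N) expr2; rewrite expr2 in badS.
  move: badS (ltW NR); move: (\sum_(j < 2 * N) _) (N%:R : R) (K%:R : R) (th) => S x y t; clear; lra.
have run j : \sum_(i < 2 * N) (F j i)%:R - n%:R * c j <= \sum_(i < 2 * N) (f i j)%:R /\
    \sum_(i < 2 * N) (f i.+1 j != f i j)%:R <= n.+1%:R * c j.
  exact: (@run_count R (F j) (2 * N) n (c j) (F2N j) (lexx _)).
exists N, f; split => //.
  have Nk : (k <= N)%N by rewrite /N leq_pmull.
  by apply: leq_trans Nk; exact: leq_addr.
split.
- move=> i j /forallP fij; have [i1 j1] := FN _ _ (fij ord0); rewrite addn0 in i1.
  split => // r rn; have Fr := fij (Ordinal (rn : (r < n.+1)%N)).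
  by split; [exact: (FN _ _ Fr).1|case/and4P: Fr].
- rewrite exchange_big/=.
  apply: (@le_trans _ _ (\sum_(j < 2 * N) (\sum_(i < 2 * N) (F j i)%:R - n%:R * c j))); last first.
    by apply: ler_sum => j _; exact: (run j).1.
  have -> : \sum_(j < 2 * N) (\sum_(i < 2 * N) (F j i)%:R - n%:R * c j) =
      \sum_(j < 2 * N) \sum_(i < 2 * N) (F j i)%:R - n%:R * \sum_(j < 2 * N) c j.
    by rewrite sumrB -mulr_sumr.
  have FD : \sum_(i < 2 * N) \sum_(j < 2 * N) (D' i j)%:R - th * N%:R ^+ 2 <=
      \sum_(j < 2 * N) \sum_(i < 2 * N) (F j i)%:R.
    rewrite lerBlDr; apply: le_trans (lerD (lexx _) badS).
    rewrite exchange_big/= -big_split/=; apply: ler_sum => j _.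
    rewrite -big_split/=; apply: ler_sum => i _; rewrite -natrD ler_nat /bad -/(F j i).
    by case: (D' i j); case: (F j i).
  have dW : d <= wm B / W ^+ 2 by rewrite ler_pdivlMr// exprn_gt0.
  have N20 : 0 <= N%:R ^+ 2 :> R by exact: sqr_ge0.
  have h1 : (d - th) * N%:R ^+ 2 <= (wm B / W ^+ 2 - z0 * th) * N%:R ^+ 2.
    by rewrite ler_wpM2r// lerB// ger_pMl// ltW.
  have h2 : n%:R * \sum_(j < 2 * N) c j <= n%:R * (4 * th * N%:R ^+ 2) by rewrite ler_wpM2l.
  have h3 : 16 * n.+1%:R * th * N%:R ^+ 2 <= d * N%:R ^+ 2 by rewrite ler_wpM2r.
  have h4 : 0 <= th * N%:R ^+ 2 by rewrite mulr_ge0// ltW.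
  have h5 : 0 <= d * N%:R ^+ 2 by rewrite mulr_ge0// ltW.
  rewrite (natrM _ 2 N) exprMn; move: (le_trans h1 D_ge) h2 h3 h4 h5 FD; rewrite -(natr1 n).
  move: (N%:R ^+ 2 : R) (th) => x t; clear; lra.
- rewrite exchange_big/=.
  apply: (@le_trans _ _ (\sum_(j < 2 * N) (n.+1%:R * c j + 1))).
    apply: ler_sum => j _.
    (* On the torus the last column is followed by the first; this seam costs at most 1 per row. *)
    apply: (@le_trans _ _ (\sum_(i < 2 * N) ((f i.+1 j != f i j)%:R + (i.+1 == 2 * N)%N%:R))).
      apply: ler_sum => i _; have := ltn_ord i; rewrite leq_eqVlt => /orP[/eqP->|i1].
        by rewrite eqxx -[leLHS]add0r lerD// lern1 leq_b1.
      by rewrite modn_small// lerDl.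
    by rewrite big_split/= lerD//; exact: (run j).2.
  rewrite big_split/= -mulr_sumr sumr_const card_ord.
  have h2 : n.+1%:R * \sum_(j < 2 * N) c j <= n.+1%:R * (4 * th * N%:R ^+ 2) by rewrite ler_wpM2l.
  have h3 : 16 * n.+1%:R * th * N%:R ^+ 2 <= zeta * N%:R ^+ 2 by rewrite ler_wpM2r// sqr_ge0.
  have h4 : 0 <= zeta * N%:R ^+ 2 by rewrite mulr_ge0 ?sqr_ge0// ltW.
  have h5 : 4 * N%:R <= th * N%:R ^+ 2 by rewrite expr2 mulrA [th * _]mulrC ler_pM2r.
  have h6 : th * N%:R ^+ 2 <= n.+1%:R * th * N%:R ^+ 2.
    by rewrite ler_wpM2r ?sqr_ge0// ler_peMl// ltW.
  rewrite (natrM _ 2 N) exprMn; move: h2 h3 h4 h5 h6.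
  move: (N%:R : R) (th) => x t; clear; lra.
Qed.

End good_cells.

(** * From good cells to points *)

(** At the first index where [r] and [r'] differ, one sum gains [u i], more than all later indices
    can contribute. *)
Lemma subset_sum_inj (n : nat) (u : 'I_n -> nat) :
  (forall i : 'I_n, \sum_(j < n | i < j) u j < u i)%N ->
  injective (fun r : {ffun 'I_n -> bool} => \sum_(i < n | r i) u i)%N.
Proof.
move=> hu r r' e; apply/ffunP => i0; apply/eqP/negPn/negP => ne0.
have [i ne min_i] := @arg_minnP _ i0 (fun i => r i != r' i) (fun i => i : nat) ne0.
have eq_lt (j : 'I_n) : (j < i)%N -> r j = r' j.
  by move=> ji; apply/eqP/negPn/negP => /min_i; rewrite leqNgt ji.
suff aux (s s' : {ffun 'I_n -> bool}) : s i -> ~~ s' i ->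
    (forall j : 'I_n, (j < i)%N -> s j = s' j) ->
    (\sum_(j < n | s' j) u j < \sum_(j < n | s j) u j)%N.
  move: ne e; case ri: (r i); case r'i: (r' i) => // _ /= e.
  - by have := aux r r'; rewrite ri r'i e ltnn => /(_ isT isT eq_lt).
  - by have := aux r' r; rewrite ri r'i e ltnn => /(_ isT isT (fun j h => esym (eq_lt j h))).
move=> si s'i ss'; rewrite (bigID (fun j : 'I_n => (j < i)%N))/=.
rewrite [ltnRHS](bigID (fun j : 'I_n => (j < i)%N))/=.
rewrite (eq_bigl (fun j : 'I_n => s j && (j < i)%N)); last first.
  by move=> j; case ji: (j < i)%N; rewrite ?andbF// (ss' _ ji).
rewrite ltn_add2l.
apply: (@leq_trans (u i)); last first.
  by rewrite (bigD1 i)/= ?si ?ltnn// leq_addr.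
apply: leq_ltn_trans (hu i); rewrite big_mkcond/= [leqRHS]big_mkcond/=.
apply: leq_sum => j _; case: ltngtP => [| |/val_inj ->]; rewrite ?andbF//.
- by case: ifP.
- by rewrite (negbTE s'i).
Qed.

Lemma arc_tail_lt (R : archiRcfType) (l : R) (n : nat) (u : 'I_n -> nat) : 0 < l ->
  (forall i : 'I_n, arc_lo l i <= u i < arc_lo l i + arc_num l i)%N ->
  forall i : 'I_n, (\sum_(j < n | (i < j)%N) u j < u i)%N.
Proof.
move=> l0 hu i; rewrite -(ltr_nat R) natr_sum.
pose x m : R := l / 4 ^+ m.
have x0 m : 0 < x m by rewrite divr_gt0// exprn_gt0.
have xS m : x m = 4 * x m.+1 by rewrite /x exprS; field; rewrite gt_eqF// exprn_gt0.
have ux (j : 'I_n) : (u j)%:R <= 2 * x j.+2.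
  have /andP[_] := hu j; rewrite /arc_lo /arc_num -/(x j.+2) addSn ltnS -(ler_nat R) natrD.
  have /andP[h _] := truncn_itv (ltW (x0 j.+2)); lra.
have xu : x i.+2 < (u i)%:R.
  have /andP[+ _] := hu i; rewrite /arc_lo -/(x i.+2) -(ler_nat R).
  have /andP[_ h] := truncn_itv (ltW (x0 i.+2)); exact: lt_le_trans.
apply: le_lt_trans xu.
(* The bound telescopes, as [2 * x m.+2 <= x m.+1 - x m.+2] by [x m.+1 = 4 * x m.+2]. *)
suff h m : \sum_(j < m | (i < j)%N) 2 * x j.+2 <= x i.+2 - (if (i < m)%N then x m.+1 else x i.+2).
  apply: le_trans (ler_sum _ (fun j _ => ux j)) _.
  apply: le_trans (h n) _; rewrite ltn_ord; have := x0 n.+1; lra.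
elim: m => [|m IH]; first by rewrite big_ord0 ltn0 subrr.
rewrite big_mkcond big_ord_recr/= -big_mkcond/= ltnS.
move: IH; case: (ltngtP i m) => [im|mi|->] IH; move: (xS m.+1) (x0 m.+2) IH; lra.
Qed.

Section vertices.
Variable R : realType.
Notation T := (measurableTypeR R * measurableTypeR R)%type.
Local Notation mu := (borel_measure2 R).
Variables (x0 : T) (W : R).
Hypothesis W0 : 0 < W.
Local Notation cell := (cell x0 W).
Local Notation wm := (wm x0 W).

(** The unknown positions of [t] in its band and of [s] in [[F, F + n]] leave [n + 1] possible
    bands. *)
Lemma band_shift (x : R) (N n a F : nat) (s t : R) : (0 < N)%N ->
  F%:R <= s <= (F + n)%:R -> band W x N a t ->
  exists2 k, (k <= n)%N & band W x N (a + F + k) (t + W / N%:R * s).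
Proof.
move=> N0 /andP[Fs sF]; have NR : N%:R != 0 :> R by rewrite pnatr_eq0 -lt0n.
rewrite /band /=.
have -> : N%:R * ((t + W / N%:R * s - x) / W) = N%:R * ((t - x) / W) + s.
  by field; rewrite NR gt_eqF.
move: (N%:R * _) => y /andP[ay ya].
have lo : (a + F)%:R <= y + s by rewrite natrD lerD.
have y0 : 0 <= y + s by apply: le_trans lo; exact: ler0n.
have /andP[h1 h2] := truncn_itv y0.
have aF : (a + F <= Num.truncn (y + s))%N.
  by rewrite -ltnS -(ltr_nat R); exact: le_lt_trans lo h2.
exists (Num.truncn (y + s) - (a + F))%N; last by rewrite subnKC// h1.
rewrite leq_subLR -ltnS -(ltr_nat R); apply: le_lt_trans h1 _.
have -> : (a + F + n).+1 = (a.+1 + (F + n))%N by lia.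
by rewrite natrD ltr_leD.
Qed.

Lemma bigcup_measure_le (I : finType) (A : I -> set T) (e : R) :
  (forall i, measurable (A i)) -> (forall i, (mu (A i) <= e%:E)%E) ->
  (mu (\bigcup_i A i) <= (#|I|%:R * e)%:E)%E.
Proof.
move=> mA hA.
have -> : \bigcup_i A i = \bigcup_(i in [set` enum I]) A i.
  by apply/seteqP; split => p [i _ Aip]; exists i => //=; rewrite mem_enum.
rewrite bigcup_seq cardE; elim: (enum I) => [|i s IH].
  by rewrite big_nil measure0/= mul0r.
rewrite big_cons /= -natr1 mulrDl mul1r addrC EFinD.
apply: le_trans (measureU2 _ (mA i) _) _; last by apply: leeD; [exact: hA|exact: IH].
by elim/big_ind: _ => //; exact: measurableU.
Qed.

(** A union bound: each of the [2 ^ n * (n + 1)] pairs of a vertex and a possible cell excludes, by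
    translation invariance, a set of at most [z0] times the area of a cell. So some point of the
    cell [(a, b)] survives. *)
Lemma common_shift_point (B : set T) (n N a b : nat) (l z0 : R) (u : 'I_n -> nat) :
  (0 < N)%N -> measurable B -> 2 ^+ n * n.+1%:R * z0 < 1 ->
  (forall r : {ffun 'I_n -> bool}, forall k, (k <= n)%N ->
    [/\ (a + \sum_(i < n | r i) farc l (u i) + k <= N)%N,
        (b + \sum_(i < n | r i) u i <= N)%N &
        wm (cell N (a + \sum_(i < n | r i) farc l (u i) + k) (b + \sum_(i < n | r i) u i) `\` B)
          <= z0 * (W / N%:R) ^+ 2]) ->
  exists p : T, forall r : {ffun 'I_n -> bool},
    B (shift2 (W / N%:R * \sum_(i < n | r i) arc l (u i)%:R,
               W / N%:R * (\sum_(i < n | r i) u i)%:R) p).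
Proof.
move=> N0 mB z0n hr.
pose F (r : {ffun 'I_n -> bool}) := (\sum_(i < n | r i) farc l (u i))%N.
pose U (r : {ffun 'I_n -> bool}) := (\sum_(i < n | r i) u i)%N.
pose V (r : {ffun 'I_n -> bool}) : T :=
  (W / N%:R * \sum_(i < n | r i) arc l (u i)%:R, W / N%:R * (U r)%:R).
pose E (r : {ffun 'I_n -> bool}) k := cell N (a + F r + k) (b + U r) `\` B.
pose I : finType := ({ffun 'I_n -> bool} * 'I_n.+1)%type.
pose bad (i : I) : set T := shift2 (V i.1) @^-1` E i.1 i.2.
have mE r k : measurable (E r k) by apply: measurableD => //; exact: measurable_cell.
have mbad i : measurable (bad i).
  by rewrite -[X in measurable X]setTI; apply: measurable_shift2.
have mubad i : (mu (bad i) <= (z0 * (W / N%:R) ^+ 2)%:E)%E.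
  case: i => r [k kn]; rewrite borel_measure2_shift//=.
  have [h1 h2 h3] := hr r k kn.
  have h3' : ((wm (E r k))%:E <= (z0 * (W / N%:R) ^+ 2)%:E)%E by rewrite lee_fin.
  apply: le_trans h3'; rewrite wmE// setIidr//.
  have lt2N m : (m <= N)%N -> (m < 2 * N)%N by move: N0; clear; lia.
  by apply: subset_trans (cell_window N0 (lt2N _ h1) (lt2N _ h2)); exact: subDsetl.
have cardI : #|{: I}|%:R = 2 ^+ n * n.+1%:R :> R.
  by rewrite card_prod card_ffun card_bool !card_ord natrM natrX.
have h20 : 0 < (W / N%:R) ^+ 2 by rewrite exprn_gt0// divr_gt0// ltr0n.
apply: contrapT => hn.
have : (mu (cell N a b) <= mu (\bigcup_i bad i))%E.
  apply: le_measure; rewrite ?inE; [exact: measurable_cell| |].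
    by apply: fin_bigcup_measurable => //; exact: finite_finset.
  move=> p [c1 c2]; apply: contrapT => np; apply: hn; exists p => r.
  apply: contrapT => nB; apply: np.
  have sF : (F r)%:R <= \sum_(i < n | r i) arc l (u i)%:R <= (F r + n)%:R.
    rewrite /F natr_sum; apply/andP; split.
      by apply: ler_sum => i _; have /andP[] := farc_itv l (u i).
    apply: (@le_trans _ _ (\sum_(i < n | r i) ((farc l (u i))%:R + 1))).
      by apply: ler_sum => i _; have /andP[_ /ltW] := farc_itv l (u i).
    rewrite big_split/= natrD natr_sum lerD2l sumr_const ler_nat.
    by apply: leq_trans (max_card _) _; rewrite card_ord.
  have [k kn ck] := band_shift N0 sF c1.
  (* Heights are integers in units of the mesh, so the vertical index is exact. *)
  have [|k' k'0 ck'] := @band_shift x0.2 N 0 b (U r) (U r)%:R p.2 N0 _ c2.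
    by rewrite addn0 lexx.
  move: k'0 ck'; rewrite leqn0 => /eqP ->; rewrite addn0 => ck'.
  by exists (r, Ordinal (kn : (k < n.+1)%N)).
apply/negP; rewrite -ltNge cell_measure//.
apply: le_lt_trans (bigcup_measure_le mbad mubad) _.
by rewrite lte_fin cardI mulrA gtr_pMl.
Qed.

Lemma square_measure (x : T) (r : R) : 0 < r ->
  measurable (square x r : set T) /\ mu (square x r) = (r ^+ 2)%:E.
Proof.
move=> r0.
have mi (c : R) : measurable (`[c, c + r]%classic : set (measurableTypeR R)).
  exact: measurable_itv.
split; first exact: measurableX.
rewrite /square borel_measure2X// !lebesgue_measure_itv/= !lte_fin !ltrDl r0 -!EFinB -EFinM.
by congr (_%:E); rewrite expr2; congr (_ * _); ring.
Qed.

End vertices.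

Lemma cube_vertex_fst (R : realType) n (x : R * R) (y : 'I_n -> R * R) r :
  (cube_vertex x y r).1 = x.1 + \sum_(i < n | r i) (y i).1.
Proof.
rewrite [in RHS]big_mkcond; congr (_ + _).
elim/big_rec2: _ => // i v c _ <-; congr (_ + _).
by case: (r i); rewrite /= ?scale1r ?scale0r.
Qed.

Lemma cube_vertex_snd (R : realType) n (x : R * R) (y : 'I_n -> R * R) r :
  (cube_vertex x y r).2 = x.2 + \sum_(i < n | r i) (y i).2.
Proof.
rewrite [in RHS]big_mkcond; congr (_ + _).
elim/big_rec2: _ => // i v c _ <-; congr (_ + _).
by case: (r i); rewrite /= ?scale1r ?scale0r.
Qed.

Theorem theorem1 (R : realType) (n : nat) (n_gt0 : (0 < n)%N)
    (A : set (R * R)) (mA : lebesgue_measurable2 A)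
    (dA : (0 < upper_banach_density A)%E) :
  exists lambda0 : R, 0 < lambda0 /\
    forall lambda : R, lambda0 <= lambda -> contains_cube_graph n lambda A.
Proof.
have [d /andP[d0 d1] hd] := upper_density_square dA.
(* [d / 2] will be the density of the Borel subset [B]; the factor [1 / 8] comes from
   [good_cells]. *)
have d2 : 0 < d / 2 / 8 <= 1 by apply/andP; split; lra.
have [zeta [C [l0 [J [zeta0 C1 l01 core]]]]] := torus_core n_gt0 d2.
apply: contrapT => hn.
have bad M : exists2 lam : R, M <= lam & ~ contains_cube_graph n lam A.
  apply: contrapT => hM; apply: hn; exists (Num.max M 1).
  split; first by rewrite lt_max ltr01 orbT.
  move=> lam; rewrite ge_max => /andP[Mlam _]; apply: contrapT => nc.
  by apply: hM; exists lam.
have [nxt hnxt] := choice (fun M => let: ex_intro2 x h1 h2 := bad M in ex_intro _ x (conj h1 h2)).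
(* [C] and [J] depend only on [d] and [n], so the failing scales are fixed before the square and the
   grid. *)
pose lam j := iter j (fun x => nxt (C * x)) (nxt 1).
have lam_bad j : ~ contains_cube_graph n (lam j) A by case: j => [|j]; exact: (hnxt _).2.
have lamC j : C * lam j <= lam j.+1 by exact: (hnxt _).1.
have lam1 j : 1 <= lam j.
  elim: j => [|j IH]; first exact: (hnxt _).1.
  by apply: le_trans (lamC j); rewrite mulr_ege1.
have lam0 j : 0 < lam j by apply: lt_le_trans (lam1 j).
have lam_mono : {homo lam : i j / (i <= j)%N >-> i <= j}.
  apply: homo_leq => // [y x z|j]; first exact: le_trans.
  by apply: le_trans (lamC j); rewrite ler_peMl// ltW.
(* With this [W] any [n] edges together are shorter than [W], that is, than [N] mesh lengths. *)
have [W [x [W0W W0 hW]]] := hd (n.+1%:R * lam J).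
have [mQ muQ] := square_measure x W0.
have e0 : 0 < d / 2 * W ^+ 2 by rewrite mulr_gt0 ?exprn_gt0// divr_gt0.
have [|B [mB BA hB]] := borel_inner e0 mA mQ; first by rewrite muQ ltry.
have Bsq : B `<=` square x W by move=> p /BA[].
have Bwin : B `<=` window x W.
  apply: subset_trans Bsq _ => p [/=]; rewrite !in_itv/= => /andP[h1 h2] /andP[h3 h4].
  by split; rewrite /seg/= ler_pdivlMr// ltr_pdivrMr//; apply/andP; split; lra.
have wB : d / 2 * W ^+ 2 <= wm x W B.
  have muB : (wm x W B)%:E = borel_measure2 R B by rewrite wmE// setIidr.
  have := le_trans hW hB; rewrite -muB -EFinD lee_fin; lra.
have p2 : 0 < 2 ^+ n * n.+1%:R :> R by rewrite mulr_gt0// exprn_gt0.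
(* Half of the threshold in the union bound of [common_shift_point]. *)
pose z0 : R := (2 * (2 ^+ n * n.+1%:R))^-1.
have z0n : 2 ^+ n * n.+1%:R * z0 < 1.
  rewrite /z0 invfM mulrCA divff ?gt_eqF// mulr1; lra.
have z01 : 0 < z0 < 1.
  have p1 : 1 <= 2 ^+ n * n.+1%:R :> R by rewrite mulr_ege1 ?exprn_ege1 ?ler1n.
  by apply/andP; rewrite /z0; split; [rewrite invr_gt0|rewrite invf_lt1]; lra.
have d20 : 0 < d / 2 by rewrite divr_gt0.
have [N [f [N0N N0 [hf fd fz]]]] :=
  good_cells W0 n (Num.truncn (l0 * W / lam 0%N)).+1 mB Bsq d20 wB zeta0 z01.
have NR : 0 < N%:R :> R by rewrite ltr0n.
(* Radii in units of the mesh; [N] is large enough for the smallest one to reach [l0]. *)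
pose ls j := lam j * N%:R / W.
have ls0 : l0 <= ls 0%N.
  have /andP[_ h] := @truncn_itv R (l0 * W / lam 0%N) ltac:(by rewrite divr_ge0 ?mulr_ge0 ?ltW//; lra).
  have : l0 * W / lam 0%N < N%:R by apply: lt_le_trans h _; rewrite ler_nat.
  by rewrite /ls ler_pdivlMr// ltr_pdivrMr// mulrC => /ltW; rewrite [N%:R * _]mulrC [W * _]mulrC.
have lsC j : C * ls j <= ls j.+1.
  by rewrite /ls !mulrA ler_pM2r ?invr_gt0// ler_pM2r.
have lsN j : (j < J)%N -> n%:R * ls j < N%:R.
  move=> /ltnW /lam_mono jJ; rewrite /ls !mulrA ltr_pdivrMr// mulrC ltr_pM2l//.
  apply: lt_le_trans W0W; apply: (@le_lt_trans _ _ (n%:R * lam J)); first by rewrite ler_wpM2l.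
  by rewrite ltr_pM2r// ltr_nat.
have hfN i j : f i j -> (i <= N)%N /\ (j <= N)%N by move=> /hf[].
have [j [jJ [u [a [b [hu hfr]]]]]] := core N f ls N0 ls0 lsC lsN hfN fd fz.
have lsj : 0 < ls j by rewrite divr_gt0// mulr_gt0.
have [|p hp] := @common_shift_point R x W W0 B n N a b (ls j) z0 u N0 mB z0n.
  by move=> r k kn; have [_ jN /(_ k kn)[]] := hf _ _ (hfr r).
apply: (lam_bad j).
pose tau := W / N%:R; have tau0 : 0 < tau by rewrite divr_gt0.
have tls : tau * ls j = lam j by rewrite /tau /ls; field; rewrite !gt_eqF.
pose y (i : 'I_n) : R * R := (tau * arc (ls j) (u i)%:R, tau * (u i)%:R).
exists p, y; split.
- move=> i; have /andP[_ hi] := hu i.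
  have ul : (0 : R) <= (u i)%:R <= ls j by rewrite ler0n (arc_num_le (ltW lsj) hi).
  have e : (y i).1 ^+ 2 + (y i).2 ^+ 2 = (tau * ls j) ^+ 2.
    have := arc_sqr ul; rewrite /y /=; move: (arc _ _) (tau) => c t h.
    by rewrite [RHS]exprMn -(subrK ((u i)%:R ^+ 2) (ls j ^+ 2)) -h; ring.
  by rewrite /euclidean_norm e tls sqrtr_sqr gtr0_norm.
- move=> r; have [+ _] := BA _ (hp r); congr A.
  rewrite [RHS]surjective_pairing cube_vertex_fst cube_vertex_snd /shift2 /shiftR /=.
  by rewrite natr_sum !mulr_sumr.
- move=> r r' /(congr1 snd); rewrite !cube_vertex_snd /= -!mulr_sumr -!natr_sum.
  move=> /addrI /(mulfI (lt0r_neq0 tau0)) /eqP; rewrite eqr_nat => /eqP.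
  exact: (subset_sum_inj (arc_tail_lt lsj hu)).
Qed.
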